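(* Assume that $J$ is bounded below by a strictly positive number on some neighborhood of the origin. Let $m(x,y)$ be any solution of the Euler–Lagrange equation for the minimization of $\mathcal{F}$ that belongs to $\mathcal{M}_{-a,a,\Omega}$. Then for some $x_0\in\mathbb{R}$, $$m(x,y)=\bar m(x-x_0)\quad\text{for all }x\in\mathbb{R}\text{ and }y\in\mathbb{R}^{d-1},$$ where $\bar m$ is the antisymmetric minimizer of the corresponding one-dimensional problem.
   Context: Let $a>0$, $d\ge2$, $L>0$, and let $\Omega$ be a $(d-1)$-dimensional cube of side $L$ spanned by the orthogonal directions $e_1,\dots,e_{d-1}$ of $\mathbb{R}^{d-1}$. $\mathcal{C}_{-a,a,\Omega}$ is the set of continuous functions $m:\mathbb{R}\times\mathbb{R}^{d-1}\to\mathbb{R}$ such that $\lim_{x\to-\infty}m(x,y)=-a$ and $\lim_{x\to+\infty}m(x,y)=a$ for every $y$, and $m(x,y+Le_k)=m(x,y)$ for all $k,x,y$. $\mathcal{M}_{-a,a,\Omega}$ is the subset of those $m$ for which $x\mapsto m(x,y)$ is monotone (increasing) for each $y$. $F:\mathbb{R}\to[0,\infty)$ is a (differentiable) even double well potential with minima at $\pm a$: $F(\pm a)=0$ and $F>0$ elsewhere. $J(x,y)=U(\sqrt{x^2+|y|^2})$, with $U:[0,\infty)\to[0,\infty)$ monotone decreasing, smooth and of finite range; differences of $y$-variables are understood periodically, i.e. in $\mathbb{R}^{d-1}/L\mathbb{Z}^{d-1}$, with $|y|$ the distance to $0$ there. The free energy is $$\mathcal{F}(m)=\int_{\mathbb{R}\times\Omega}F(m(x,y))\,dx\,dy+\frac12\int_{\mathbb{R}\times\Omega}\int_{\mathbb{R}\times\Omega}(m(x_1,y_1)-m(x_2,y_2))^2J(x_1-x_2,y_1-y_2)\,dx_1\,dx_2\,dy_1\,dy_2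 ,$$ and its Euler–Lagrange equation is $$F'(m(x,y))=2\int_{\mathbb{R}\times\Omega}J(x-x',y-y')\,(m(x',y')-m(x,y))\,dx'\,dy' .$$ The corresponding one-dimensional problem is the minimization of $$\int_{\mathbb{R}}F(m(x))\,dx+\frac12\int_{\mathbb{R}}\int_{\mathbb{R}}(m(x)-m(x'))^2J_1(x-x')\,dx\,dx',\qquad J_1(x)=\int_\Omega J(x,y)\,dy,$$ over measurable $m:\mathbb{R}\to\mathbb{R}$ with limits $-a$ at $-\infty$ and $a$ at $+\infty$; its minimizer is unique up to translation, and $\bar m$ denotes the antisymmetric one, $\bar m(-x)=-\bar m(x)$ (a.e.). *)

(* Defs.v *)
From HB Require Import structures.
From mathcomp Require Import all_boot all_order all_algebra.
From mathcomp Require Import all_classical all_reals all_analysis.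

Set Implicit Arguments.
Unset Strict Implicit.
Unset Printing Implicit Defensive.

Import Order.TTheory GRing.Theory Num.Theory.
Import numFieldNormedType.Exports.

Local Open Scope classical_set_scope.
Local Open Scope ring_scope.

(* Restated because the library's sigma-finite instance of [m1 \x m2] is
   shadowed by the one for probability measures. *)
Lemma product_sigma_finite d1 d2 (T1 : measurableType d1)
    (T2 : measurableType d2) (R : realType)
    (m1 : {sigma_finite_measure set T1 -> \bar R})
    (m2 : {sigma_finite_measure set T2 -> \bar R}) :
  sigma_finite setT (m1 \x m2)%E.
Proof.
have /sigma_finiteP[F [TF ndF Foo]] := sigma_finiteT m1.
have /sigma_finiteP[G [TG ndG Goo]] := sigma_finiteT m2.
exists (fun n => F n `*` G n).
  rewrite -setXTT TF TG predeqE => -[x y]; split.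
    move=> [/= [n _ Fnx] [k _ Gky]]; exists (maxn n k) => //; split.
    - by move: x Fnx; exact/subsetPset/ndF/leq_maxl.
    - by move: y Gky; exact/subsetPset/ndG/leq_maxr.
  by move=> [n _ []/= ? ?]; split; exists n.
move=> k; have [? ?] := Foo k; have [? ?] := Goo k.
split; first exact: measurableX.
by rewrite product_measure1E// lte_mul_pinfty// ge0_fin_numE.
Qed.

Section lebesgue_tuple.
Variable R : realType.
Local Open Scope ereal_scope.

Definition tcons n (p : R * n.-tuple R) : n.+1.-tuple R :=
  [tuple of p.1 :: p.2].

Lemma measurable_tcons n : measurable_fun [set: R * n.-tuple R] (@tcons n).
Proof. exact: measurable_cons. Qed.

(* The image under [tcons] of the product of one-dimensional Lebesgue measure
   with a measure on n-tuples. *)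
Definition lebesgue_cons n
    (mu : {sigma_finite_measure set (n.-tuple R) -> \bar R}) :
    set (n.+1.-tuple R) -> \bar R :=
  pushforward (@lebesgue_measure R \x mu) (@tcons n).

Section lebesgue_cons.
Variables (n : nat) (mu : {sigma_finite_measure set (n.-tuple R) -> \bar R}).

Let lebesgue_cons0 : lebesgue_cons mu set0 = 0.
Proof. by rewrite /lebesgue_cons /pushforward preimage_set0 measure0. Qed.

Let lebesgue_cons_ge0 A : 0 <= lebesgue_cons mu A.
Proof. by rewrite /lebesgue_cons /pushforward; exact: measure_ge0. Qed.

Let lebesgue_cons_sigma_additive : semi_sigma_additive (lebesgue_cons mu).
Proof.
move=> F mF tF mUF; rewrite /lebesgue_cons /pushforward preimage_bigcup.
apply: measure_semi_sigma_additive.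
- by move=> k; rewrite -[X in measurable X]setTI; exact: measurable_tcons.
- apply/trivIsetP => i j _ _ ij; rewrite -preimage_setI.
  by move/trivIsetP : tF => ->//; rewrite preimage_set0.
- rewrite -preimage_bigcup -[X in measurable X]setTI.
  exact: measurable_tcons.
Qed.

HB.instance Definition _ := isMeasure.Build _ _ _ (lebesgue_cons mu)
  lebesgue_cons0 lebesgue_cons_ge0 lebesgue_cons_sigma_additive.

Let lebesgue_cons_sigma_finite : sigma_finite setT (lebesgue_cons mu).
Proof.
have [F UF mF] := product_sigma_finite (@lebesgue_measure R) mu.
pose g (t : n.+1.-tuple R) : R * n.-tuple R := (thead t, [tuple of behead t]).
have mg : measurable_fun setT g.
  by apply/measurable_fun_pairP; split;
    [exact: measurable_tnth|exact: measurable_behead].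
have gK p : g (tcons p) = p.
  by case: p => x t; rewrite /g; congr (_, _); apply/val_inj.
exists (fun k => g @^-1` F k).
  by rewrite -preimage_bigcup -UF preimage_setT.
move=> k; have [mFk Fk] := mF k; split.
  by rewrite -[X in measurable X]setTI; exact: mg.
rewrite /lebesgue_cons /pushforward /=.
rewrite (_ : _ @^-1` _ = F k)//; apply/seteqP.
by split=> p /=; rewrite gK.
Qed.

HB.instance Definition _ := Measure_isSigmaFinite.Build _ _ _
  (lebesgue_cons mu) lebesgue_cons_sigma_finite.

End lebesgue_cons.

(* Lebesgue measure on R^n, the n-fold product of [lebesgue_measure]. *)
Fixpoint lebesgue_tuple n : {sigma_finite_measure set (n.-tuple R) -> \bar R} :=
  match n with
  | 0 => dirac [tuple]
  | k.+1 => lebesgue_cons (lebesgue_tuple k)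
  end.

End lebesgue_tuple.

Section model.
Variable R : realType.

Definition even_double_well (a : R) (F : R -> R) :=
  [/\ forall s, derivable F s 1,
      forall s, F (- s) = F s,
      F a = 0, F (- a) = 0 &
      forall s, s <> a -> s <> - a -> 0 < F s].

(* Smoothness on [0, +oo[, up to and including the endpoint 0. *)
Definition smooth_on_nonneg (U : R -> R) :=
  exists2 V : R -> R,
    forall k r, derivable (derive1n k V) r 1 &
    forall r, 0 <= r -> U r = V r.

(* Only the values of U on [0, +oo[ matter. *)
Definition interaction_profile (U : R -> R) :=
  [/\ forall r, 0 <= r -> 0 <= U r,
      forall r s, 0 <= r -> r <= s -> U s <= U r,
      smooth_on_nonneg U &
      exists rho, forall r, rho < r -> U r = 0].

(* Distance from y to 0 in R^n / L Z^n, for the Euclidean metric (the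
   library's norm on row vectors is the sup norm). *)
Definition torus_norm (L : R) n (y : 'rV[R]_n) : R :=
  inf [set Num.sqrt (\sum_(i < n) (y 0 i + L * (k 0 i)%:~R) ^+ 2)
      | k in [set: 'rV[int]_n]].

Definition J (U : R -> R) (L : R) n (x : R) (y : 'rV[R]_n) : R :=
  U (Num.sqrt (x ^+ 2 + torus_norm L y ^+ 2)).

(* The cube Omega, as a set of tuples: these carry the measurable structure,
   whereas row vectors carry the topology. *)
Definition cube (L : R) n : set (n.-tuple R) :=
  [set t | forall i, 0 <= tnth t i <= L].

Arguments cube : clear implicits.

Definition row_of n (t : n.-tuple R) : 'rV[R]_n := \row_i tnth t i.

Definition J1 (U : R -> R) (L : R) n (x : R) : R :=
  \int[lebesgue_tuple R n]_(t in cube L n) J U L x (row_of t).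

Definition in_C (a L : R) n (m : R -> 'rV[R]_n -> R) :=
  [/\ continuous (fun p : R * 'rV[R]_n => m p.1 p.2),
      forall y, m x y @[x --> -oo] --> - a,
      forall y, m x y @[x --> +oo] --> a &
      forall k x y, m x (y + L *: delta_mx 0 k) = m x y].

Definition in_M (a L : R) n (m : R -> 'rV[R]_n -> R) :=
  in_C a L m /\ forall y, {homo (fun x => m x y) : x1 x2 / x1 <= x2}.

Definition euler_lagrange (F U : R -> R) (L : R) n (m : R -> 'rV[R]_n -> R) :=
  forall x y, derive1 F (m x y) =
    2 * \int[(@lebesgue_measure R \x lebesgue_tuple R n)%E]_(
          p in [set: R] `*` cube L n)
        (J U L (x - p.1) (y - row_of p.2) * (m p.1 (row_of p.2) - m x y)).

Definition energy_1d (F J1 : R -> R) (m : R -> R) : \bar R :=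
  (\int[lebesgue_measure]_x (F (m x))%:E +
   (2^-1)%:E * \int[lebesgue_measure]_x \int[lebesgue_measure]_x'
     ((m x - m x') ^+ 2 * J1 (x - x'))%:E)%E.

Definition admissible_1d (a : R) (m : R -> R) :=
  [/\ measurable_fun setT m,
      m x @[x --> -oo] --> - a & m x @[x --> +oo] --> a].

Definition minimizer_1d (a : R) (F J1 : R -> R) (m : R -> R) :=
  admissible_1d a m /\
  forall u, admissible_1d a u -> (energy_1d F J1 m <= energy_1d F J1 u)%E.

Definition antisymmetric_minimizer_1d (a : R) (F J1 : R -> R) (m : R -> R) :=
  minimizer_1d a F J1 m /\ {ae lebesgue_measure, forall x, m (- x) = - m x}.

(* [m] represents the antisymmetric minimizer, which is unique as a class of
   functions modulo equality almost everywhere. *)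
Definition the_antisymmetric_minimizer_1d (a : R) (F J1 : R -> R)
    (m : R -> R) :=
  antisymmetric_minimizer_1d a F J1 m /\
  forall u, antisymmetric_minimizer_1d a F J1 u ->
    {ae lebesgue_measure, forall x, u x = m x}.

End model.

Arguments cube {R} L n _.

(* Main.v *)
Require Import Defs.
From HB Require Import structures.
From mathcomp Require Import all_boot all_order all_algebra.
From mathcomp Require Import all_classical all_reals all_analysis.
From mathcomp Require Import measurable_realfun lra ring.

(** Write [n = d - 1].  The proof has two halves: a monotone solution does not
depend on [y], and a one-dimensional monotone solution is, up to translation,
the only minimizer.

Planarity.  A strictly increasing profile is described by the abscissa
[level m (s, t)] at which [x |-> m x t] crosses the height [s].  In the
coordinates [p = (s, t)] the Euler-Lagrange equation says that the integral
over [q] of [flux m (p, q)], the interaction carried by the displacements that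
lead from the level of [p] beyond the level of [q], is a function of [p] that
does not depend on [m] ([flux_int], [balance_formula]).  Neither does
[flux m (p, q) + flux m (q, p)] ([flux_sum]), and [flux m (p, q)] decreases when
the difference [level m q - level m p] increases.  So for two solutions [m1] and
[m2] the difference [K] of the fluxes is antisymmetric and its integral over
the second variable vanishes.  Testing it against a bounded increasing
function [zeta] of the gap [level m1 - level m2] gives that the double integral
of [(zeta p - zeta q) * K (p, q)] is zero, although the integrand is
nonnegative, and positive where two nearby points have different gaps.  Hence
the gap is constant ([antisymmetric_test], [rigidity]).  For [m2] take the
translate of [m1 = m] by a vector [v] in the direction [y]: it solves the same
equation by periodicity, so it is a translate of [m] in the direction [x], and
the averages over the cube, which do not see [v], show that this translation is
trivial ([planar]).  Strict monotonicity, which the levels require, holds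
because an equality [m x1 v = m x2 v] would spread along the line and make the
profile periodic ([m_increasing]).

One dimension.  Let [g] be the profile, [k = J1], and let [transport d] be the
map [g x |-> g (x + d)], an increasing bijection whose inverse is
[transport (- d)].  With [potential d] a primitive of [transport d s - s],
Young's inequality for this pair of inverse functions reads
[potential d s + potential (- d) s' + (s - s') ^+ 2 / 2 >= 0], with equality
only for [s' = transport d s] ([young_ge0], [young_eq0]).  Integrating the
Euler-Lagrange equation in [s] expresses the well through the potentials:
[F s] is the integral of [k d * (potential d s + potential (- d) s)] over [d]
for [s] in the interval [[- a, a]], and is larger elsewhere ([well_part_eq],
[well_part_le]).  Substituting this in the energy of a competitor [u] produces
the Young terms at [u x] and [u (x + d)], and the differences
[potential (- d) (u x) - potential (- d) (u (x + d))], whose integral over [x]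
depends only on the limits of [u] ([telescoping]).  Thus the energy of [u]
exceeds that of [g] by at least the integral of the Young terms, which vanish
for [g] ([energy_lower_bound], [front_minimizer]).  For a minimizer they vanish
almost everywhere, that is, [u (x + d) = transport d (u x)] for small [d], and
this propagates to show that [u] is a translate of [g] ([minimizer_translate]).
Finally [x |-> - g (- x)] is a solution too, hence a translate of [g]; so some
translate of [g] is odd, and it is the only one
([antisymmetric_translate]). *)

Set Implicit Arguments.
Unset Strict Implicit.
Unset Printing Implicit Defensive.

Import Order.TTheory GRing.Theory Num.Theory.
Import numFieldNormedType.Exports.

Local Open Scope classical_set_scope.
Local Open Scope ring_scope.

(** * Translations and reflections of Lebesgue measure *)

Section signed_pushforward.
Local Open Scope ereal_scope.

(** Change of variables results are proved with Tonelli's theorem for nonnegative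
functions. This passes them on to all measurable functions in a class [P] that is
stable under positive and negative parts, such as the periodic functions. *)
Lemma integral_signed_transfer d1 d2 (T1 : measurableType d1)
    (T2 : measurableType d2) (R : realType)
    (mu1 : {measure set T1 -> \bar R}) (mu2 : {measure set T2 -> \bar R})
    (D1 : set T1) (D2 : set T2) (phi : T1 -> T2)
    (P : (T2 -> \bar R) -> Prop) :
  (forall f, measurable_fun setT f -> (forall y, 0 <= f y) -> P f ->
    \int[mu1]_(x in D1) f (phi x) = \int[mu2]_(y in D2) f y) ->
  (forall f, P f -> P f^\+ /\ P f^\-) ->
  forall f, measurable_fun setT f -> P f ->
    \int[mu1]_(x in D1) f (phi x) = \int[mu2]_(y in D2) f y.
Proof.
move=> H Pf f mf /Pf[fp fn].
rewrite [LHS]integralE [RHS]integralE; congr (_ - _).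
  rewrite -(H f^\+) //; last exact: measurable_funepos.
  by apply: eq_integral => x _; rewrite (funepos_comp f phi).
rewrite -(H f^\-) //; last exact: measurable_funeneg.
by apply: eq_integral => x _; rewrite (funeneg_comp f phi).
Qed.
End signed_pushforward.

Section translation.
Variable R : realType.
Local Notation mu := (@lebesgue_measure R).
Local Open Scope ereal_scope.

Lemma measurable_addr (c : R) : measurable_fun [set: R] (fun x => x + c)%R.
Proof. exact: measurable_funD. Qed.

(** Both sides agree on the half-open intervals, which determine the measure. *)
Lemma lebesgue_shift (c : R) (A : set R) : measurable A ->
  mu ((fun x => x + c)%R @^-1` A) = mu A.
Proof.
move=> mA; apply/esym.
pose nu := measure_function_pushforward__canonical__measure_function_Measure mu (measurable_addr c : @measurable_fun _ _ (measurableTypeR R) (measurableTypeR R) setT _).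
rewrite (@lebesgue_measure_unique R nu)// => _ [[a b] _ <-].
rewrite /nu/= /pushforward.
rewrite (_ : _ @^-1` _ = (`](a - c)%R, (b - c)%R]%classic : set R)); last first.
  by apply/seteqP; split => x /=; rewrite !in_itv/= ltrBlDr lerBrDr.
rewrite !lebesgue_measure_itv/= !lte_fin ltrD2r.
by case: ifP => // _; rewrite -!EFinD; congr EFin; lra.
Qed.

Lemma lebesgue_oppr (A : set R) : measurable A ->
  mu (-%R @^-1` A) = mu A.
Proof.
move=> mA; apply/esym.
pose nu := measure_function_pushforward__canonical__measure_function_Measure mu (@oppr_measurable R setT : @measurable_fun _ _ (measurableTypeR R) (measurableTypeR R) setT _).
rewrite (@lebesgue_measure_unique R nu)// => _ [[a b] _ <-].
rewrite /nu/= /pushforward.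
rewrite (_ : _ @^-1` _ = (`[(- b)%R, (- a)%R[%classic : set R)); last first.
  by apply/seteqP; split => x /=; rewrite !in_itv/= lerNl ltrNr andbC.
rewrite !lebesgue_measure_itv/= !lte_fin ltrN2.
by case: ifP => // _; rewrite -!EFinD; congr EFin; lra.
Qed.

Lemma integral_pull (phi : R -> R) (f : R -> \bar R) :
  @measurable_fun _ _ (measurableTypeR R) (measurableTypeR R) setT phi ->
  (forall A, measurable A -> mu (phi @^-1` A) = mu A) ->
  measurable_fun setT f -> \int[mu]_x f (phi x) = \int[mu]_x f x.
Proof.
move=> mphi H mf.
apply: (@integral_signed_transfer _ _ _ _ _ mu mu setT setT phi (fun=> True)) => // {mf} {}f mf f0 _.
rewrite -(@ge0_integral_pushforward _ _ _ _ _ _ mphi mu setT f)//.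
apply: eq_measure_integral => /= A mA _; exact: H.
Qed.

Lemma integral_shift (c : R) (f : R -> \bar R) : measurable_fun setT f ->
  \int[mu]_x f (x + c)%R = \int[mu]_x f x.
Proof.
apply: (@integral_pull (fun x => x + c)%R); first exact: measurable_addr.
exact: lebesgue_shift.
Qed.

Lemma integral_oppr (f : R -> \bar R) : measurable_fun setT f ->
  \int[mu]_x f (- x)%R = \int[mu]_x f x.
Proof.
by apply: (@integral_pull -%R); [exact: oppr_measurable|exact: lebesgue_oppr].
Qed.

End translation.

(** * Tonelli's theorem on rectangles, and tuples *)

Section product_rectangle.
Local Open Scope ereal_scope.
Context d1 d2 (T1 : measurableType d1) (T2 : measurableType d2) (R : realType).
Variables (m1 : {sigma_finite_measure set T1 -> \bar R}).
Variables (m2 : {sigma_finite_measure set T2 -> \bar R}).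

Lemma patch_setX (A : set T1) (B : set T2) (f : T1 * T2 -> \bar R) x y :
  (f \_ (A `*` B)) (x, y) = ((fun x => ((fun y => f (x, y)) \_ B) y) \_ A) x.
Proof.
rewrite !patchE; have -> : ((x, y) \in A `*` B) = (x \in A) && (y \in B).
  by apply/idP/andP; rewrite !inE.
by case: (x \in A); case: (y \in B).
Qed.

Lemma ge0_integral_setX (A : set T1) (B : set T2) (f : T1 * T2 -> \bar R) :
  measurable A -> measurable B -> measurable_fun setT f -> (forall p, 0 <= f p) ->
  \int[m1 \x m2]_(p in A `*` B) f p = \int[m1]_(x in A) \int[m2]_(y in B) f (x, y).
Proof.
move=> mA mB mf f0.
rewrite integral_mkcond fubini_tonelli1; last 2 first.
- apply/(measurable_restrictT f (measurableX mA mB)); exact: measurable_funTS.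
- by move=> p; rewrite patchE; case: ifPn.
rewrite [RHS]integral_mkcond; apply: eq_integral => x _; rewrite /fubini_F.
under eq_integral do rewrite patch_setX.
rewrite [RHS]patchE; case: ifPn => [xA|xA].
  by rewrite [RHS]integral_mkcond; apply: eq_integral => y _; rewrite patchE xA.
by rewrite integral0_eq// => y _; rewrite patchE (negbTE xA).
Qed.

Lemma ge0_integral_setX_swap (A : set T1) (B : set T2) (f : T1 * T2 -> \bar R) :
  measurable A -> measurable B -> measurable_fun setT f -> (forall p, 0 <= f p) ->
  \int[m1 \x m2]_(p in A `*` B) f p = \int[m2]_(y in B) \int[m1]_(x in A) f (x, y).
Proof.
move=> mA mB mf f0.
rewrite integral_mkcond fubini_tonelli2; last 2 first.
- apply/(measurable_restrictT f (measurableX mA mB)); exact: measurable_funTS.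
- by move=> p; rewrite patchE; case: ifPn.
rewrite [RHS]integral_mkcond; apply: eq_integral => y _; rewrite /fubini_G.
under eq_integral do rewrite patch_setX.
rewrite [RHS]patchE; case: ifPn => [yB|yB].
  rewrite [RHS]integral_mkcond; apply: eq_integral => x _; rewrite !patchE.
  by rewrite yB.
by rewrite integral0_eq// => x _; rewrite !patchE (negbTE yB); case: ifPn.
Qed.

Lemma ge0_integral_swap (A : set T1) (B : set T2) (f : T1 * T2 -> \bar R) :
  measurable A -> measurable B -> measurable_fun setT f -> (forall p, 0 <= f p) ->
  \int[m1]_(x in A) \int[m2]_(y in B) f (x, y) =
  \int[m2]_(y in B) \int[m1]_(x in A) f (x, y).
Proof.
by move=> *; rewrite -ge0_integral_setX// ge0_integral_setX_swap.
Qed.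

Lemma measurable_fun_partial_integral (B : set T2) (f : T1 * T2 -> \bar R) :
  measurable B -> measurable_fun setT f -> (forall p, 0 <= f p) ->
  measurable_fun setT (fun x => \int[m2]_(y in B) f (x, y)).
Proof.
move=> mB mf f0.
rewrite (_ : (fun x => _) = fubini_F m2 (f \_ (setT `*` B))); last first.
  apply/funext => x; rewrite /fubini_F [LHS]integral_mkcond.
  by apply: eq_integral => y _; rewrite patch_setX [RHS]patchE in_setT.
apply: measurable_fun_fubini_tonelli_F => //.
  by apply/(measurable_restrictT f (measurableX measurableT mB)); exact: measurable_funTS.
by move=> p; rewrite patchE; case: ifPn.
Qed.

End product_rectangle.

Section tuples.
Variable R : realType.
Local Notation mu := (@lebesgue_measure R).
Local Notation lam n := (lebesgue_tuple R n).
Local Open Scope ereal_scope.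

(** Tuples carry the measurable structure but no addition, whereas row vectors
form a group: hence the mixed addition. *)
Definition tuple_add n (t : n.-tuple R) (v : 'rV[R]_n) : n.-tuple R :=
  [tuple tnth t i + v ord0 i | i < n]%R.

Lemma row_of_add n t (v : 'rV[R]_n) : row_of (tuple_add t v) = (row_of t + v)%R.
Proof. by apply/rowP => i; rewrite !mxE tnth_mktuple. Qed.

Lemma measurable_tuple_add n (v : 'rV[R]_n) :
  measurable_fun [set: n.-tuple R] (fun t => tuple_add t v).
Proof.
apply/measurable_fun_tnthP => i.
rewrite (_ : _ \o _ = (fun t => tnth t i + v ord0 i)%R).
  by apply: measurable_funD => //; exact: measurable_tnth.
by apply/funext => t /=; rewrite tnth_mktuple.
Qed.

Lemma tcons_add n (x : R) (t : n.-tuple R) (v : 'rV[R]_n.+1) :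
  tuple_add (tcons (x, t)) v =
  tcons (x + v ord0 ord0, tuple_add t (\row_i v ord0 (lift ord0 i)))%R.
Proof.
apply: eq_from_tnth => i; rewrite tnth_mktuple.
case: (unliftP ord0 i) => [j ->|->].
  by rewrite !tnthS/= !tnth_mktuple mxE.
by rewrite !tnth0.
Qed.

Lemma measurable_cube L n : measurable (@cube R L n).
Proof.
rewrite [X in measurable X](_ : _ =
    \bigcap_(i in [set: 'I_n]) [set t : n.-tuple R | 0 <= tnth t i <= L]%R).
  apply: fin_bigcap_measurable => [|i _]; first exact: finite_finset.
  have mtn : measurable_fun [set: n.-tuple R] (fun t => tnth t i).
    exact: measurable_tnth.
  rewrite [X in measurable X](_ : _ =
      setT `&` (fun t : n.-tuple R => tnth t i) @^-1` `[0%R, L]).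
    exact: (mtn measurableT _ (measurable_itv `[0%R, L])).
  by apply/seteqP; split => t; rewrite /= in_itv//= => -[].
by apply/seteqP; split => t /= H; [move=> i _; exact: H|move=> i; exact: H].
Qed.

Lemma cubeS L n x (t : n.-tuple R) :
  cube L n.+1 (tcons (x, t)) <-> `[0%R, L]%classic x /\ cube L n t.
Proof.
split.
  move=> h; split; first by have := h ord0; rewrite tnth0/= in_itv.
  by move=> i; have := h (lift ord0 i); rewrite tnthS.
by move=> [x0 h] i; case: (unliftP ord0 i) => [j ->|->]; rewrite ?tnthS ?tnth0//.
Qed.

End tuples.

(** * Integrals over cubes and periodic functions *)

Section tuple_integrals.
Variable R : realType.
Local Notation mu := (@lebesgue_measure R).
Local Notation lam n := (lebesgue_tuple R n).
Local Open Scope ereal_scope.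

(** Restated for the measurable structure in which [lebesgue_measure] lives. It is
convertible to the default structure of [R], but unification does not see it. *)
Lemma measurable_tcons_lebesgue n :
  @measurable_fun _ _ (measurableTypeR R * n.-tuple R)%type _ setT (@tcons R n).
Proof. exact: measurable_tcons. Qed.

Lemma ge0_integral_tupleS n (D : set (n.+1.-tuple R))
    (f : n.+1.-tuple R -> \bar R) :
  measurable D -> measurable_fun setT f -> (forall t, 0 <= f t) ->
  \int[lam n.+1]_(t in D) f t =
  \int[mu \x lam n]_(p in @tcons R n @^-1` D) f (tcons p).
Proof.
move=> mD mf f0.
rewrite -(ge0_integral_pushforward (@measurable_tcons_lebesgue n) (mu \x lam n)%E mD)//.
exact: measurable_funTS.
Qed.

Lemma cubeS_preimage L n :
  @tcons R n @^-1` cube L n.+1 = `[0%R, L]%classic `*` cube L n.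
Proof. by apply/seteqP; split => -[x t] /= /cubeS. Qed.

Lemma ge0_integral_cubeS L n (f : n.+1.-tuple R -> \bar R) :
  measurable_fun setT f -> (forall t, 0 <= f t) ->
  \int[lam n.+1]_(t in cube L n.+1) f t =
  \int[mu]_(x in `[0%R, L]) \int[lam n]_(t in cube L n) f (tcons (x, t)).
Proof.
move=> mf f0.
rewrite ge0_integral_tupleS//; last exact: measurable_cube.
rewrite cubeS_preimage (ge0_integral_setX mu (lam n) (measurable_itv _)
  (@measurable_cube R L n) (f := f \o @tcons R n))//.
  exact: measurableT_comp mf (@measurable_tcons_lebesgue n).
by move=> p; exact: f0.
Qed.

Lemma measurable_patch_itv (i : interval R) (f : R -> \bar R) :
  measurable_fun setT f -> measurable_fun setT (f \_ [set` i]).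
Proof.
move=> mf; have mi : measurable ([set` i] : set R) by exact: measurable_itv.
by have [+ _] := measurable_restrictT f mi; apply; exact: measurable_funTS.
Qed.

Lemma integral_itv_shift (a b c : R) (f : R -> \bar R) : measurable_fun setT f ->
  \int[mu]_(x in `[a, b]) f (x + c)%R = \int[mu]_(x in `[(a + c)%R, (b + c)%R]) f x.
Proof.
move=> mf; rewrite [LHS]integral_mkcond [RHS]integral_mkcond.
rewrite -[RHS](integral_shift c); last exact: measurable_patch_itv.
apply: eq_integral => x _; rewrite !patchE.
by rewrite !mem_setE !in_itv/= !lerD2r.
Qed.

Section periodic.
Variables (L : R) (f : R -> \bar R).
Hypothesis L0 : (0 < L)%R.
Hypothesis mf : measurable_fun setT f.
Hypothesis f0 : forall x, 0 <= f x.
Hypothesis fL : forall x, f (x + L)%R = f x.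

Lemma periodic_int (z : int) x : f (x + L * z%:~R)%R = f x.
Proof.
have H (n : nat) y : f (y + L * n%:R)%R = f y.
  elim: n y => [|n IH] y; first by rewrite mulr0 addr0.
  by rewrite -natr1 mulrDr mulr1 addrA fL IH.
case: z => n; first exact: (H n).
rewrite NegzE mulrNz mulrN -(H n.+1 (x - _)%R).
by rewrite -addrA addNr addr0.
Qed.

(** By periodicity [c] may be taken in [[0, L]]; then the window [[c, c + L]] is
cut at [L] and its right part is moved back by [L]. *)
Lemma integral_period (c : R) :
  \int[mu]_(x in `[0%R, L]) f (x + c)%R = \int[mu]_(x in `[0%R, L]) f x.
Proof.
pose z := Num.floor (c / L); pose r := (c - L * z%:~R)%R.
have /andP[r0 rL] : (0 <= r <= L)%R.
  have /andP[h1 h2] := floor_itv (c / L)%R.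
  rewrite /r subr_ge0 mulrC -ler_pdivlMr// h1/= lerBlDl.
  rewrite -[X in (_ <= _ + X)%R]mul1r -mulrDl -ler_pdivrMr//.
  by rewrite (le_trans (ltW h2))// intrD addrC.
have fr x : f (x + c)%R = f (x + r)%R.
  by rewrite /r addrA -mulrN -mulrNz periodic_int.
under eq_integral do rewrite fr.
rewrite integral_itv_shift// add0r.
have splitf (a b e : R) : (a <= b)%R -> (b <= e)%R ->
    \int[mu]_(x in `[a, e]) f x =
    \int[mu]_(x in `[a, b]) f x + \int[mu]_(x in `[b, e]) f x.
  move=> b0 be; rewrite (@itv_bndbnd_setU _ _ _ (BRight b)) ?bnd_simp//.
  rewrite ge0_integral_setU//; last 2 first.
  - exact: measurable_funTS.
  - apply/disj_setPS => y [/=]; rewrite 2!in_itv/= => /andP[_ yx] /andP[].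
    by rewrite ltNge yx.
  by rewrite integral_itv_obnd_cbnd//; exact: measurable_funTS.
rewrite (splitf r L) ?lerDl// [RHS](splitf 0%R r)// addeC; congr (_ + _).
rewrite -{1}(add0r L) [(L + r)%R]addrC -integral_itv_shift//.
by apply: eq_integral => x _; rewrite fL.
Qed.
End periodic.
End tuple_integrals.

(** * Translation invariance on the periodic strip *)

Section cube_shift.
Variable R : realType.
Local Notation mu := (@lebesgue_measure R).
Local Notation lam n := (lebesgue_tuple R n).
Local Open Scope ereal_scope.

Definition tuple_periodic (L : R) n (f : n.-tuple R -> \bar R) :=
  forall k t, f (tuple_add t (L *: delta_mx ord0 k)%R) = f t.

Lemma measurable_tcons_section n x (f : n.+1.-tuple R -> \bar R) :
  measurable_fun setT f -> measurable_fun setT (fun t => f (tcons (x, t))).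
Proof.
move=> mf; apply: (measurableT_comp mf).
apply: (measurableT_comp (@measurable_tcons R n)).
exact: measurable_pair1.
Qed.

(** Induction on [n]: the inner integral is invariant by the induction hypothesis,
and as a function of the first coordinate it is periodic. *)
Lemma ge0_integral_cube_shift n (L : R) (f : n.-tuple R -> \bar R)
    (v : 'rV[R]_n) :
  (0 < L)%R -> measurable_fun setT f -> (forall t, 0 <= f t) ->
  tuple_periodic L f ->
  \int[lam n]_(t in cube L n) f (tuple_add t v) =
  \int[lam n]_(t in cube L n) f t.
Proof.
move=> L0; elim: n f v => [|n IH] f v mf f0 fL.
  by apply: eq_integral => t _; congr f; rewrite [LHS]tuple0 [RHS]tuple0.
rewrite !ge0_integral_cubeS//; last first.
  exact: measurableT_comp mf (@measurable_tuple_add R n.+1 v).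
under eq_integral => x _ do under eq_integral do rewrite tcons_add.
pose G x := \int[lam n]_(t in cube L n) f (tcons (x, t)).
have mG : measurable_fun setT G.
  apply: (@measurable_fun_partial_integral _ _ _ _ _ (lam n) _ (f \o @tcons R n)) => //.
  - exact: measurable_cube.
  - exact: measurableT_comp mf (@measurable_tcons R n).
  - by move=> p; exact: f0.
transitivity (\int[mu]_(x in `[0%R, L]) G (x + v ord0 ord0)%R).
  apply: eq_integral => x _.
  rewrite (IH (fun t => f (tcons (x + v ord0 ord0, t)%R)))//.
    exact: measurable_tcons_section.
  move=> k t; rewrite -[RHS](fL (lift ord0 k)); congr f.
  rewrite tcons_add; congr tcons; congr (_, tuple_add _ _).
    by rewrite !mxE/= mulr0 addr0.
  by apply/rowP => i; rewrite !mxE/= (inj_eq lift_inj).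
apply: integral_period => //.
  by move=> x; apply: integral_ge0 => t _; exact: f0.
move=> x; rewrite /G; apply: eq_integral => t _.
rewrite -[RHS](fL ord0) tcons_add; congr f; congr tcons; congr (_, _).
  by rewrite !mxE/= mulr1.
by apply: eq_from_tnth => i; rewrite tnth_mktuple !mxE/= mulr0 addr0.
Qed.

Lemma ge0_integral_strip_shift n (L : R) (f : R * n.-tuple R -> \bar R) (c : R)
    (v : 'rV[R]_n) :
  (0 < L)%R -> measurable_fun setT f -> (forall t, 0 <= f t) ->
  (forall x, tuple_periodic L (fun t => f (x, t))) ->
  \int[mu \x lam n]_(p in setT `*` cube L n) f (p.1 + c, tuple_add p.2 v)%R =
  \int[mu \x lam n]_(p in setT `*` cube L n) f p.
Proof.
move=> L0 mf f0 fL.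
have mcube := @measurable_cube R L n.
rewrite !ge0_integral_setX//; last first.
  apply: (measurableT_comp mf); apply/measurable_fun_pairP; split => /=.
    by apply: measurable_funD => //; exact: measurable_fst.
  exact: measurableT_comp (@measurable_tuple_add R n v) measurable_snd.
pose G x := \int[lam n]_(t in cube L n) f (x, t).
have mG : measurable_fun setT G by exact: measurable_fun_partial_integral.
rewrite -[RHS](integral_shift c)//.
apply: eq_integral => x _.
apply: (ge0_integral_cube_shift (f := fun t => f (x + c, t)%R)) => //.
exact: measurableT_comp mf (measurable_pair1 _).
Qed.

(** The [x] direction is invariant by translation and the [y] directions by
periodicity. This is what lets the Euler-Lagrange equation be centred at any
point. *)
Lemma integral_strip_shift n (L : R) (f : R * n.-tuple R -> \bar R) (c : R)
    (v : 'rV[R]_n) :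
  (0 < L)%R -> measurable_fun setT f ->
  (forall x, tuple_periodic L (fun t => f (x, t))) ->
  \int[mu \x lam n]_(p in setT `*` cube L n) f (p.1 + c, tuple_add p.2 v)%R =
  \int[mu \x lam n]_(p in setT `*` cube L n) f p.
Proof.
move=> L0.
apply: (@integral_signed_transfer _ _ _ _ _ (mu \x lam n)%E (mu \x lam n)%E _ _
  (fun p : R * n.-tuple R => (p.1 + c, tuple_add p.2 v)%R)
  (fun f => forall x, tuple_periodic L (fun t => f (x, t)))).
  by move=> {}f mf f0 fL; exact: ge0_integral_strip_shift.
move=> {}f fL; split => x k t.
  by rewrite !unlock fL.
by rewrite !unlock fL.
Qed.

Lemma lebesgue_itvcc_lty (a b : R) : mu `[a, b] < +oo.
Proof.
by rewrite lebesgue_measure_itv; case: ifP => _; rewrite ?lt0y// -EFinB ltry.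
Qed.

Lemma lebesgue_itv_gt0 (x y : bool) (a b : R) : (a < b)%R ->
  0 < mu [set` Interval (BSide x a) (BSide y b)].
Proof.
by move=> ab; rewrite lebesgue_measure_itv/= lte_fin ab -EFinB lte_fin subr_gt0.
Qed.

Lemma lebesgue_cube_finite n (L : R) : lam n (cube L n) < +oo.
Proof.
elim: n => [|n IH].
  by rewrite /= diracE; case: (_ \in _); rewrite ltry.
rewrite /= /lebesgue_cons /pushforward cubeS_preimage product_measure1E//.
  by rewrite lte_mul_pinfty// ge0_fin_numE// ; exact: lebesgue_itvcc_lty.
exact: measurable_cube.
Qed.

(* the box of half-width e around t0 *)
Definition tuple_box n (t0 : n.-tuple R) (e : R) : set (n.-tuple R) :=
  [set t | forall i, `|tnth t i - tnth t0 i| < e]%R.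

Lemma tuple_boxE n (t0 : n.-tuple R) e :
  tuple_box t0 e = \bigcap_(i in [set: 'I_n]) ((fun t : n.-tuple R => tnth t i) @^-1` ball (tnth t0 i) e).
Proof.
by apply/seteqP; split => t /= H i; [move=> _|]; have := H i; rewrite /ball/= distrC//; apply.
Qed.

Lemma measurable_tuple_box n (t0 : n.-tuple R) e : measurable (tuple_box t0 e).
Proof.
rewrite tuple_boxE.
apply: fin_bigcap_measurable => [|i _]; first exact: finite_finset.
have mtn : measurable_fun [set: n.-tuple R] (fun t => tnth t i).
  exact: measurable_tnth.
rewrite -[X in measurable X]setTI.
exact: (mtn measurableT _ (measurable_ball _ _)).
Qed.

(** The centre may lie on the boundary of the cube: in each direction half of the
box at least stays inside. *)
Lemma lebesgue_tuple_box_gt0 n (L : R) (t0 : n.-tuple R) e : (0 < L)%R -> (0 < e)%R ->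
  cube L n t0 -> 0 < lam n (tuple_box t0 e `&` cube L n).
Proof.
move=> L0 e0; elim: n t0 => [|n IH] t0 h0.
  rewrite /= diracE mem_set ?lte01//; split; first by case.
  by case.
pose t1 : n.-tuple R := [tuple of behead t0].
have E : @tcons R n @^-1` (tuple_box t0 e `&` cube L n.+1) =
    (ball (thead t0) e `&` `[0%R, L]%classic) `*` (tuple_box t1 e `&` cube L n).
  have tn i : tnth t1 i = tnth t0 (lift ord0 i) by rewrite [in RHS](tuple_eta t0) tnthS.
  apply/seteqP; split => -[x t] /=.
    move=> [hb /cubeS[? ?]]; split; split => //.
      by have := hb ord0; rewrite tnth0 /ball/= distrC.
    by move=> i; have := hb (lift ord0 i); rewrite tnthS tn.
  move=> [[hx xL] [ht tL]]; split; last by apply/cubeS.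
  move=> i; case: (unliftP ord0 i) => [j ->|->].
    by rewrite tnthS -tn.
  by move: hx; rewrite tnth0 /ball/= distrC.
rewrite /= /lebesgue_cons /pushforward E product_measure1E//; last 2 first.
- by apply: measurableI; [exact: measurable_ball|exact: measurable_itv].
- by apply: measurableI; [exact: measurable_tuple_box|exact: measurable_cube].
have /andP[x0 xL] : (0 <= thead t0 <= L)%R by exact: h0.
apply: mule_gt0; last first.
  apply: IH => i; have := h0 (lift ord0 i).
  by rewrite [in X in X -> _](tuple_eta t0) tnthS.
(* The half of the interval that points to the midpoint of [[0, L]]. *)
have [a [b [ab h]]] : exists a b, (a < b)%R /\ `[a, b]%classic `<=` ball (thead t0) e `&` `[0%R, L]%classic.
  have [xL2|xL2] := leP (thead t0) (L / 2)%R.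
    exists (thead t0), (thead t0 + Num.min (e / 2) (L / 2))%R; split.
      by rewrite ltrDl lt_min !divr_gt0.
    move=> z/=; rewrite in_itv/= => /andP[z1].
    rewrite -lerBlDl le_min => /andP[z2 z3]; split.
      rewrite /ball/= ltr_norml; apply/andP; split; lra.
    rewrite in_itv/=; apply/andP; split; lra.
  exists (thead t0 - Num.min (e / 2) (L / 2))%R, (thead t0); split.
    by rewrite ltrBlDr ltrDl lt_min !divr_gt0.
  move=> z/=; rewrite in_itv/= => /andP[+ z1].
  rewrite lerBlDr -lerBlDl le_min => /andP[z2 z3]; split.
    rewrite /ball/= ltr_norml; apply/andP; split; lra.
  rewrite in_itv/=; apply/andP; split; lra.
apply: (lt_le_trans _ (le_measure mu _ _ h)); rewrite ?inE//.
  exact: lebesgue_itv_gt0.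
by apply: measurableI; [exact: measurable_ball|exact: measurable_itv].
Qed.

End cube_shift.

(** * The interaction kernel *)

Section row_vectors.
Variable R : realType.

Lemma near_row_box n (x0 : R) (y0 : 'rV[R]_n) (P : R * 'rV[R]_n -> Prop) :
  (\forall p \near (x0, y0), P p) ->
  exists2 e : R, 0 < e & forall x (y : 'rV[R]_n), `|x - x0| < e ->
    (forall i, `|y ord0 i - y0 ord0 i| < e) -> P (x, y).
Proof.
move=> /nbhs_ballP[e /= e0 H]; exists e => // x y xe ye; apply: H; split => /=.
  by rewrite /ball/= distrC.
by split => [|i j]; [exact: e0|rewrite (ord1 i) /ball/= distrC].
Qed.

(** Round [z] down to a multiple of [(k + 1)^-1]. *)
Definition grid (k : nat) (z : R) : R := (Num.floor (z * k.+1%:R))%:~R / k.+1%:R.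

Lemma grid_dist k z : `|grid k z - z| <= k.+1%:R^-1.
Proof.
have /andP[h1 h2] := floor_itv (z * k.+1%:R).
have k0 : 0 < k.+1%:R :> R by rewrite ltr0n.
rewrite distrC ger0_norm /grid.
  rewrite lerBlDr -[X in _ <= X + _]mul1r -mulrDl ler_pdivlMr//.
  by rewrite (le_trans (ltW h2))// intrD addrC.
by rewrite subr_ge0 ler_pdivrMr.
Qed.

Lemma measurable_floor_eq k (z : int) : measurable [set x : R | Num.floor (x * k.+1%:R) = z].
Proof.
have k0 : 0 < k.+1%:R :> R by rewrite ltr0n.
rewrite (_ : [set _ | _] = `[z%:~R / k.+1%:R, (z + 1)%:~R / k.+1%:R[%classic); first exact: measurable_itv.
apply/seteqP; split => x /=; rewrite in_itv/= ler_pdivrMr// ltr_pdivlMr// -floor_eq; first by move=> ->.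
by move/eqP.
Qed.

(** Continuity refers to the topology of row vectors, measurability to the product
sigma-algebra on tuples. The bridge is a pointwise approximation by functions of
the rounded coordinates, which take countably many values on measurable sets. *)
Lemma measurable_continuous_row n (f : R * 'rV[R]_n -> R) : continuous f ->
  measurable_fun setT (fun p : R * n.-tuple R => f (p.1, row_of p.2)).
Proof.
move=> cf.
pose h k (p : R * n.-tuple R) := f (grid k p.1, \row_i grid k (tnth p.2 i)).
apply: (@measurable_fun_cvg _ _ _ _ h); last first.
  move=> [x t] _; apply/cvgrPdist_lt => e e0.
  have /cvgrPdist_lt/(_ _ e0)/near_row_box[d d0 H] := cf (x, row_of t).
  near=> k; rewrite /h/=; apply: H => [|i]; rewrite ?mxE.
    by rewrite (le_lt_trans (grid_dist _ _))//; near: k; exact: near_infty_natSinv_lt (PosNum d0).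
  by rewrite (le_lt_trans (grid_dist _ _))//; near: k; exact: near_infty_natSinv_lt (PosNum d0).
move=> k _ Y mY; rewrite setTI.
pose c (z : int) : R := z%:~R / k.+1%:R.
pose g (z : int * n.-tuple int) := f (c z.1, \row_i c (tnth z.2 i)).
pose fl (z : R) : int := Num.floor (z * k.+1%:R).
pose B (z : int * n.-tuple int) := [set p : R * n.-tuple R | fl p.1 = z.1] `&`
  \bigcap_(i in [set: 'I_n]) [set p : R * n.-tuple R | fl (tnth p.2 i) = tnth z.2 i].
rewrite (_ : _ @^-1` _ = \bigcup_(z in [set: int * n.-tuple int]) (B z `&` [set _ | Y (g z)])).
  apply: countable_bigcupT_measurable; first exact: countableP.
  move=> z; apply: measurableI; last first.
    have [Yz|Yz] := pselect (Y (g z)).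
      by rewrite (_ : [set _ | _] = setT)//; apply/seteqP; split => [_ _ /=|_ _ /=].
    by rewrite (_ : [set _ | _] = set0)//; apply/seteqP; split => [_ /=|_ /=].
  apply: measurableI.
    rewrite -[X in measurable X]setTI.
    exact: (measurable_fst measurableT _ (@measurable_floor_eq k z.1)).
  apply: fin_bigcap_measurable => [|i _]; first exact: finite_finset.
  have mt : measurable_fun setT (fun p : R * n.-tuple R => tnth p.2 i).
    exact: (measurableT_comp (measurable_tnth i) measurable_snd).
  rewrite -[X in measurable X]setTI.
  exact: (mt measurableT _ (@measurable_floor_eq k (tnth z.2 i))).
apply/seteqP; split => [[x t]|[x t]] /=.
  rewrite /h/= => Yh; exists (fl x, [tuple fl (tnth t i) | i < n]) => //=.
  have -> : g (fl x, [tuple fl (tnth t i) | i < n]) = f (grid k x, \row_i grid k (tnth t i)).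
    by rewrite /g/=; congr (f (_, _)); apply/rowP => i; rewrite !mxE tnth_mktuple.
  by split => //; split => //= i _; rewrite /= tnth_mktuple.
move=> [z _] [[/= h1 h2] Yg].
rewrite /h/= (_ : f _ = g z)// /g; congr (f (_, _)); first by rewrite /c -h1.
by apply/rowP => i; rewrite !mxE /c -(h2 i I).
Unshelve. all: by end_near. Qed.

End row_vectors.

Section kernel.
Variables (R : realType) (U : R -> R) (L : R) (n : nat).
Hypothesis HU : interaction_profile U.
Hypothesis L0 : 0 < L.
Local Notation j := (@J R U L n).
Local Notation T := (n.-tuple R).

Let tnset (y : 'rV[R]_n) := [set Num.sqrt (\sum_(i < n) (y ord0 i + L * (k ord0 i)%:~R) ^+ 2)
      | k in [set: 'rV[int]_n]].

Lemma torus_norm_has_inf y : has_inf (tnset y).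
Proof.
split; first by exists (Num.sqrt (\sum_(i < n) (y ord0 i + L * ((0 : 'rV[int]_n) ord0 i)%:~R) ^+ 2)), 0.
by exists 0 => _ [k _ <-]; exact: sqrtr_ge0.
Qed.

Lemma torus_normN (y : 'rV[R]_n) : torus_norm L (- y) = torus_norm L y.
Proof.
rewrite /torus_norm; congr inf; apply/seteqP; split => _ [k _ <-]; exists (- k) => //;
  congr (Num.sqrt _); apply: eq_bigr => i _; rewrite !mxE rmorphN/= -sqrrN; congr (_ ^+ _); ring.
Qed.

Lemma torus_norm_periodic (y : 'rV[R]_n) l : torus_norm L (y + L *: delta_mx ord0 l) = torus_norm L y.
Proof.
rewrite /torus_norm; congr inf; apply/seteqP; split => _ [k _ <-].
  exists (k + delta_mx ord0 l) => //; congr (Num.sqrt _); apply: eq_bigr => i _.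
  rewrite !mxE rmorphD/=; congr (_ ^+ _).
  by case: eqP => _; rewrite /= ?rmorph1 ?rmorph0 ?mulr1n ?mulr0n; ring.
exists (k - delta_mx ord0 l) => //; congr (Num.sqrt _); apply: eq_bigr => i _.
rewrite !mxE rmorphB/=; congr (_ ^+ _).
by case: eqP => _; rewrite /= ?rmorph1 ?rmorph0 ?mulr1n ?mulr0n; ring.
Qed.

Lemma JNx x y : j (- x) y = j x y.
Proof. by rewrite /J sqrrN. Qed.

Lemma JNy x y : j x (- y) = j x y.
Proof. by rewrite /J torus_normN. Qed.

Lemma J_periodic x y l : j x (y + L *: delta_mx ord0 l) = j x y.
Proof. by rewrite /J torus_norm_periodic. Qed.

Lemma J_ge0 x y : 0 <= j x y.
Proof. by case: HU => U0 _ _ _; apply: U0; exact: sqrtr_ge0. Qed.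

Lemma J_le x y : j x y <= U 0.
Proof. by case: HU => _ Ud _ _; apply: Ud => //; exact: sqrtr_ge0. Qed.

Lemma J_finite_range : exists2 rho : R, 0 < rho & forall x y, rho < `|x| -> j x y = 0.
Proof.
case: HU => _ _ _ [rho Hrho]; exists (Num.max rho 1); first by rewrite lt_max ltr01 orbT.
move=> x y; rewrite gt_max => /andP[h1 h2]; apply: Hrho; apply: (lt_le_trans h1).
by rewrite -sqrtr_sqr ler_sqrt ?addr_ge0 ?sqr_ge0// lerDl sqr_ge0.
Qed.

(** The infimum runs over the countable lattice of integer vectors. *)
Lemma measurable_torus_norm : measurable_fun setT (fun t : T => torus_norm L (row_of t)).
Proof.
apply: (measurability _ (RGenInftyO.measurableE R)) => _ [_ [c ->]] <-.
rewrite setTI.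
rewrite (_ : _ @^-1` _ = \bigcup_(k in [set: 'rV[int]_n])
   ((fun t : T => Num.sqrt (\sum_(i < n) (tnth t i + L * (k ord0 i)%:~R) ^+ 2)) @^-1` [set` `]-oo, c[])).
  apply: countable_bigcupT_measurable; first exact: countableP.
  move=> k; rewrite -[X in measurable X]setTI.
  set q := (fun t : T => Num.sqrt _).
  have mq : measurable_fun setT q.
    apply: (measurableT_comp (continuous_measurable_fun (@sqrt_continuous R))).
    apply: measurable_sum => i; apply: measurable_funX.
    by apply: measurable_funD => //; exact: measurable_tnth.
  exact: (mq measurableT _ (measurable_itv `]-oo, c[)).
have E (k : 'rV[int]_n) (t : T) : Num.sqrt (\sum_(i < n) (tnth t i + L * (k ord0 i)%:~R) ^+ 2) =
  Num.sqrt (\sum_(i < n) (row_of t ord0 i + L * (k ord0 i)%:~R) ^+ 2).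
  by congr (Num.sqrt _); apply: eq_bigr => i _; rewrite mxE.
apply/seteqP; split => t /=; rewrite in_itv/=.
  move=> /(inf_lt (torus_norm_has_inf _).1)[_ [k _ <-] h]; exists k => //=.
  by rewrite in_itv/= E.
move=> [k _]; rewrite /= in_itv/= E => h; apply: le_lt_trans h.
by apply: ge_inf; [exact: (torus_norm_has_inf _).2|exists k].
Qed.

Lemma measurable_J d (S : measurableType d) (f : S -> R) (g h : S -> T) :
  measurable_fun setT f -> measurable_fun setT g -> measurable_fun setT h ->
  measurable_fun setT (fun s => j (f s) (row_of (g s) - row_of (h s))).
Proof.
move=> mf mg mh; case: (HU) => _ _ [V dV UV] _.
have cV : continuous V by move=> r; apply/differentiable_continuous/derivable1_diffP; exact: (dV 0%N r).
rewrite (_ : (fun s => _) = (fun s => V (Num.sqrt (f s ^+ 2 + torus_norm L (row_of [tuple tnth (g s) i - tnth (h s) i | i < n]) ^+ 2)))).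
  apply: (measurableT_comp (continuous_measurable_fun cV)).
  apply: (measurableT_comp (continuous_measurable_fun (@sqrt_continuous R))).
  apply: measurable_funD; first exact: measurable_funX.
  apply: measurable_funX; apply: (measurableT_comp measurable_torus_norm).
  apply/measurable_fun_tnthP => i.
  rewrite (_ : _ \o _ = (fun s => tnth (g s) i - tnth (h s) i)).
    by apply: measurable_funB; apply: (measurableT_comp (measurable_tnth i)).
  by apply/funext => s /=; rewrite tnth_mktuple.
apply/funext => s; rewrite /J UV ?sqrtr_ge0//; congr (V (Num.sqrt (_ + torus_norm L _ ^+ 2))).
by apply/rowP => i; rewrite !mxE tnth_mktuple.
Qed.

End kernel.

(** * Strict inequalities between integrals and the antisymmetric test *)

Section strict_integral.
Local Open Scope ereal_scope.
Context d (T : measurableType d) (R : realType).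
Variable mu : {measure set T -> \bar R}.

(** A nonnegative function with zero integral vanishes almost everywhere, hence
somewhere on [B]. *)
Lemma integral_gt0 (D B : set T) (f : T -> \bar R) :
  measurable D -> measurable B -> B `<=` D -> 0 < mu B ->
  measurable_fun D f -> (forall x, D x -> 0 <= f x) -> (forall x, B x -> 0 < f x) ->
  0 < \int[mu]_(x in D) f x.
Proof.
move=> mD mB BD B0 mf f0 fB.
rewrite lt0e integral_ge0// andbT; apply/negP => /eqP H.
have : \int[mu]_(x in D) `|f x| = 0.
  by rewrite -[RHS]H; apply: eq_integral => x /[!inE] Dx; rewrite gee0_abs ?f0.
move=> /(ae_eq_integral_abs mu mD mf)[N [mN N0 HN]].
have : mu B <= mu N.
  apply: le_measure; rewrite ?inE//; apply: subset_trans HN => x Bx /= /(_ (BD _ Bx)) h.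
  by have := fB _ Bx; rewrite h ltxx.
by rewrite N0 leNgt B0.
Qed.

Lemma integral_lt (D B : set T) (f g : T -> R) :
  measurable D -> measurable B -> B `<=` D -> 0 < mu B ->
  measurable_fun D f -> measurable_fun D g ->
  (forall x, D x -> 0 <= f x)%R -> (forall x, D x -> f x <= g x)%R ->
  (forall x, B x -> f x < g x)%R ->
  \int[mu]_(x in D) (f x)%:E < +oo ->
  \int[mu]_(x in D) (f x)%:E < \int[mu]_(x in D) (g x)%:E.
Proof.
move=> mD mB BD B0 mf mg f0 fg fgB foo.
have -> : \int[mu]_(x in D) (g x)%:E =
    \int[mu]_(x in D) (f x)%:E + \int[mu]_(x in D) (g x - f x)%:E.
  rewrite -ge0_integralD//.
  - by apply: eq_integral => x _; rewrite -EFinD addrC subrK.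
  - exact/measurable_EFinP.
  - by move=> x Dx; rewrite lee_fin subr_ge0 fg.
  - exact/measurable_EFinP/measurable_funB.
rewrite lteDl//.
  by apply: (integral_gt0 mD mB) => // [|x Dx|x Bx]; [exact/measurable_EFinP/measurable_funB|rewrite lee_fin subr_ge0 fg|rewrite lte_fin subr_gt0 fgB].
by rewrite ge0_fin_numE// integral_ge0// => x Dx; rewrite lee_fin f0.
Qed.

Lemma bounded_integral_lty (D : set T) (f : T -> R) (C : R) :
  measurable D -> mu D < +oo -> measurable_fun D f ->
  (forall x, D x -> 0 <= f x <= C)%R ->
  \int[mu]_(x in D) (f x)%:E < +oo.
Proof.
move=> mD Doo mf fC.
apply: (@le_lt_trans _ _ (\int[mu]_(x in D) (cst C%:E) x)).
  apply: ge0_le_integral => //.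
  - by move=> x /fC/andP[? _]; rewrite lee_fin.
  - exact/measurable_EFinP.
  - by move=> x /fC/andP[_ ?]; rewrite lee_fin.
rewrite integral_cst//.
have [->|/set0P[x /fC/andP[h1 h2]]] := eqVneq D set0.
  by rewrite measure0 mule0 ltry.
by rewrite lte_mul_pinfty// lee_fin (le_trans h1).
Qed.

End strict_integral.

Section antisymmetric_test.
Local Open Scope ereal_scope.
Context d (T : measurableType d) (R : realType).
Variable mu : {sigma_finite_measure set T -> \bar R}.
Variables (D : set T) (h1 h2 : T * T -> R) (zeta : T -> R) (C : R).
Hypothesis mD : measurable D.
Hypothesis Doo : mu D < +oo.
Hypothesis mh1 : measurable_fun setT h1.
Hypothesis mh2 : measurable_fun setT h2.
Hypothesis mz : measurable_fun setT zeta.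
Hypothesis h1C : forall p, (0 <= h1 p <= C)%R.
Hypothesis h2C : forall p, (0 <= h2 p <= C)%R.
Hypothesis zC : forall p, (0 <= zeta p <= C)%R.
Hypothesis hsym : forall p q, (h1 (p, q) + h1 (q, p) = h2 (p, q) + h2 (q, p))%R.
Hypothesis hint : forall p, D p ->
  \int[mu]_(q in D) (h1 (p, q))%:E = \int[mu]_(q in D) (h2 (p, q))%:E.
Hypothesis mono : forall p q,
  (zeta q * h1 (p, q) + zeta p * h2 (p, q) <=
   zeta p * h1 (p, q) + zeta q * h2 (p, q))%R.

Local Notation mu2 := (mu \x mu).

Let mDD : measurable (D `*` D). Proof. exact: measurableX. Qed.

Let DDoo : mu2 (D `*` D) < +oo.
Proof. by rewrite product_measure1E// lte_mul_pinfty// ge0_fin_numE. Qed.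

Let mh_swap (h : T * T -> R) : measurable_fun setT h -> measurable_fun setT (fun p => h (p.2, p.1)).
Proof.
by move=> mh; apply: (measurableT_comp mh); apply/measurable_fun_pairP; split => /=;
  [exact: measurable_snd|exact: measurable_fst].
Qed.

Let mz1 : measurable_fun setT (fun p : T * T => zeta p.1).
Proof. exact: (measurableT_comp mz measurable_fst). Qed.

Let mz2 : measurable_fun setT (fun p : T * T => zeta p.2).
Proof. exact: (measurableT_comp mz measurable_snd). Qed.

Let I (h : T * T -> R) := \int[mu2]_(p in D `*` D) (h p)%:E.

Let I_fin (h : T * T -> R) : measurable_fun setT h -> (forall p, (0 <= h p <= C)%R) ->
  I (fun p => zeta p.1 * h p)%R \is a fin_num /\
  I (fun p => zeta p.2 * h p)%R \is a fin_num.
Proof.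
move=> mh hC; split; rewrite ge0_fin_numE.
- apply: (@bounded_integral_lty _ _ _ _ _ _ (C * C)%R) => //.
    exact/measurable_funTS/measurable_funM.
  move=> p _; have /andP[? ?] := hC p; have /andP[? ?] := zC p.1.
  by rewrite mulr_ge0//= ler_pM.
- apply: integral_ge0 => p _; have /andP[? ?] := hC p; have /andP[? ?] := zC p.1.
  by rewrite lee_fin mulr_ge0.
- apply: (@bounded_integral_lty _ _ _ _ _ _ (C * C)%R) => //.
    exact/measurable_funTS/measurable_funM.
  move=> p _; have /andP[? ?] := hC p; have /andP[? ?] := zC p.2.
  by rewrite mulr_ge0//= ler_pM.
- apply: integral_ge0 => p _; have /andP[? ?] := hC p; have /andP[? ?] := zC p.2.
  by rewrite lee_fin mulr_ge0.
Qed.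

Let I_D (h h' : T * T -> R) : measurable_fun setT h -> measurable_fun setT h' ->
  (forall p, 0 <= h p)%R -> (forall p, 0 <= h' p)%R ->
  I (fun p => h p + h' p)%R = I h + I h'.
Proof.
move=> mh mh' h0 h'0; rewrite /I -ge0_integralD//.
- by move=> p _; rewrite lee_fin.
- exact/measurable_funTS/measurable_EFinP.
- by move=> p _; rewrite lee_fin.
- exact/measurable_funTS/measurable_EFinP.
Qed.

Let I_swap (h : T * T -> R) : measurable_fun setT h -> (forall p, 0 <= h p)%R ->
  I (fun p => h (p.2, p.1)) = I h.
Proof.
move=> mh h0; rewrite /I ge0_integral_setX//; last 2 first.
- by apply/measurable_EFinP; exact: mh_swap.
- by move=> p; rewrite lee_fin.
rewrite [RHS]ge0_integral_setX_swap//.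
- exact/measurable_EFinP.
Qed.

Let I_first (h : T * T -> R) : measurable_fun setT h -> (forall p, 0 <= h p <= C)%R ->
  I (fun p => zeta p.1 * h p)%R = \int[mu]_(p in D) ((zeta p)%:E * \int[mu]_(q in D) (h (p, q))%:E).
Proof.
move=> mh hC; rewrite /I ge0_integral_setX//; last 2 first.
- exact/measurable_EFinP/measurable_funM.
- move=> p; have /andP[? ?] := hC p; have /andP[? ?] := zC p.1.
  by rewrite lee_fin mulr_ge0.
apply: eq_integral => p _; rewrite -ge0_integralZl//=.
- by apply/measurable_funTS/measurable_EFinP; apply: (measurableT_comp mh); exact: measurable_pair1.
- by move=> q _; have /andP[? ?] := hC (p, q); rewrite lee_fin.
- by have /andP[? ?] := zC p; rewrite lee_fin.
Qed.

(** Put [K = h1 - h2]. By [hsym] it is antisymmetric and by [hint] its integral over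
the second variable vanishes, so the integral of [(zeta p - zeta q) * K (p, q)] is
zero. By [mono] this integrand is nonnegative: it cannot be positive on a set of
positive measure. Everything is arranged as an inequality between sums of
nonnegative functions, to stay within Tonelli's theorem. *)
Lemma antisymmetric_test (B : set (T * T)) : measurable B -> B `<=` D `*` D ->
  0 < mu2 B ->
  ~ (forall p, B p -> zeta p.2 * h1 p + zeta p.1 * h2 p <
      zeta p.1 * h1 p + zeta p.2 * h2 p)%R.
Proof.
move=> mB BD B0 H.
have h10 p : (0 <= h1 p)%R by have /andP[] := h1C p.
have h20 p : (0 <= h2 p)%R by have /andP[] := h2C p.
have z0 p : (0 <= zeta p)%R by have /andP[] := zC p.
have [f1 f1'] := I_fin mh1 h1C; have [f2 f2'] := I_fin mh2 h2C.
have E1 : I (fun p => zeta p.1 * h1 p)%R = I (fun p => zeta p.1 * h2 p)%R.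
  by rewrite !I_first//; apply: eq_integral => p /[!inE] Dp; rewrite hint.
(* Exchanging the two variables reduces this to [E1] and to [hsym]. *)
have E2 : I (fun p => zeta p.2 * h1 p)%R = I (fun p => zeta p.2 * h2 p)%R.
  have K (h : T * T -> R) : measurable_fun setT h -> (forall p, 0 <= h p)%R ->
    I (fun p => zeta p.1 * (h p + h (p.2, p.1)))%R = I (fun p => zeta p.1 * h p)%R + I (fun p => zeta p.2 * h p)%R.
    move=> mh h0; rewrite -[X in _ + X]I_swap//; last 2 first.
    - exact: measurable_funM.
    - by move=> p; rewrite mulr_ge0.
    rewrite -I_D//=; last 4 first.
    - exact: measurable_funM.
    - by apply: measurable_funM => //; exact: mh_swap.
    - by move=> p; rewrite mulr_ge0.
    - by move=> p; rewrite mulr_ge0.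
    by apply: eq_integral => -[p q] _ /=; rewrite mulrDr.
  have := K _ mh1 h10; rewrite (_ : I _ = I (fun p => zeta p.1 * (h2 p + h2 (p.2, p.1)))%R); last first.
    by apply: eq_integral => -[p q] _ /=; rewrite hsym.
  rewrite K// E1 => /eqP; rewrite eq_sym.
  by rewrite -(fineK f1') -(fineK f2) -(fineK f2') -!EFinD => /eqP[] /addrI ->.
have : I (fun p => zeta p.2 * h1 p + zeta p.1 * h2 p)%R < I (fun p => zeta p.1 * h1 p + zeta p.2 * h2 p)%R.
  apply: (integral_lt mDD mB BD B0) => //.
  - by apply/measurable_funTS/measurable_funD; exact: measurable_funM.
  - by apply/measurable_funTS/measurable_funD; exact: measurable_funM.
  - by move=> p _; rewrite addr_ge0// mulr_ge0.
  - by move=> -[p q] _; exact: mono.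
  apply: (@bounded_integral_lty _ _ _ _ _ _ (C * C + C * C)%R) => //.
    by apply/measurable_funTS/measurable_funD; exact: measurable_funM.
  move=> p _; rewrite addr_ge0 ?mulr_ge0//=.
  have /andP[_ ?] := h1C p; have /andP[_ ?] := h2C p; have /andP[_ ?] := zC p.1; have /andP[_ ?] := zC p.2.
  by apply: lerD; exact: ler_pM.
rewrite !I_D//; try exact: measurable_funM; try by move=> p; rewrite mulr_ge0.
by rewrite E2 -E1 addeC ltxx.
Qed.

End antisymmetric_test.

(** * Fronts and their inverses *)

Section fronts.
Variables (R : realType) (a : R).
Implicit Type g : R -> R.

Lemma nondecreasing_front_bounds g : {homo g : x y / x <= y} ->
  g x @[x --> -oo] --> - a -> g x @[x --> +oo] --> a ->
  forall x, - a <= g x <= a.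
Proof.
move=> gm gNy gy x; apply/andP; split.
  apply/ler_addgt0Pr => e e0.
  have /cvgrPdist_lt/(_ _ e0) H := gNy.
  have [z [zx]] : exists z, z <= x /\ `|- a - g z| < e.
    near -oo_R => z; exists z; split; first by near: z; apply: nbhs_ninfty_le; exact: num_real.
    by near: z.
  rewrite ltr_distlC => /andP[h _].
  by have := gm _ _ zx; move: h; rewrite ltrBlDr => /ltW h h'; rewrite (le_trans h)// lerD2r.
apply/ler_addgt0Pr => e e0.
have /cvgrPdist_lt/(_ _ e0) H := gy.
have [z [zx]] : exists z, x <= z /\ `|a - g z| < e.
  near +oo_R => z; exists z; split; first by near: z; apply: nbhs_pinfty_ge; exact: num_real.
  by near: z.
rewrite ltr_distlC => /andP[_ h].
by rewrite (le_trans (gm _ _ zx))// ltW.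
Unshelve. all: by end_near. Qed.

Definition front g := [/\ continuous g, {homo g : x y / x < y},
  g x @[x --> -oo] --> - a & g x @[x --> +oo] --> a].

(** The value outside the range of [g] only has to be a fixed number, so that the
inverse is measurable on the whole line. *)
Definition front_inv g s := if - a < s < a then xget 0 [set x | g x = s] else 0.

Variable g : R -> R.
Hypothesis Hg : front g.

Lemma front_mono : {mono g : x y / x < y}.
Proof. by case: Hg => _ h _ _; apply: leW_mono; exact: le_mono. Qed.

Lemma front_le_mono : {mono g : x y / x <= y}.
Proof. by case: Hg => _ h _ _; exact: le_mono. Qed.

Lemma front_bounds x : - a < g x < a.
Proof.
case: (Hg) => _ gm gNy gy.
have gle : {homo g : x y / x <= y} by move=> y z; rewrite front_le_mono.
have B := nondecreasing_front_bounds gle gNy gy.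
have /andP[h1 _] := B (x - 1); have /andP[_ h2] := B (x + 1).
by rewrite (le_lt_trans h1) ?gm ?(lt_le_trans _ h2)// ?gm ?ltrBlDr ?ltrDl.
Qed.

Lemma front_surj s : - a < s < a -> exists x, g x = s.
Proof.
move=> /andP[s1 s2]; case: (Hg) => cg gm gNy gy.
have [z1 h1] : exists z, g z < s.
  have /cvgrPdist_lt/(_ (s + a)) H := gNy.
  near -oo_R => z; exists z.
  have : `|- a - g z| < s + a by near: z; apply: H; rewrite -[a]opprK subr_gt0.
  by rewrite ltr_distlC => /andP[_]; rewrite addrCA addNr addr0.
have [z2 h2] : exists z, s < g z.
  have /cvgrPdist_lt/(_ (a - s)) H := gy.
  near +oo_R => z; exists z.
  have : `|a - g z| < a - s by near: z; apply: H; rewrite subr_gt0.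
  by rewrite ltr_distlC => /andP[+ _]; rewrite subKr.
have z12 : z1 <= z2 by rewrite -front_le_mono ltW// (lt_trans h1).
have [x _ gx] : exists2 x, x \in `[z1, z2] & g x = s.
  apply: IVT => //; first exact: continuous_subspaceT.
  by rewrite ge_min le_max (ltW h1) (ltW h2) orbT.
by exists x.
Unshelve. all: by end_near. Qed.

Lemma front_invK s : - a < s < a -> g (front_inv g s) = s.
Proof.
move=> sa; rewrite /front_inv sa.
by have [x gx] := front_surj sa; apply: (@xgetPex _ 0 [set x | g x = s]); exists x.
Qed.

(** Sublevels of the inverse are read off [g]; measurability and continuity of the
inverse reduce to those of [g] in this way. *)
Lemma front_inv_lt s x : - a < s < a -> (front_inv g s < x) = (s < g x).
Proof. by move=> sa; rewrite -[LHS]front_mono front_invK. Qed.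

Lemma front_inv_gt s x : - a < s < a -> (x < front_inv g s) = (g x < s).
Proof. by move=> sa; rewrite -[LHS]front_mono front_invK. Qed.

Lemma frontK x : front_inv g (g x) = x.
Proof.
have h := front_invK (front_bounds x).
by apply/eqP; rewrite eq_le -[X in X && _]front_le_mono -[X in _ && X]front_le_mono h !lexx.
Qed.
End fronts.

(** * The Euler-Lagrange equation in level coordinates *)

Section strip_measure.
Variable R : realType.

(** A name for the product measure, to which the sigma-finiteness instance can be
attached. *)
Definition strip_measure n : set (measurableTypeR R * n.-tuple R) -> \bar R :=
  (@lebesgue_measure R \x lebesgue_tuple R n)%E.

Arguments strip_measure : clear implicits.

HB.instance Definition _ n := Measure.on (strip_measure n).

HB.instance Definition _ n := Measure_isSigmaFinite.Build _ _ _
  (strip_measure n) (product_sigma_finite _ _).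

End strip_measure.

Arguments strip_measure {R} n _.

Section layers.
Variables (R : realType) (U : R -> R) (L : R) (n : nat) (a : R).
Hypothesis HU : interaction_profile U.
Hypothesis L0 : 0 < L.
Hypothesis a0 : 0 < a.
Local Notation j := (@J R U L n).
Local Notation T := (n.-tuple R).
Local Notation mu := (@lebesgue_measure R).
Local Notation lam := (lebesgue_tuple R n).

Definition front_family (m : R -> 'rV[R]_n -> R) :=
  continuous (fun p : R * 'rV[R]_n => m p.1 p.2) /\
  forall y, front a (m ^~ y).

(** The abscissa at which the profile above the point [p.2] crosses the height
[p.1]. *)
Definition level m (p : R * T) : R := front_inv a (m ^~ (row_of p.2)) p.1.

(** The level coordinates range over this set, which has finite measure, unlike the
strip itself. *)
Definition slab : set (R * T) := `]- a, a[ `*` cube L n.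

Lemma measurable_slab : measurable slab.
Proof. by apply: measurableX; [exact: measurable_itv|exact: measurable_cube]. Qed.

(** The interaction carried by the displacements [d] that lead from the level of
[pq.1] strictly beyond the level of [pq.2]. *)
Definition flux m (pq : (R * T) * (R * T)) : \bar R :=
  (\int[mu]_d (if level m pq.2 < level m pq.1 + d
    then j d (row_of pq.1.2 - row_of pq.2.2) else 0)%:E)%E.

Section one_family.
Variable m : R -> 'rV[R]_n -> R.
Hypothesis Hm : front_family m.

Lemma measurable_family : measurable_fun setT (fun p : R * T => m p.1 (row_of p.2)).
Proof. by case: Hm => cm _; exact: (measurable_continuous_row cm). Qed.

Lemma measurable_family_section x : measurable_fun setT (fun t : T => m x (row_of t)).
Proof. exact: (measurableT_comp measurable_family (measurable_pair1 x)). Qed.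

Lemma measurable_level : measurable_fun setT (level m).
Proof.
apply: (measurability _ (RGenInftyO.measurableE R)) => _ [_ [c ->]] <-.
rewrite setTI.
pose A : set (R * T) := [set p | - a < p.1 < a].
have mA : measurable A.
  rewrite (_ : A = setT `&` (fst @^-1` `]- a, a[%classic)).
    exact: (measurable_fst measurableT _ (measurable_itv `]- a, a[)).
  by apply/seteqP; split => p /=; rewrite in_itv/= => // -[].
pose B : set (R * T) := [set p | p.1 < m c (row_of p.2)].
have mB : measurable B.
  have /(_ measurableT [set true] I) :=
   @measurable_fun_ltr _ _ _ setT (fun p : R * T => p.1) (fun p : R * T => m c (row_of p.2)) measurable_fst
     (measurableT_comp (measurable_family_section c) measurable_snd).
  by rewrite setTI.
(* The second set accounts for the default value of the inverse. *)
rewrite (_ : _ @^-1` _ = (A `&` B) `|` (~` A `&` [set _ | 0 < c])).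
  apply: measurableU; first exact: measurableI.
  apply: measurableI; first exact: measurableC.
  have [c0|c0] := boolP (0 < c).
    by rewrite (_ : [set _ | _] = setT)//; apply/seteqP; split.
  by rewrite (_ : [set _ | _] = set0)//; apply/seteqP; split.
apply/seteqP; split => p /=; rewrite in_itv/= /level.
  have [Ap|Ap] := boolP (- a < p.1 < a).
    by rewrite front_inv_lt//; [left|case: Hm => _].
  by rewrite /front_inv (negbTE Ap) => c0; right; split => //; exact/negP.
move=> [[Ap Bp]|[/negP Ap c0]].
  by rewrite front_inv_lt//; case: Hm => _.
by rewrite /front_inv (negbTE Ap).
Qed.

Lemma measurable_flux_integrand :
  measurable_fun setT (fun z : ((R * T) * (R * T)) * measurableTypeR R =>
   (if level m z.1.2 < level m z.1.1 + z.2
    then j z.2 (row_of z.1.1.2 - row_of z.1.2.2) else 0)%:E).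
Proof.
apply/measurable_EFinP.
have m1 : measurable_fun setT (fun z : ((R * T) * (R * T)) * measurableTypeR R => z.1.1).
  exact: (measurableT_comp measurable_fst measurable_fst).
have m2 : measurable_fun setT (fun z : ((R * T) * (R * T)) * measurableTypeR R => z.1.2).
  exact: (measurableT_comp measurable_snd measurable_fst).
apply: measurable_fun_ifT => //.
- apply: measurable_fun_ltr; first exact: (measurableT_comp measurable_level m2).
  by apply: measurable_funD; [exact: (measurableT_comp measurable_level m1)|exact: measurable_snd].
- exact: (measurable_J L HU measurable_snd (measurableT_comp measurable_snd m1)
    (measurableT_comp measurable_snd m2)).
Qed.

Lemma flux_integrand_ge0 (z : ((R * T) * (R * T)) * measurableTypeR R) :
   (0 <= (if level m z.1.2 < level m z.1.1 + z.2
    then j z.2 (row_of z.1.1.2 - row_of z.1.2.2) else 0)%:E)%E.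
Proof. by case: ifPn => // _; rewrite lee_fin J_ge0. Qed.

Lemma measurable_flux : measurable_fun setT (flux m).
Proof.
exact: (measurable_fun_partial_integral mu measurableT measurable_flux_integrand flux_integrand_ge0).
Qed.

Lemma flux_ge0 pq : (0 <= flux m pq)%E.
Proof. by apply: integral_ge0 => d _; exact: (flux_integrand_ge0 (pq, d)). Qed.

Lemma measurable_flux_section pq : measurable_fun [set: R] (fun d : R =>
   (if level m pq.2 < level m pq.1 + d
    then j d (row_of pq.1.2 - row_of pq.2.2) else 0)).
Proof.
have H := measurableT_comp measurable_flux_integrand (measurable_pair1 pq).
exact: (proj1 (measurable_EFinP _ _) H).
Qed.

(** Reversing [d] in the second term turns the condition on [d] into the opposite
strict inequality, so the two fluxes share out the displacements; the one
displacement that belongs to neither is a null set. *)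
Lemma flux_sum p q : (flux m (p, q) + flux m (q, p) =
   \int[mu]_d (j d (row_of p.2 - row_of q.2))%:E)%E.
Proof.
rewrite /flux/= -[X in (_ + X)%E]integral_oppr; last first.
  by apply/measurable_EFinP; exact: (measurable_flux_section (q, p)).
set r0 := level m q - level m p.
have mr0 : measurable ([set: g_sigma_algebraType R.-ocitv.-measurable] `\ r0).
  by apply: measurableD => //; exact: measurable_set1.
have mj : measurable_fun setT (fun d => j d (row_of p.2 - row_of q.2)).
  exact: measurable_J.
rewrite -[RHS](integral_setD1 (r := r0))//; last exact/measurable_funTS/measurable_EFinP.
rewrite -ge0_integralD//; last 4 first.
- by move=> d _; exact: (flux_integrand_ge0 (p, q, d)).
- by apply/measurable_EFinP; exact: (measurable_flux_section (p, q)).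
- by move=> d _; exact: (flux_integrand_ge0 (q, p, - d)).
- apply/measurable_EFinP.
  exact: (measurableT_comp (measurable_flux_section (q, p)) (@oppr_measurable R setT)).
rewrite -[LHS](integral_setD1 (r := r0))//; last first.
  apply/measurable_funTS/emeasurable_funD.
    by apply/measurable_EFinP; exact: (measurable_flux_section (p, q)).
  apply/measurable_EFinP.
  exact: (measurableT_comp (measurable_flux_section (q, p)) (@oppr_measurable R setT)).
apply: eq_integral => d; rewrite inE => -[_ /= dr0].
rewrite -EFinD; congr EFin.
rewrite (JNx U L) -(JNy U L d (row_of q.2 - row_of p.2)) opprB.
have -> : (level m q < level m p + d) = (r0 < d) by rewrite /r0; apply/idP/idP; lra.
have -> : (level m p < level m q - d) = (d < r0) by rewrite /r0; apply/idP/idP; lra.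
by have [h|h|h] := ltgtP r0 d; rewrite ?addr0 ?add0r//; case: dr0; rewrite h.
Qed.

(** The heights [s] whose level lies before [x] are those between [- a] and the
value of the profile at [x]. *)
Lemma layer_integral (k x : R) t : 0 <= k ->
  (\int[mu]_(s in `](- a)%R, a[) (if level m (s, t) < x then k else 0)%:E =
   (k * (m x (row_of t) + a))%:E)%E.
Proof.
move=> k0; have /andP[M1 M2] := front_bounds (Hm.2 (row_of t)) x.
set M := m x (row_of t) in M1 M2 *.
transitivity (\int[mu]_(s in `](- a)%R, M[) (cst k%:E) s)%E.
  rewrite [LHS]integral_mkcond [RHS]integral_mkcond; apply: eq_integral => s _.
  rewrite !patchE !mem_setE !in_itv/=.
  have [/andP[s1 s2]|sa] := boolP (- a < s < a).
    rewrite s1/= /level/= front_inv_lt//; last by rewrite s1.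
      by rewrite -/M; case: ifPn.
    exact: Hm.2.
  by case: ifPn => // /andP[s1 s2]; rewrite s1 (lt_trans s2) in sa.
rewrite integral_cst//= lebesgue_measure_itv/= lte_fin M1 -EFinB -EFinM opprK//.
Qed.

(** Layer-cake formula: exchanging the integrals over the height of [q] and over the
displacement turns the flux into the convolution of the Euler-Lagrange
equation. The profile is raised by [a] so that all integrands are nonnegative. *)
Lemma flux_int (p : R * T) : - a < p.1 < a ->
  (\int[strip_measure n]_(q in slab) flux m (p, q) =
   \int[strip_measure n]_(z in setT `*` cube L n)
     (j z.1 (row_of p.2 - row_of z.2) * (m (level m p + z.1) (row_of z.2) + a))%:E)%E.
Proof.
move=> pa.
have mc : measurable (cube L n) by exact: measurable_cube.
have mI : measurable (`]- a, a[ : set (measurableTypeR R)) by exact: measurable_itv.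
rewrite /strip_measure /slab ge0_integral_setX_swap//; last 2 first.
- exact: (measurableT_comp measurable_flux (measurable_pair1 p)).
- by move=> q; exact: flux_ge0.
rewrite ge0_integral_setX_swap//; last 2 first.
- apply/measurable_EFinP; apply: measurable_funM.
    exact: (measurable_J L HU measurable_fst (@measurable_cst _ _ _ _ setT p.2) measurable_snd).
  apply: measurable_funD => //.
  apply: (measurableT_comp measurable_family (g := fun z : R * T => (level m p + z.1, z.2))).
  apply/measurable_fun_pairP; split => /=; last exact: measurable_snd.
  by apply: measurable_funD => //; exact: measurable_fst.
- move=> z; rewrite lee_fin mulr_ge0 ?(J_ge0 L HU)//.
  by have /andP[/ltW] := front_bounds (Hm.2 (row_of z.2)) (level m p + z.1); rewrite -subr_ge0 opprK addrC.
apply: eq_integral => t _; rewrite /flux/=.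
rewrite (@ge0_integral_swap _ _ _ _ _ mu mu _ setT
  (fun z : R * R => (if level m (z.1, t) < level m p + z.2 then j z.2 (row_of p.2 - row_of t) else 0)%:E))//.
- by apply: eq_integral => d _; rewrite -layer_integral// (J_ge0 L HU).
- have H : @measurable_fun _ _ (measurableTypeR R * measurableTypeR R)%type _ setT (fun z : R * R => ((p, (z.1, t)), z.2) : ((R * T) * (R * T)) * R).
    apply/measurable_fun_pairP; split => /=; last exact: measurable_snd.
    apply/measurable_fun_pairP; split => /=; first exact: measurable_cst.
    by apply/measurable_fun_pairP; split => /=; [exact: (@measurable_fst _ _ (measurableTypeR R) (measurableTypeR R))|exact: measurable_cst].
  exact: (measurableT_comp measurable_flux_integrand H).
- by move=> z; exact: (flux_integrand_ge0 (p, (z.1, t), z.2)).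
Qed.

End one_family.
End layers.

(** * Two solutions with the same balance differ by a translation *)

Lemma atan_shift_bounds (R : realType) (x : R) : 0 <= atan x + pi / 2 <= pi.
Proof.
by have := atan_gtNpi2 x; have := atan_ltpi2 x => *; apply/andP; split; lra.
Qed.

Lemma dist_lt_near (R : realFieldType) (x y x' y' r : R) :
  `|x - y| < r / 2 -> `|x' - x| < r / 4 -> `|y' - y| < r / 4 -> `|x' - y'| < r.
Proof.
by rewrite !ltr_norml => /andP[? ?] /andP[? ?] /andP[? ?]; apply/andP; split; lra.
Qed.

Lemma difference_stable (R : realFieldType) (x1 y1 x2 y2 x1' y1' x2' y2' e : R) :
  e <= ((x1 - y1) - (x2 - y2)) / 4 -> `|x1' - x1| < e -> `|y1' - y1| < e ->
  `|x2' - x2| < e -> `|y2' - y2| < e -> x2' - y2' < x1' - y1'.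
Proof.
by rewrite !ltr_norml => ? /andP[? ?] /andP[? ?] /andP[? ?] /andP[? ?]; lra.
Qed.

Lemma lerBB_swap (R : numDomainType) (x y z t : R) :
  (x - y <= z - t) = (x - z <= y - t).
Proof. by rewrite -subr_ge0 -[RHS]subr_ge0; congr (_ <= _); ring. Qed.

Lemma ltrBB_swap (R : numDomainType) (x y z t : R) :
  (x - y < z - t) = (x - z < y - t).
Proof. by rewrite -subr_gt0 -[RHS]subr_gt0; congr (_ < _); ring. Qed.

(** The difference of the two sides is [(z - z') * (h - h')]. *)
Lemma rearrangement_le (R : realDomainType) (z z' h h' : R) :
  z' <= z -> h' <= h -> z' * h + z * h' <= z * h + z' * h'.
Proof.
move=> zz hh; rewrite -subr_ge0 [X in 0 <= X](_ : _ = (z - z') * (h - h')); last by ring.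
by rewrite mulr_ge0// subr_ge0.
Qed.

Lemma rearrangement_lt (R : realDomainType) (z z' h h' : R) :
  z' < z -> h' < h -> z' * h + z * h' < z * h + z' * h'.
Proof.
move=> zz hh; rewrite -subr_gt0 [X in 0 < X](_ : _ = (z - z') * (h - h')); last by ring.
by rewrite mulr_gt0// subr_gt0.
Qed.

Section rigidity.
Variables (R : realType) (U : R -> R) (L : R) (n : nat) (a : R).
Hypothesis HU : interaction_profile U.
Hypothesis L0 : 0 < L.
Hypothesis a0 : 0 < a.
Local Notation j := (@J R U L n).
Local Notation T := (n.-tuple R).
Local Notation mu := (@lebesgue_measure R).
Local Notation lam := (lebesgue_tuple R n).
Local Notation front_family := (@front_family R n a).
Local Notation level := (@level R n a).
Local Notation slab := (@slab R L n a).
Local Notation flux := (@flux R U L n a).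

Lemma strip_measureX (A : set R) (B : set T) : measurable A -> measurable B ->
  strip_measure n (A `*` B) = (mu A * lam B)%E.
Proof. by move=> mA mB; rewrite /strip_measure product_measure1E. Qed.

Lemma slab_lty : (strip_measure n slab < +oo)%E.
Proof.
rewrite strip_measureX; [|exact: measurable_itv|exact: measurable_cube].
rewrite lte_mul_pinfty//; last exact: lebesgue_cube_finite.
by rewrite ge0_fin_numE// lebesgue_measure_itv/=; case: ifP; rewrite ?ltry// -EFinB ltry.
Qed.

(** The kernel is bounded by [U 0] and has finite range. *)
Lemma kernel_mass : exists2 C : R, 0 <= C & forall t t' : T,
  (\int[mu]_d (j d (row_of t - row_of t'))%:E <= C%:E)%E.
Proof.
have [rho rho0 Hrho] := J_finite_range L n HU.
have U00 : 0 <= U 0 by case: HU => + _ _ _; apply.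
exists (U 0 * (rho - - rho)); first by rewrite mulr_ge0// subr_ge0 ge0_cp// ltW.
move=> t t'.
apply: (@le_trans _ _ (\int[mu]_(d in `[(- rho)%R, rho]) (cst (U 0)%:E) d)%E).
  rewrite [leRHS]integral_mkcond; apply: ge0_le_integral => //.
  - by move=> d _; rewrite lee_fin (J_ge0 L HU).
  - by apply/measurable_EFinP; apply: (measurable_J L HU) => //.
  - by apply: measurable_patch_itv.
  - move=> d _; rewrite patchE mem_setE in_itv/= -ler_norml.
    by case: ifPn => [_|]; [rewrite lee_fin (J_le L HU)|rewrite -ltNge => /Hrho ->].
rewrite integral_cst//= lebesgue_measure_itv/= lte_fin.
by rewrite (lt_le_trans (_ : - rho < 0))// ?oppr_lt0// ?(ltW rho0)// -EFinB -EFinM.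
Qed.

Lemma flux_le m : front_family m -> forall pq,
  (flux m pq <= \int[mu]_d (j d (row_of pq.1.2 - row_of pq.2.2))%:E)%E.
Proof.
move=> Hm [p q]; rewrite -(flux_sum L HU Hm).
by rewrite leeDl// (flux_ge0 L a HU).
Qed.

(** Raising the level of [q] relative to that of [p] leaves fewer displacements
that pass it. *)
Lemma flux_homo m1 m2 p q : front_family m1 -> front_family m2 ->
  level m1 q - level m1 p <= level m2 q - level m2 p ->
  (flux m2 (p, q) <= flux m1 (p, q))%E.
Proof.
move=> H1 H2 h; apply: ge0_le_integral => //=.
- by move=> d _; exact: (flux_integrand_ge0 L a HU m2 (p, q, d)).
- by apply/measurable_EFinP; exact: (measurable_flux_section L HU H2 (p, q)).
- by apply/measurable_EFinP; exact: (measurable_flux_section L HU H1 (p, q)).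
move=> d _; rewrite lee_fin; case: ifPn => [h2|_]; last by case: ifP => // _; exact: J_ge0.
by rewrite ifT//; move: h h2; lra.
Qed.

(** If the profile at [p0.2] crosses [p0.1] at [x0], then by continuity of [m] the
profiles above nearby points are already above nearby heights at [x0 + e], and
still below them at [x0 - e]. *)
Lemma level_near m (Hm : front_family m) (p0 : R * T) (e : R) : - a < p0.1 < a -> 0 < e ->
  exists2 d : R, 0 < d & forall p : R * T, `|p.1 - p0.1| < d -> tuple_box p0.2 d p.2 ->
    - a < p.1 < a /\ `|level m p - level m p0| < e.
Proof.
move=> p0a e0; set x0 := level m p0; case: (Hm) => cm fm.
have mx0 : m x0 (row_of p0.2) = p0.1 by exact: (front_invK (fm _)).
have cx x : continuous (fun z : R * 'rV[R]_n => m x z.2 - z.1).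
  move=> z; apply: cvgB; last exact: cvg_fst.
  apply: (@continuous_comp _ _ _ (fun z : R * 'rV[R]_n => (x, z.2)) (fun p : R * 'rV[R]_n => m p.1 p.2)); last exact: cm.
  by rewrite /continuous_at; case: z => z1 z2; exact: (cvg_pair (cvg_cst x) (@cvg_snd _ _ (nbhs z1) (nbhs z2) _)).
have [d1 d10 h1] : exists2 d : R, 0 < d & forall x (y : 'rV[R]_n), `|x - p0.1| < d ->
    (forall i, `|y ord0 i - row_of p0.2 ord0 i| < d) -> x < m (x0 + e) y.
  apply: (@near_row_box _ _ _ _ (fun z => z.1 < m (x0 + e) z.2)).
  have /(cvgr_gt _ (cx (x0 + e) (p0.1, row_of p0.2))) : 0 < m (x0 + e) (row_of p0.2) - p0.1.
    by rewrite subr_gt0 -{1}mx0 (front_mono (fm _)) ltrDl.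
  by apply: filterS => z; rewrite subr_gt0.
have [d2 d20 h2] : exists2 d : R, 0 < d & forall x (y : 'rV[R]_n), `|x - p0.1| < d ->
    (forall i, `|y ord0 i - row_of p0.2 ord0 i| < d) -> m (x0 - e) y < x.
  apply: (@near_row_box _ _ _ _ (fun z => m (x0 - e) z.2 < z.1)).
  have /(cvgr_lt _ (cx (x0 - e) (p0.1, row_of p0.2))) : m (x0 - e) (row_of p0.2) - p0.1 < 0.
    by rewrite subr_lt0 -mx0 (front_mono (fm _)) ltrBlDr ltrDl.
  by apply: filterS => z; rewrite subr_lt0.
exists (Num.min d1 d2); first by rewrite lt_min d10.
move=> p; rewrite lt_min => /andP[pd1 pd2] box.
have {}h1 : p.1 < m (x0 + e) (row_of p.2).
  by apply: h1 => // i; rewrite !mxE; have := box i; rewrite lt_min => /andP[].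
have {}h2 : m (x0 - e) (row_of p.2) < p.1.
  by apply: h2 => // i; rewrite !mxE; have := box i; rewrite lt_min => /andP[].
have pa : - a < p.1 < a.
  have /andP[b1 _] := front_bounds (fm (row_of p.2)) (x0 - e).
  have /andP[_ b2] := front_bounds (fm (row_of p.2)) (x0 + e).
  by rewrite (lt_trans b1 h2) (lt_trans h1 b2).
split => //; rewrite ltr_distl; apply/andP; split.
  by rewrite (front_inv_gt (fm _)).
by rewrite (front_inv_lt (fm _)).
Qed.

Variables (r c : R).
Hypothesis r0 : 0 < r.
Hypothesis c0 : 0 < c.
Hypothesis Jpos : forall x (y : 'rV[R]_n), `|x| < r -> (forall i, `|y ord0 i| < r) -> c <= j x y.

(** The displacements between the two level differences are counted by the first
flux only. They form an interval that meets the range on which the kernel is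
bounded below. *)
Lemma flux_lt m1 m2 p q : front_family m1 -> front_family m2 ->
  (forall i, `|tnth p.2 i - tnth q.2 i| < r) ->
  `|level m1 p - level m1 q| < r ->
  level m1 q - level m1 p < level m2 q - level m2 p ->
  (flux m2 (p, q) < flux m1 (p, q))%E.
Proof.
move=> H1 H2 pqr; rewrite ltr_norml => /andP[A1 A2] h.
set A := level m1 q - level m1 p in h *; set B := level m2 q - level m2 p in h *.
have Ar : A < Num.min B r by rewrite lt_min h/= /A; lra.
apply: (@integral_lt _ _ _ mu setT `]A, (Num.min B r)[%classic).
- by [].
- exact: measurable_itv.
- by [].
- exact: lebesgue_itv_gt0.
- exact: (measurable_flux_section L HU H2 (p, q)).
- exact: (measurable_flux_section L HU H1 (p, q)).
- by move=> d _; case: ifP => // _; exact: J_ge0.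
- move=> d _; case: ifPn => [h2|_]; last by case: ifP => // _; exact: J_ge0.
  by rewrite ifT//; move: h h2; rewrite /A /B/=; lra.
- move=> d; rewrite /= in_itv/= lt_min => /andP[d1 /andP[d2 d3]].
  rewrite ifF; last by apply/negbTE; rewrite -leNgt; move: d2; rewrite /B; lra.
  rewrite ifT; last by move: d1; rewrite /A; lra.
  apply: (lt_le_trans c0); apply: Jpos.
    by rewrite ltr_norml d3 andbT; move: d1; rewrite /A; lra.
  by move=> i; rewrite !mxE.
have [C C0 HC] := kernel_mass.
exact: (le_lt_trans (flux_le H2 (p, q)) (le_lt_trans (HC _ _) (ltry _))).
Qed.

Variables (m1 m2 : R -> 'rV[R]_n -> R).
Hypothesis Hm1 : front_family m1.
Hypothesis Hm2 : front_family m2.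
Hypothesis balance : forall (s : R) (t : T), - a < s < a -> cube L n t ->
  (\int[strip_measure n]_(z in setT `*` cube L n)
     (j z.1 (row_of t - row_of z.2) * (m1 (level m1 (s, t) + z.1) (row_of z.2) + a))%:E =
   \int[strip_measure n]_(z in setT `*` cube L n)
     (j z.1 (row_of t - row_of z.2) * (m2 (level m2 (s, t) + z.1) (row_of z.2) + a))%:E)%E.

Let gap p := level m1 p - level m2 p.
(* The gap may be unbounded near the ends of the range, hence the arctangent. *)
Let zeta p := atan (gap p) + pi / 2.

Let zeta_lt p q : gap p < gap q -> zeta p < zeta q.
Proof. by rewrite /zeta ltrD2r => ?; exact: lt_atan. Qed.

Let zeta_le p q : gap p <= gap q -> zeta p <= zeta q.
Proof. by rewrite /zeta lerD2r => ?; exact: le_atan. Qed.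

Let measurable_zeta : measurable_fun setT zeta.
Proof.
apply: measurable_funD => //.
apply: (measurableT_comp (continuous_measurable_fun (@continuous_atan R))).
by apply: measurable_funB; exact: measurable_level.
Qed.

Let flux_fin m pq : front_family m -> flux m pq \is a fin_num.
Proof.
move=> Hm; have [C C0 HC] := kernel_mass.
rewrite ge0_fin_numE ?(flux_ge0 L a HU)//.
exact: (le_lt_trans (flux_le Hm pq) (le_lt_trans (HC _ _) (ltry _))).
Qed.

Let measurable_fine_flux m : front_family m -> measurable_fun setT (fun pq => fine (flux m pq)).
Proof.
move=> Hm; apply: (measurableT_comp (f := fine)) => //.
exact: measurable_flux.
Qed.

(** Otherwise [gap q < gap p] holds for [p] and [q] in small boxes around [p0] and
[q0] by continuity of the levels, and [antisymmetric_test] is contradicted on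
the product of these boxes. *)
Let gap_le_local (p0 q0 : R * T) : slab p0 -> slab q0 ->
  (forall i, `|tnth p0.2 i - tnth q0.2 i| < r / 2) ->
  `|level m1 p0 - level m1 q0| < r / 2 -> gap p0 <= gap q0.
Proof.
move=> [p0a p0L] [q0a q0L] tpq pqr; rewrite leNgt; apply/negP => gpq.
move: p0a q0a; rewrite /= !in_itv/= => p0a q0a.
(* With this precision the levels of [p] and [q] stay closer than [r], and their
   gaps stay in the same order. *)
pose e := Num.min (r / 4) ((gap p0 - gap q0) / 4).
have e0 : 0 < e by rewrite lt_min !divr_gt0// subr_gt0.
have er : e <= r / 4 by rewrite /e ge_min lexx.
have eg : e <= (gap p0 - gap q0) / 4 by rewrite /e ge_min lexx orbT.
have [d1 d10 h1] := level_near Hm1 p0a e0.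
have [d2 d20 h2] := level_near Hm2 p0a e0.
have [d3 d30 h3] := level_near Hm1 q0a e0.
have [d4 d40 h4] := level_near Hm2 q0a e0.
pose d := Num.min (Num.min (Num.min d1 d2) (Num.min d3 d4)) (r / 4).
have d0 : 0 < d by rewrite !lt_min d10 d20 d30 d40 divr_gt0.
have [dd1 dd2 dd3 dd4 ddr] : [/\ d <= d1, d <= d2, d <= d3, d <= d4 & d <= r / 4].
  by rewrite /d !ge_min !lexx ?orbT.
pose bx (p : R * T) : set (R * T) := ball p.1 d `*` (tuple_box p.2 d `&` cube L n).
have mbx p : measurable (bx p).
  apply: measurableX; first exact: measurable_ball.
  by apply: measurableI; [exact: measurable_tuple_box|exact: measurable_cube].
have bx_dist (p p' : R * T) d' : d <= d' -> bx p p' -> `|p'.1 - p.1| < d' /\ tuple_box p.2 d' p'.2.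
  move=> dd' [/= b1 [b2 _]]; split; first by rewrite distrC (lt_le_trans b1).
  by move=> i; rewrite (lt_le_trans (b2 i)).
have bx_gt0 p : cube L n p.2 -> (0 < strip_measure n (bx p))%E.
  move=> Lp; rewrite strip_measureX; last 2 first.
  - exact: measurable_ball.
  - by apply: measurableI; [exact: measurable_tuple_box|exact: measurable_cube].
  apply: mule_gt0; last exact: lebesgue_tuple_box_gt0.
  rewrite ball_itv; apply: lebesgue_itv_gt0; lra.
have B0 : (0 < (strip_measure n \x strip_measure n) (bx p0 `*` bx q0))%E.
  rewrite product_measure1E; [|exact: mbx|exact: mbx].
  by apply: mule_gt0; exact: bx_gt0.
have [C C0 HC] := kernel_mass.
pose D := Num.max C pi.
have CD : C <= D by rewrite le_max lexx.
have piD : pi <= D by rewrite le_max lexx orbT.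
have flux_bound m : front_family m -> forall pq, 0 <= fine (flux m pq) <= D.
  move=> Hm pq; rewrite fine_ge0 ?(flux_ge0 L a HU)//= (le_trans _ CD)//.
  by rewrite -lee_fin fineK ?flux_fin// (le_trans (flux_le Hm pq)).
have D0 : 0 <= D by rewrite (le_trans C0).
apply: (@antisymmetric_test _ _ _ (strip_measure n) slab (fun pq => fine (flux m1 pq))
  (fun pq => fine (flux m2 pq)) zeta D _ _ _ _ _ _ _ _ _ _ _ (bx p0 `*` bx q0)).
- exact: measurable_slab.
- exact: slab_lty.
- exact: measurable_fine_flux.
- exact: measurable_fine_flux.
- exact: measurable_zeta.
- exact: flux_bound.
- exact: flux_bound.
- by move=> p; have /andP[z1 z2] := atan_shift_bounds (gap p); rewrite z1 (le_trans z2).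
- move=> p q.
  rewrite -(fineD (flux_fin _ Hm1) (flux_fin _ Hm1)).
  rewrite -(fineD (flux_fin _ Hm2) (flux_fin _ Hm2)).
  by rewrite (flux_sum L HU Hm1) (flux_sum L HU Hm2).
- move=> [s t] [/= + Lt]; rewrite in_itv/= => sa.
  under eq_integral do rewrite fineK ?flux_fin//.
  under [RHS]eq_integral do rewrite fineK ?flux_fin//.
  by rewrite !(flux_int L HU)//; exact: balance.
- move=> p q; have [g|/ltW g] := leP (gap p) (gap q).
    have f12 : fine (flux m1 (p, q)) <= fine (flux m2 (p, q)).
      rewrite fine_le ?flux_fin//; apply: flux_homo => //.
      by rewrite lerBB_swap -opprB -[leRHS]opprB lerN2.
    rewrite addrC [leRHS]addrC; apply: rearrangement_le => //; exact: zeta_le.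
  have f12 : fine (flux m2 (p, q)) <= fine (flux m1 (p, q)).
    rewrite fine_le ?flux_fin//; apply: flux_homo => //.
    by rewrite -lerBB_swap.
  by apply: rearrangement_le => //; exact: zeta_le.
- by apply: measurableX; exact: mbx.
- move=> [p q] [/= bp bq]; split; split.
  + by rewrite /= in_itv/=; have [? ?] := bx_dist _ _ _ dd1 bp; have [] := h1 p.
  + by case: bp => _ [].
  + by rewrite /= in_itv/=; have [? ?] := bx_dist _ _ _ dd3 bq; have [] := h3 q.
  + by case: bq => _ [].
- exact: B0.
move=> [p q] [/= bp bq].
have [u1 v1] := bx_dist _ _ _ dd1 bp; have [_ l1] := h1 _ u1 v1.
have [u2 v2] := bx_dist _ _ _ dd2 bp; have [_ l2] := h2 _ u2 v2.
have [u3 v3] := bx_dist _ _ _ dd3 bq; have [_ l3] := h3 _ u3 v3.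
have [u4 v4] := bx_dist _ _ _ dd4 bq; have [_ l4] := h4 _ u4 v4.
have [_ bp2] := bx_dist _ _ _ ddr bp; have [_ bq2] := bx_dist _ _ _ ddr bq.
have gl : gap q < gap p by exact: (difference_stable eg l1 l2 l3 l4).
have fl : (flux m2 (p, q) < flux m1 (p, q))%E.
  apply: flux_lt => //.
  - by move=> i; exact: (dist_lt_near (tpq i) (bp2 i) (bq2 i)).
  - by apply: (dist_lt_near pqr); apply: (lt_le_trans _ er).
  - by rewrite -ltrBB_swap.
have {}fl : fine (flux m2 (p, q)) < fine (flux m1 (p, q)) by rewrite fine_lt ?flux_fin.
by apply: rearrangement_lt => //; exact: zeta_lt.
Qed.

Let gap_eq_local (p0 q0 : R * T) : slab p0 -> slab q0 ->
  (forall i, `|tnth p0.2 i - tnth q0.2 i| < r / 2) ->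
  `|level m1 p0 - level m1 q0| < r / 2 -> gap p0 = gap q0.
Proof.
move=> Dp Dq tr lr; apply/eqP; rewrite eq_le !gap_le_local// 1?distrC//.
by move=> i; rewrite distrC.
Qed.

(** The gap is locally constant, at a scale [r / 2] which is the same everywhere, in
the coordinates [(x, t)]. Any two points of the strip are joined by a segment,
which steps shorter than this scale subdivide. *)
Lemma rigidity : exists c1 : R, forall x (t : T), cube L n t ->
  m1 x (row_of t) = m2 (x - c1) (row_of t).
Proof.
pose G x (t : T) := gap (m1 x (row_of t), t).
have lev x (t : T) : level m1 (m1 x (row_of t), t) = x.
  by rewrite /level; exact: (frontK (Hm1.2 (row_of t))).
have step x x' (t t' : T) : cube L n t -> cube L n t' -> `|x - x'| < r / 2 ->
    (forall i, `|tnth t i - tnth t' i| < r / 2) -> G x t = G x' t'.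
  move=> Lt Lt' xr tr; apply: gap_eq_local => //; rewrite ?lev//.
    by split => //=; rewrite in_itv/=; exact: (front_bounds (Hm1.2 _)).
  by split => //=; rewrite in_itv/=; exact: (front_bounds (Hm1.2 _)).
have const x x' (t t' : T) : cube L n t -> cube L n t' -> G x t = G x' t'.
  move=> Lt Lt'.
  (* [B] steps suffice for each of them to be shorter than [r / 2]. *)
  pose B := 2 / r * (`|x' - x| + L).
  have [N NB] : exists N : nat, B < N.+1%:R.
    exists (Num.truncn B); exact: truncnS_gt.
  pose l (k : nat) : R := k%:R / N.+1%:R.
  pose X k := x + l k * (x' - x).
  pose Y k : T := [tuple tnth t i + l k * (tnth t' i - tnth t i) | i < n].
  have N0 : 0 < N.+1%:R :> R by rewrite ltr0n.
  have l1 k : l k.+1 - l k = N.+1%:R^-1.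
    by rewrite /l -mulrBl -natrB// subSnn mul1r.
  have Ni0 : 0 <= N.+1%:R^-1 :> R by rewrite invr_ge0 ltW.
  have lB : N.+1%:R^-1 * (`|x' - x| + L) < r / 2.
    rewrite mulrC ltr_pdivrMr//; move: NB; rewrite /B.
    by rewrite -ltr_pdivlMl ?divr_gt0// invf_div mulrC (mulrC _ (r / 2)).
  have LY k : (k <= N.+1)%N -> cube L n (Y k).
    move=> kN i; rewrite tnth_mktuple; have := Lt i; have := Lt' i.
    have : 0 <= l k <= 1.
      by rewrite divr_ge0//= ler_pdivrMr// mul1r ler_nat.
    by move=> /andP[? ?] /andP[? ?] /andP[? ?]; apply/andP; split; nra.
  have H k : (k <= N.+1)%N -> G x t = G (X k) (Y k).
    elim: k => [|k IH] kN.
      congr G; first by rewrite /X /l mul0r mul0r addr0.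
      by apply: eq_from_tnth => i; rewrite tnth_mktuple /l !mul0r addr0.
    rewrite IH ?(ltnW kN)//; apply: step; [exact/LY/ltnW|exact: LY| |].
      have -> : X k - X k.+1 = - (N.+1%:R^-1 * (x' - x)) by rewrite /X -(l1 k); ring.
      rewrite normrN normrM (ger0_norm Ni0).
      by apply: (le_lt_trans _ lB); rewrite ler_wpM2l// lerDl ltW.
    move=> i; rewrite !tnth_mktuple.
    rewrite (_ : _ - _ = - (N.+1%:R^-1 * (tnth t' i - tnth t i))); last by rewrite -(l1 k); ring.
    rewrite normrN normrM (ger0_norm Ni0).
    apply: (le_lt_trans _ lB); rewrite ler_wpM2l//.
    have := Lt i; have := Lt' i => /andP[? ?] /andP[? ?].
    have : 0 <= `|x' - x| by [].
    by rewrite ler_norml => ?; apply/andP; split; lra.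
  rewrite (H N.+1)//; congr G; first by rewrite /X /l divff ?gt_eqF// mul1r subrKC.
  by apply: eq_from_tnth => i; rewrite tnth_mktuple /l divff ?gt_eqF// mul1r subrKC.
pose t0 : T := [tuple 0 | i < n].
have Lt0 : cube L n t0 by move=> i; rewrite tnth_mktuple lexx ltW.
exists (G 0 t0) => x t Lt.
have := const x 0 t t0 Lt Lt0; rewrite {1}/G /gap lev => E.
have -> : x - G 0 t0 = level m2 (m1 x (row_of t), t) by rewrite -E; lra.
rewrite /level/=; apply/esym/(front_invK (Hm2.2 (row_of t))).
exact: (front_bounds (Hm1.2 _)).
Qed.

End rigidity.

(** * The balance satisfied by monotone solutions *)

Section planar.
Variables (R : realType) (a L : R) (n : nat) (F U : R -> R) (m : R -> 'rV[R]_n -> R).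
Hypothesis a0 : 0 < a.
Hypothesis L0 : 0 < L.
Hypothesis HU : interaction_profile U.
Hypothesis Hm : in_M a L m.
Hypothesis EL : euler_lagrange F U L m.
Local Notation j := (@J R U L n).
Local Notation T := (n.-tuple R).
Local Notation mu := (@lebesgue_measure R).
Local Notation lam := (lebesgue_tuple R n).
Local Notation strip := ([set: R] `*` cube L n : set (measurableTypeR R * T)).

Lemma m_bounds x y : - a <= m x y <= a.
Proof.
by case: Hm => -[_ mNy my _] mh; exact: (nondecreasing_front_bounds (mh y) (mNy y) (my y)).
Qed.

Lemma measurable_strip : measurable strip.
Proof. by apply: measurableX; [exact: measurableT|exact: measurable_cube]. Qed.

Lemma measurable_m (x : R) (v : 'rV[R]_n) :
  measurable_fun setT (fun z : measurableTypeR R * T => m (x + z.1) (row_of z.2 + v)).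
Proof.
case: Hm => -[cm _ _ _] _.
rewrite (_ : (fun z => _) = (fun p : R * T => m p.1 (row_of p.2)) \o (fun z => (x + z.1, tuple_add z.2 v))).
  apply: (measurableT_comp (measurable_continuous_row cm)).
  apply/measurable_fun_pairP; split => /=.
    by apply: measurable_funD => //; exact: measurable_fst.
  exact: (measurableT_comp (@measurable_tuple_add R n v) measurable_snd).
by apply/funext => z /=; rewrite row_of_add.
Qed.

Lemma measurable_j (t : T) :
  measurable_fun setT (fun z : measurableTypeR R * T => j z.1 (row_of t - row_of z.2)).
Proof.
exact: (measurable_J L HU measurable_fst (@measurable_cst _ _ _ _ setT t) measurable_snd).
Qed.

Lemma m_periodic x y k : m x (y + L *: delta_mx ord0 k) = m x y.
Proof. by case: Hm => -[_ _ _ h] _; exact: h. Qed.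

(** Centring the integral at the point itself removes the dependence of its domain
on that point. The vector [v] is kept apart from [t] so that the equation of a
translate of [m] has the same kernel as that of [m]. *)
Lemma el_shift x (t : T) v : derive1 F (m x (row_of t + v)) =
  2 * \int[strip_measure n]_(z in strip)
    (j z.1 (row_of t - row_of z.2) * (m (x + z.1) (row_of z.2 + v) - m x (row_of t + v))).
Proof.
rewrite EL; congr (_ * fine _).
set s := m x _.
pose f (p : R * T) : \bar R := (j (x - p.1) (row_of t + v - row_of p.2) * (m p.1 (row_of p.2) - s))%:E.
have mf : measurable_fun setT f.
  apply/measurable_EFinP; apply: measurable_funM.
    rewrite (_ : (fun p => _) = (fun p : R * T => j (x - p.1) (row_of (tuple_add t v) - row_of p.2))).
      apply: (measurable_J L HU); last exact: measurable_snd.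
        by apply: measurable_funB => //; exact: measurable_fst.
      exact: measurable_cst.
    by apply/funext => p; rewrite row_of_add.
  apply: measurable_funB => //.
  by case: Hm => -[cm _ _ _] _; exact: (measurable_continuous_row cm).
have fp z : tuple_periodic L (fun t => f (z, t)).
  move=> k u; rewrite /f/= row_of_add m_periodic; congr (_ * _)%:E.
  by rewrite opprD addrA -(J_periodic U L _ _ k) subrK.
rewrite -[LHS](integral_strip_shift x v L0 mf fp).
apply: eq_integral => z _; rewrite /f/= row_of_add; congr (_ * _)%:E.
  rewrite -(JNx U L); congr j; first by ring.
  by rewrite opprD addrACA subrr addr0.
by rewrite (addrC x).
Qed.

Definition mass (t : T) : \bar R :=
  (\int[strip_measure n]_(z in strip) (j z.1 (row_of t - row_of z.2))%:E)%E.

Lemma mass_fin t : mass t \is a fin_num.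
Proof.
rewrite ge0_fin_numE; last by apply: integral_ge0 => z _; rewrite lee_fin (J_ge0 L HU).
have mc := @measurable_cube R L n.
rewrite /mass /strip_measure ge0_integral_setX_swap//; last 2 first.
- by apply/measurable_EFinP; exact: measurable_j.
- by move=> z; rewrite lee_fin (J_ge0 L HU).
have [C C0 HC] := kernel_mass L n HU.
apply: (@le_lt_trans _ _ (\int[lam]_(t' in cube L n) (cst C%:E) t')%E).
  apply: ge0_le_integral => //.
  - by move=> t' _; apply: integral_ge0 => d _; rewrite lee_fin (J_ge0 L HU).
  - apply: measurable_funTS.
    apply: (@measurable_fun_partial_integral _ _ _ _ _ mu setT (fun z : T * R => (j z.2 (row_of t - row_of z.1))%:E)) => //.
      apply/measurable_EFinP.
      exact: (measurable_J L HU measurable_snd (@measurable_cst _ _ _ _ setT t) measurable_fst).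
    by move=> z; rewrite lee_fin (J_ge0 L HU).
  - by move=> t' _; exact: HC.
by rewrite integral_cst// lte_mul_pinfty// ?lee_fin// lebesgue_cube_finite.
Qed.

(** The Euler-Lagrange equation with the constant terms moved to the right, so that
the integrand is nonnegative. *)
Lemma balance_formula x (t : T) v :
  (\int[strip_measure n]_(z in strip)
    (j z.1 (row_of t - row_of z.2) * (m (x + z.1) (row_of z.2 + v) + a))%:E =
   (derive1 F (m x (row_of t + v)) / 2 + (m x (row_of t + v) + a) * fine (mass t))%:E)%E.
Proof.
set s := m x _.
have int_j : (strip_measure n).-integrable strip (EFin \o (fun z => j z.1 (row_of t - row_of z.2))).
  apply/integrableP; split.
    by apply/measurable_funTS/measurable_EFinP; exact: measurable_j.
  under eq_integral do rewrite gee0_abs ?lee_fin ?(J_ge0 L HU)//.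
  by have := mass_fin t; rewrite ge0_fin_numE//; apply: integral_ge0 => z _; rewrite lee_fin (J_ge0 L HU).
have int_f : (strip_measure n).-integrable strip (fun z =>
    (j z.1 (row_of t - row_of z.2) * (m (x + z.1) (row_of z.2 + v) - s))%:E).
  apply: (@le_integrable _ _ _ _ _ measurable_strip _ (fun z => (2 * a)%:E * (EFin \o (fun z => j z.1 (row_of t - row_of z.2))) z)%E).
  - apply/measurable_funTS/measurable_EFinP/measurable_funM; first exact: measurable_j.
    by apply: measurable_funB => //; exact: measurable_m.
  - move=> z _; rewrite /= lee_fin !normrM (ger0_norm (J_ge0 L HU _ _)) mulrC.
    apply: ler_wpM2r; first exact: (J_ge0 L HU).
    have /andP[b1 b2] := m_bounds (x + z.1) (row_of z.2 + v).
    have /andP[b3 b4] := m_bounds x (row_of t + v).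
    rewrite -normrM (ger0_norm (mulr_ge0 _ (ltW a0)))// ler_norml -/s in b3 b4 *.
    by apply/andP; split; lra.
  - exact: (integrableZl measurable_strip (2 * a) int_j).
have int_g : (strip_measure n).-integrable strip (fun z => ((s + a)%:E * (j z.1 (row_of t - row_of z.2))%:E)%E).
  exact: (integrableZl measurable_strip (s + a) int_j).
transitivity (\int[strip_measure n]_(z in strip) ((j z.1 (row_of t - row_of z.2) * (m (x + z.1) (row_of z.2 + v) - s))%:E +
   (s + a)%:E * (j z.1 (row_of t - row_of z.2))%:E))%E.
  by apply: eq_integral => z _; rewrite -EFinM -EFinD; congr EFin; ring.
rewrite (integralD measurable_strip int_f int_g) [RHS]EFinD; congr (_ + _)%E.
  have := el_shift x t v; rewrite /Rintegral -/s => ->.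
  by rewrite mulrC mulKf// fineK//; exact: (integrable_fin_num measurable_strip int_f).
rewrite (integralZl measurable_strip int_j) EFinM fineK ?mass_fin//.
Qed.

End planar.

(** * Strict monotonicity and planar symmetry *)

Section planar_symmetry.
Variables (R : realType) (a L : R) (n : nat) (F U : R -> R) (m : R -> 'rV[R]_n -> R).
Hypothesis a0 : 0 < a.
Hypothesis L0 : 0 < L.
Hypothesis HU : interaction_profile U.
Hypothesis Hm : in_M a L m.
Hypothesis EL : euler_lagrange F U L m.
Variables (r c : R).
Hypothesis r0 : 0 < r.
Hypothesis c0 : 0 < c.
Local Notation j := (@J R U L n).
Hypothesis Jpos : forall x (y : 'rV[R]_n), `|x| < r -> (forall i, `|y ord0 i| < r) -> c <= j x y.
Local Notation T := (n.-tuple R).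
Local Notation mu := (@lebesgue_measure R).
Local Notation lam := (lebesgue_tuple R n).
Local Notation strip := ([set: R] `*` cube L n : set (measurableTypeR R * T)).

Let t0 : T := [tuple 0 | i < n].

Let row0 : row_of t0 = 0.
Proof. by apply/rowP => i; rewrite !mxE tnth_mktuple. Qed.

Let cube0 : cube L n t0.
Proof. by move=> i; rewrite tnth_mktuple lexx ltW. Qed.

Let mh : forall y, {homo (fun x => m x y) : x1 x2 / x1 <= x2}.
Proof. by case: Hm. Qed.

(** By [balance_formula] the interaction integrals at [x1] and [x2] agree, although
by monotonicity one integrand dominates the other; so the two cannot differ at
a displacement where the kernel is positive. *)
Lemma equality_spreads v x1 x2 d : x1 <= x2 -> m x1 v = m x2 v -> `|d| < r ->
  m (x1 + d) v = m (x2 + d) v.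
Proof.
move=> x12 E dr; apply/eqP; rewrite eq_le mh ?lerD2r//= leNgt; apply/negP => lt12.
have [e e0 He] : exists2 e : R, 0 < e & forall x (y : 'rV[R]_n), `|x - d| < e ->
    (forall i, `|y ord0 i - (0 : 'rV[R]_n) ord0 i| < e) -> m (x1 + x) (y + v) < m (x2 + x) (y + v).
  apply: (@near_row_box _ _ _ _ (fun z => m (x1 + z.1) (z.2 + v) < m (x2 + z.1) (z.2 + v))).
  have cx x : continuous (fun z : R * 'rV[R]_n => m (x + z.1) (z.2 + v)).
    case: Hm => -[cm _ _ _] _ [z1 z2].
    apply: (@continuous_comp _ _ _ (fun z : R * 'rV[R]_n => (x + z.1, z.2 + v)) (fun p : R * 'rV[R]_n => m p.1 p.2)); last exact: cm.
    apply: (cvg_pair (F := nbhs (z1, z2)) (G := nbhs (x + z1)) (H := nbhs (z2 + v))).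
      by apply: cvgD; [exact: cvg_cst|exact: cvg_fst].
    by apply: cvgD; [exact: cvg_snd|exact: cvg_cst].
  have cd : continuous (fun z : R * 'rV[R]_n => m (x2 + z.1) (z.2 + v) - m (x1 + z.1) (z.2 + v)).
    by move=> z; apply: cvgB; exact: cx.
  have : 0 < m (x2 + d) (0 + v) - m (x1 + d) (0 + v) by rewrite add0r subr_gt0.
  move/(cvgr_gt _ (cd (d, 0))).
  by apply: filterS => z; rewrite subr_gt0.
pose e' := Num.min e (r - `|d|).
have e'0 : 0 < e' by rewrite lt_min e0 subr_gt0.
have e'e : e' <= e by rewrite ge_min lexx.
have e'r : e' <= r - `|d| by rewrite ge_min lexx orbT.
pose B := ball d e' `*` (tuple_box t0 e' `&` cube L n) : set (measurableTypeR R * T).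
have mb : measurable (ball d e' : set R) by exact: measurable_ball.
have mt : measurable (tuple_box t0 e' `&` cube L n).
  by apply: measurableI; [exact: measurable_tuple_box|exact: measurable_cube].
have B0 : (0 < strip_measure n B)%E.
  rewrite strip_measureX//; apply: mule_gt0; last exact: lebesgue_tuple_box_gt0.
  by rewrite ball_itv; apply: lebesgue_itv_gt0; rewrite ltrBlDr -addrA ltrDl addr_gt0.
have := balance_formula a0 L0 HU Hm EL x1 t0 v.
have := balance_formula a0 L0 HU Hm EL x2 t0 v.
rewrite row0 add0r -E => <- eq12.
suff : (\int[strip_measure n]_(z in strip) (j z.1 (0 - row_of z.2) * (m (x1 + z.1) (row_of z.2 + v) + a))%:E <
   \int[strip_measure n]_(z in strip) (j z.1 (0 - row_of z.2) * (m (x2 + z.1) (row_of z.2 + v) + a))%:E)%E.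
  by rewrite eq12 ltxx.
have mint x : measurable_fun strip (fun z => j z.1 (0 - row_of z.2) * (m (x + z.1) (row_of z.2 + v) + a)).
  apply: measurable_funTS; apply: measurable_funM.
    by rewrite -row0; exact: measurable_j.
  by apply: measurable_funD => //; exact: (measurable_m Hm).
have ma0 x y : 0 <= m x y + a.
  by have /andP[] := m_bounds Hm x y; rewrite -subr_ge0 opprK.
apply: (@integral_lt _ _ _ _ _ B) => //.
- exact: measurable_strip.
- exact: measurableX.
- by move=> [z1 z2] [_ [_]].
- by move=> z _; rewrite mulr_ge0// (J_ge0 L HU).
- by move=> z _; rewrite ler_wpM2l ?(J_ge0 L HU)// lerD2r; apply: mh; rewrite lerD2r.
- move=> [z1 z2] [/= b1 [b2 _]].
  have b1' : `|z1 - d| < e' by rewrite distrC.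
  rewrite ltr_pM2l ?ltrD2r.
    apply: He; first exact: (lt_le_trans b1').
    by move=> i; rewrite !mxE; have := b2 i; rewrite tnth_mktuple => b; exact: (lt_le_trans b).
  apply: (lt_le_trans c0); apply: Jpos.
    have := lt_le_trans b1' e'r; rewrite ltrBrDl => h.
    by rewrite (le_lt_trans _ h)// -{1}(subrK d z1) addrC ler_normD.
  move=> i; have := b2 i; rewrite !mxE tnth_mktuple sub0r subr0 normrN => b.
  apply: (lt_le_trans b); apply: (le_trans e'r); rewrite gerBl//.
by rewrite eq12 -row0 (balance_formula a0 L0 HU Hm EL) ltry.
Qed.

(** An equality would spread to the whole line by steps shorter than [r], and make
the profile periodic, against its limits. *)
Lemma m_increasing v : {homo (fun x => m x v) : x1 x2 / x1 < x2}.
Proof.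
move=> x1 x2 x12; rewrite lt_neqAle mh ?(ltW x12)// andbT; apply/negP => /eqP E.
have all d : m (x1 + d) v = m (x2 + d) v.
  have [k kd] : exists k : nat, `|d| / r < k.+1%:R by exists (Num.truncn (`|d| / r)); exact: truncnS_gt.
  have k0 : 0 < k.+1%:R :> R by rewrite ltr0n.
  pose h := d / k.+1%:R.
  have hr : `|h| < r.
    by rewrite normrM normfV (gtr0_norm k0) ltr_pdivrMr// mulrC -ltr_pdivrMr.
  have H i : m (x1 + h *+ i) v = m (x2 + h *+ i) v.
    elim: i => [|i IH]; first by rewrite !mulr0n !addr0.
    by rewrite mulrSr !addrA; apply: equality_spreads => //; rewrite lerD2r ltW.
  by have := H k.+1; rewrite -mulr_natr /h divfK// gt_eqF.
pose delta := x2 - x1.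
have delta0 : 0 < delta by rewrite subr_gt0.
have per x : m (x + delta) v = m x v.
  have := all (x - x1); rewrite subrKC => ->; congr m.
  by rewrite /delta; ring.
have perk k x : m (x + delta *+ k) v = m x v.
  elim: k x => [|k IH] x; first by rewrite mulr0n addr0.
  by rewrite mulrS addrA IH per.
have arch (z : R) : exists k : nat, z <= delta *+ k.
  exists (Num.truncn (z / delta)).+1; rewrite -mulr_natl -ler_pdivrMr//.
  by rewrite ltW// truncnS_gt.
case: Hm => -[_ mNy my _] _.
have [z1 hz1] : exists z, 0 < m z v.
  have /(cvgr_gt _ (my v)) H := a0.
  by near +oo_R => z; exists z; near: z.
have [z2 hz2] : exists z, m z v < 0.
  have /(cvgr_lt _ (mNy v)) H : - a < 0 by rewrite oppr_lt0.
  by near -oo_R => z; exists z; near: z.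
have [k1 K1] := arch (z1 - x1); have [k2 K2] := arch (x1 - z2).
have h1 : 0 < m x1 v by rewrite (lt_le_trans hz1)// -(perk k1 x1) mh// -lerBlDl.
have : m x1 v <= m z2 v by rewrite -(perk k2 z2) mh// -lerBlDl.
by rewrite leNgt (lt_trans hz2 h1).
Unshelve. all: by end_near. Qed.

Lemma shifted_front_family v : front_family a (fun x y => m x (y + v)).
Proof.
case: (Hm) => -[cm mNy my _] _; split.
  move=> [z1 z2].
  apply: (@continuous_comp _ _ _ (fun z : R * 'rV[R]_n => (z.1, z.2 + v)) (fun p : R * 'rV[R]_n => m p.1 p.2)); last exact: cm.
  apply: (cvg_pair (F := nbhs (z1, z2)) (G := nbhs z1) (H := nbhs (z2 + v))).
    exact: cvg_fst.
  by apply: cvgD; [exact: cvg_snd|exact: cvg_cst].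
move=> y; split; [|exact: m_increasing|exact: mNy|exact: my].
move=> x; apply: (@continuous_comp _ _ _ (fun x : R => (x, y + v)) (fun p : R * 'rV[R]_n => m p.1 p.2)); last exact: cm.
by apply: (cvg_pair (F := nbhs x) (G := nbhs x) (H := nbhs (y + v))); [exact: cvg_id|exact: cvg_cst].
Qed.

(** Cube averages do not change when the profile is translated in the [y]
directions, and being strictly increasing they detect a translation in [x]. *)
Lemma cube_average_increasing x1 x2 : x1 < x2 ->
  (\int[lam]_(t in cube L n) (m x1 (row_of t) + a)%:E <
   \int[lam]_(t in cube L n) (m x2 (row_of t) + a)%:E)%E.
Proof.
move=> x12.
have ma x y : 0 <= m x y + a <= a + a.
  by have /andP[h1 h2] := m_bounds Hm x y; rewrite lerD2r h2 andbT -lerBlDr sub0r.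
have mm x : measurable_fun (cube L n) (fun t : T => m x (row_of t) + a).
  apply: measurable_funTS; apply: measurable_funD => //.
  case: Hm => -[cm _ _ _] _.
  exact: (measurableT_comp (measurable_continuous_row cm) (measurable_pair1 x)).
apply: (@integral_lt _ _ _ _ _ (tuple_box t0 1 `&` cube L n)) => //.
- exact: measurable_cube.
- by apply: measurableI; [exact: measurable_tuple_box|exact: measurable_cube].
- exact: lebesgue_tuple_box_gt0.
- by move=> t _; have /andP[] := ma x1 (row_of t).
- by move=> t _; rewrite lerD2r mh// ltW.
- by move=> t _; rewrite ltrD2r m_increasing.
apply: (@bounded_integral_lty _ _ _ _ _ _ (a + a)) => //.
- exact: measurable_cube.
- exact: lebesgue_cube_finite.
Qed.

Lemma planar v x : m x v = m x 0.
Proof.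
have Hm1 : front_family a m.
  by have := shifted_front_family 0; under eq_fun do under eq_fun do rewrite addr0.
have Hm2 := shifted_front_family v.
have [s t sa Lt|c1 Hc1] := rigidity HU L0 r0 c0 Jpos Hm1 Hm2.
  (* At a point where the profile takes the value [s], the right side of the
     balance depends on [s] and [t] only. *)
  have key x' v' : m x' (row_of t + v') = s ->
      (\int[strip_measure n]_(z in strip) (j z.1 (row_of t - row_of z.2) * (m (x' + z.1) (row_of z.2 + v') + a))%:E)%E
      = (derive1 F s / 2 + (s + a) * fine (mass L U t))%:E.
    by move=> <-; exact: balance_formula.
  rewrite [RHS](key (level a (fun x y => m x (y + v)) (s, t)) v); last first.
    exact: (front_invK (Hm2.2 (row_of t)) sa).
  rewrite -(key (level a m (s, t)) 0); last first.
    by rewrite addr0; exact: (front_invK (Hm1.2 (row_of t)) sa).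
  by apply: eq_integral => z _; rewrite addr0.
have shift y : (\int[lam]_(t in cube L n) (m y (row_of t + v) + a)%:E =
    \int[lam]_(t in cube L n) (m y (row_of t) + a)%:E)%E.
  rewrite -(@ge0_integral_cube_shift R n L (fun t => (m y (row_of t) + a)%:E) v L0).
  - by apply: eq_integral => t _; rewrite row_of_add.
  - apply/measurable_EFinP/measurable_funD => //; case: Hm => -[cm _ _ _] _.
    exact: (measurableT_comp (measurable_continuous_row cm) (measurable_pair1 y)).
  - by move=> t; rewrite lee_fin -lerBlDr sub0r; have /andP[] := m_bounds Hm y (row_of t).
  - by move=> k t; rewrite row_of_add (m_periodic Hm).
have c10 : c1 = 0.
  have E : (\int[lam]_(t in cube L n) (m 0 (row_of t) + a)%:E =
      \int[lam]_(t in cube L n) (m (0 - c1) (row_of t) + a)%:E)%E.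
    by rewrite -[RHS]shift; apply: eq_integral => t; rewrite inE => Lt; rewrite Hc1.
  have [h|h|//] := ltgtP c1 0.
    by have := @cube_average_increasing 0 (0 - c1); rewrite E sub0r oppr_gt0 ltxx => /(_ h).
  by have := @cube_average_increasing (0 - c1) 0; rewrite E sub0r oppr_lt0 ltxx => /(_ h).
by have := Hc1 x t0 cube0; rewrite row0 add0r c10 subr0.
Qed.
End planar_symmetry.

(** * Transport along a front and Young's inequality *)

Section transport.
Variables (R : realType) (a : R) (g : R -> R).
Hypothesis a0 : 0 < a.
Hypothesis Hg : front a g.
Local Notation mu := (@lebesgue_measure R).
Local Notation w := (front_inv a g).

(** The map [g x |-> g (x + d)] on the range of [g], extended by the identity:
the flow of translations, read on the values of the front. *)
Definition transport (d s : R) : R := if - a < s < a then g (w s + d) else s.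
Local Notation phi := transport.

Lemma transport_in d s : - a < s < a -> - a < phi d s < a.
Proof. by move=> sa; rewrite /phi sa; exact: front_bounds. Qed.

Lemma transport_out d s : ~~ (- a < s < a) -> phi d s = s.
Proof. by move=> sa; rewrite /phi (negbTE sa). Qed.

Lemma transport_front d x : phi d (g x) = g (x + d).
Proof. by rewrite /phi (front_bounds Hg) (frontK Hg). Qed.

Lemma transport0 s : phi 0 s = s.
Proof. by rewrite /phi; case: ifP => // sa; rewrite addr0 (front_invK Hg). Qed.

Lemma transportD d e s : phi d (phi e s) = phi (e + d) s.
Proof.
have [sa|sa] := boolP (- a < s < a); last by rewrite !transport_out.
by rewrite [phi e s]/phi sa transport_front /phi sa addrA.
Qed.

Lemma transportK d : cancel (phi d) (phi (- d)).
Proof. by move=> s; rewrite transportD subrr transport0. Qed.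

Lemma transportNK d : cancel (phi (- d)) (phi d).
Proof. by move=> s; rewrite transportD addNr transport0. Qed.

Lemma transport_homo d : {homo phi d : s t / s < t}.
Proof.
move=> s t st; have [sa|sa] := boolP (- a < s < a); have [ta|ta] := boolP (- a < t < a).
- rewrite /phi sa ta (front_mono Hg) ltrD2r -(front_mono Hg).
  by rewrite !(front_invK Hg).
- rewrite (transport_out _ ta); have /andP[_ h] := transport_in d sa.
  rewrite (lt_le_trans h)// leNgt; apply: contra ta => ta; rewrite ta andbT.
  by case/andP: sa => sa _; rewrite (lt_trans sa).
- rewrite (transport_out _ sa); have /andP[h _] := transport_in d ta.
  rewrite (le_lt_trans _ h)// leNgt; apply: contra sa => sa; rewrite sa/=.
  by case/andP: ta => _; exact: lt_trans.
- by rewrite !transport_out.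
Qed.

Lemma transport_mono d : {mono phi d : s t / s < t}.
Proof. by apply: leW_mono; apply: le_mono; exact: transport_homo. Qed.

Lemma transport_le_mono d : {mono phi d : s t / s <= t}.
Proof. by apply: le_mono; exact: transport_homo. Qed.

(** A monotone bijection is continuous; its inverse is explicit. *)
Lemma continuous_transport d : continuous (phi d).
Proof.
move=> s; apply/cvgrPdist_lt => e e0.
have h1 : phi (- d) (phi d s - e) < s.
  by rewrite -(transport_mono d) transportNK ltrBlDr ltrDl.
have h2 : s < phi (- d) (phi d s + e).
  by rewrite -(transport_mono d) transportNK ltrDl.
near=> t; rewrite ltr_distlC; apply/andP; split.
  by rewrite -(transport_mono (- d)) transportK; near: t; exact: lt_nbhsr.
by rewrite -(transport_mono (- d)) transportK; near: t; exact: lt_nbhsl.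
Unshelve. all: by end_near. Qed.

Definition displacement d s := phi d s - s.
Local Notation psi := displacement.

Lemma continuous_displacement d : continuous (psi d).
Proof. by move=> s; apply: cvgB; [exact: continuous_transport|exact: cvg_id]. Qed.

Lemma displacement_out d s : ~~ (- a < s < a) -> psi d s = 0.
Proof. by move=> sa; rewrite /psi transport_out// subrr. Qed.

Lemma displacement_le d s : `|psi d s| <= a + a.
Proof.
have [sa|sa] := boolP (- a < s < a); last by rewrite displacement_out// normr0 addr_ge0 ?ltW.
have /andP[? ?] := sa; have /andP[? ?] := transport_in d sa.
by rewrite /psi ler_norml; apply/andP; split; lra.
Qed.

Lemma integrable_displacement d : mu.-integrable setT (EFin \o psi d).
Proof.
have mpsi : measurable_fun [set: R] (psi d).
  by apply: continuous_measurable_fun; exact: continuous_displacement.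
apply/integrableP; split; first exact/measurable_EFinP.
have -> : (\int[mu]_x `|(EFin \o psi d) x| = \int[mu]_(x in `[(- a)%R, a]) `|psi d x|%:E)%E.
  rewrite [RHS]integral_mkcond; apply: eq_integral => x _.
  rewrite patchE mem_setE in_itv/=; case: ifPn => // xa.
  rewrite displacement_out ?normr0//.
  by apply: contra xa => /andP[? ?]; rewrite !ltW.
apply: (@bounded_integral_lty _ _ _ _ _ _ (a + a)).
- exact: measurable_itv.
- exact: lebesgue_itvcc_lty.
- by apply: measurable_funTS; exact: measurableT_comp.
- by move=> x _; rewrite displacement_le normr_ge0.
Qed.

(** A primitive of the displacement that vanishes below [- a]. *)
Definition potential d s := \int[mu]_(t in `]-oo, s]) psi d t.
Local Notation Psi := potential.

Lemma potential_derive (d s : R) : is_derive s 1 (Psi d) (psi d s).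
Proof.
have [] := @continuous_FTC1 R (psi d) -oo%O s (s + 1) _ _ _ (@continuous_displacement d s).
- by rewrite ltrDl.
- by apply: integrableS (integrable_displacement d) => //; exact: measurable_itv.
- by rewrite ltNyr.
move=> h1 h2; apply: (DeriveDef h1).
by rewrite -h2 derive1E.
Qed.

Lemma potential_low d s : s <= - a -> Psi d s = 0.
Proof.
move=> sa; rewrite /Psi /Rintegral (_ : (\int[mu]_(t in _) _ = 0)%E)//.
rewrite integral0_eq// => t; rewrite /= in_itv/= => ts.
rewrite displacement_out// negb_and -leNgt (le_trans ts)//.
Qed.

(** A primitive of [transport d], which is increasing, hence a convex function. *)
Definition primitive d s := Psi d s + s ^+ 2 / 2.
Local Notation Phi := primitive.

Lemma primitive_derive (d s : R) : is_derive s 1 (Phi d) (phi d s).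
Proof.
have h := potential_derive d s.
have h2 : is_derive s 1 (fun s : R => 2^-1 *: s ^+ 2) s.
  by apply: is_derive_eq; rewrite /GRing.scale/= !mulr1; field.
have -> : Phi d = Psi d \+ (fun s : R => 2^-1 *: s ^+ 2).
  by apply/funext => t; rewrite /Phi/= mulrC.
by have := is_deriveD h h2; rewrite /psi subrK.
Qed.

Lemma continuous_primitive d : continuous (Phi d).
Proof.
move=> s; apply/differentiable_continuous/derivable1_diffP.
by have [] := primitive_derive d s.
Qed.

Lemma primitive_lt d s t : s < t ->
  phi d s * (t - s) < Phi d t - Phi d s < phi d t * (t - s).
Proof.
move=> st.
have [x + ->] := MVT st (fun x _ => primitive_derive d x)
  (continuous_subspaceT (@continuous_primitive d)).
rewrite in_itv/= => /andP[sx xt].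
by rewrite !ltr_pM2r ?subr_gt0// !transport_homo.
Qed.

Lemma primitive_le d s t : s <= t ->
  phi d s * (t - s) <= Phi d t - Phi d s <= phi d t * (t - s).
Proof.
rewrite le_eqVlt => /predU1P[->|/(primitive_lt d)/andP[h1 h2]].
  by rewrite !subrr !mulr0 lexx.
by rewrite !ltW.
Qed.

Lemma potential_increment d s t : s <= t ->
  phi d s * (t - s) <= Psi d t - Psi d s + (t ^+ 2 / 2 - s ^+ 2 / 2) <= phi d t * (t - s).
Proof.
move=> st; rewrite (_ : _ + _ = Phi d t - Phi d s); first exact: primitive_le.
by rewrite /Phi; ring.
Qed.

(** The difference of the two sides of Young's inequality: [primitive d] and
[primitive (- d)] are convex conjugates, since their derivatives [transport d] and
[transport (- d)] are inverse to each other. *)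
Definition young d s s' := Phi d s + Phi (- d) s' - s * s'.

Lemma youngE d s s' : young d s s' = Psi d s + Psi (- d) s' + (s - s') ^+ 2 / 2.
Proof. by rewrite /young /Phi; field. Qed.

(** The increments of both primitives are bracketed by their derivatives at the end
points, so along the graph the Young function varies at most by the product of
the increments. *)
Lemma young_graph_lipschitz d s t : s <= t ->
  `|young d t (phi d t) - young d s (phi d s)| <= (phi d t - phi d s) * (t - s).
Proof.
move=> st; have /andP[h1 h2] := primitive_le d st.
have : phi d s <= phi d t by rewrite transport_le_mono.
move=> /(primitive_le (- d))/andP[]; rewrite !transportK => h3 h4.
rewrite ler_norml /young; apply/andP; split; lra.
Qed.

(** By [young_graph_lipschitz] the Young function has derivative zero along the
graph, because [transport d] is continuous; and it vanishes at [- a]. The chain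
rule would not do, since the transport may fail to be differentiable. *)
Lemma young_graph d s : young d s (phi d s) = 0.
Proof.
pose f s := young d s (phi d s).
have base : f (- a) = 0.
  have oa : ~~ (- a < - a < a) by rewrite ltxx.
  rewrite /f youngE (transport_out d oa) !potential_low// subrr expr0n/=.
  by rewrite mul0r !addr0.
rewrite -[LHS]/(f s) -base; apply: is_derive_0_is_cst => {base}s.
apply/is_derive1_caratheodory.
have lip z : `|f z - f s| <= `|phi d z - phi d s| * `|z - s|.
  have [zs|/ltW sz] := leP z s.
    rewrite distrC (le_trans (young_graph_lipschitz d zs))// -normrM.
    by rewrite -mulrNN !opprB ler_norm.
  by rewrite (le_trans (young_graph_lipschitz d sz))// -normrM ler_norm.
exists (fun z => if z == s then 0 else (f z - f s) / (z - s)); split.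
- move=> z; case: eqVneq => [->|zs]; first by rewrite !subrr mul0r.
  by rewrite divfK// subr_eq0.
- apply/cvgrPdist_lt => e e0; rewrite eqxx.
  have /cvgrPdist_lt/(_ _ e0) := @continuous_transport d s.
  apply: filterS => z; rewrite sub0r normrN; case: eqVneq => [_|zs h]; first by rewrite normr0.
  rewrite (le_lt_trans _ h)// normrM normfV ler_pdivrMr ?normr_gt0 ?subr_eq0//.
  by rewrite (distrC (phi d s)).
- by rewrite eqxx.
Qed.

(** Compare [s] with the point [t] that is transported to [s']: the Young function
vanishes at [(t, s')], and in its first variable it has derivative
[transport d s - s'], which has the sign of [s - t]. *)
Lemma young_gt0 d s s' : s' != phi d s -> 0 < young d s s'.
Proof.
move=> ne; pose t := phi (- d) s'.
have tE : phi d t = s' by rewrite /t transportNK.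
have y0 : young d t s' = 0 by rewrite -tE young_graph.
have -> : young d s s' = Phi d s - Phi d t - s' * (s - t).
  by rewrite -[LHS]subr0 -y0 /young; ring.
have [st|ts|ts] := ltgtP s t.
- by have /andP[_] := primitive_lt d st; rewrite tE; lra.
- by have /andP[+ _] := primitive_lt d ts; rewrite tE; lra.
- by move: ne; rewrite ts tE eqxx.
Qed.

Lemma young_ge0 d s s' : 0 <= young d s s'.
Proof.
have [->|/(young_gt0)/ltW//] := eqVneq s' (phi d s); by rewrite young_graph.
Qed.

Lemma young_eq0 d s s' : young d s s' = 0 -> s' = phi d s.
Proof. by move=> h; apply/eqP/negP => /negP/young_gt0; rewrite h ltxx. Qed.

Lemma potential_bounds d s : 0 <= Psi d s + Psi (- d) s.
Proof. by have := young_ge0 d s s; rewrite youngE subrr expr0n/= mul0r addr0. Qed.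

Lemma continuous_potential d : continuous (Psi d).
Proof.
move=> s; apply/differentiable_continuous/derivable1_diffP.
by have [] := potential_derive d s.
Qed.

Lemma potential_MVT d s t : s < t ->
  exists2 x, s < x < t & Psi d t - Psi d s = psi d x * (t - s).
Proof.
move=> st.
have [x + E] := MVT st (fun x _ => potential_derive d x)
  (continuous_subspaceT (@continuous_potential d)).
by rewrite in_itv/= => sxt; exists x.
Qed.

Lemma potential_high d s : a <= s -> Psi d s = Psi d a.
Proof.
rewrite le_eqVlt => /predU1P[->//|/(potential_MVT d)[x /andP[ax _]]].
rewrite displacement_out ?mul0r => [/eqP|]; first by rewrite subr_eq0 => /eqP.
by rewrite negb_and -!leNgt (ltW ax) orbT.
Qed.

Lemma potential_le d s : `|Psi d s| <= (a + a) * (a + a).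
Proof.
have B0 : 0 <= (a + a) * (a + a) by rewrite mulr_ge0// addr_ge0// ltW.
have mid t : - a < t <= a -> `|Psi d t| <= (a + a) * (a + a).
  move=> /andP[at1 at2]; have [x _] := potential_MVT d at1.
  rewrite [Psi d (- a)]potential_low// subr0 => ->.
  rewrite normrM ler_pM// ?displacement_le//.
  by rewrite opprK ger0_norm ?lerD2r// -lerBlDr sub0r ltW.
have [sa|sa] := leP s (- a); first by rewrite potential_low// normr0.
have [as_|as_] := leP s a; first by rewrite mid// sa.
by rewrite (potential_high d (ltW as_)) mid// lexx gtrN.
Qed.

(** Outside of the range of the front the transport is the identity, so this is
[young_graph] on the diagonal. *)
Lemma potential_pair_out d s : ~~ (- a < s < a) -> Psi d s + Psi (- d) s = 0.
Proof.
move=> sa; have := young_graph d s; rewrite transport_out// youngE.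
by rewrite subrr expr0n/= mul0r addr0.
Qed.

End transport.

(** * The well expressed through the potentials *)

(** Over a subdivision of mesh [h] the increments of [D] add up to at most
[(f v - f u) * h]. *)
Lemma monotone_increment_const (R : realType) (D f : R -> R) (u v : R) : u <= v ->
  (forall s t, u <= s -> s <= t -> t <= v -> `|D t - D s| <= (f t - f s) * (t - s)) ->
  D v = D u.
Proof.
move=> uv H; apply/eqP; rewrite -subr_eq0 -normr_eq0 eq_le normr_ge0 andbT.
apply/ler_addgt0Pr => e e0; rewrite add0r.
pose C := (f v - f u) * (v - u).
have C0 : 0 <= C by rewrite (le_trans _ (H _ _ _ uv _)).
have [N NB] : exists N : nat, C / e < N.+1%:R by exists (Num.truncn (C / e)); exact: truncnS_gt.
have N0 : 0 < N.+1%:R :> R by rewrite ltr0n.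
pose h := (v - u) / N.+1%:R.
have h0 : 0 <= h by rewrite divr_ge0 ?subr_ge0// ltW.
pose X i := u + i%:R * h.
have Xu i : u <= X i by rewrite lerDl mulr_ge0.
have Xv i : (i <= N.+1)%N -> X i <= v.
  move=> iN; rewrite /X -lerBrDl /h mulrA ler_pdivrMr// mulrC ler_wpM2l ?subr_ge0//.
  by rewrite ler_nat.
have XS i : X i.+1 - X i = h by rewrite /X -natr1; ring.
have K i : (i <= N.+1)%N -> `|D (X i) - D u| <= (f (X i) - f u) * h.
  elim: i => [|i IH] iN; first by rewrite /X mul0r addr0 !subrr mul0r normr0.
  have XX : X i <= X i.+1 by rewrite -subr_ge0 XS.
  rewrite -(subrKA (D (X i))) (le_trans (ler_normD _ _))//.
  rewrite -[f _ - f u](subrKA (f (X i))) mulrDl lerD//; last exact/IH/ltnW.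
  by rewrite -(XS i) H// Xv.
have XN : X N.+1 = v by rewrite /X /h mulrC divfK ?gt_eqF// subrKC.
have := K N.+1 (leqnn _); rewrite XN => /le_trans; apply.
by rewrite /h mulrA ler_pdivrMr// -ler_pdivrMl// mulrC ltW.
Qed.

Lemma sandwich_dist (R : realFieldType) (A B X S h : R) : 0 <= h -> A <= X -> X <= B ->
  h * A <= S -> S <= h * B -> `|X * h - S| <= (B - A) * h.
Proof.
move=> h0 AX XB AS SB.
have /= := ler_wpM2r h0 AX; have /= := ler_wpM2r h0 XB.
by rewrite ler_norml => *; apply/andP; split; lra.
Qed.

Lemma regroup (R : comRingType) (x y A B p q M : R) :
  (x - A) - (y - B) = ((x + p * M) - (y + q * M)) - (A - B + (p - q) * M).
Proof. by ring. Qed.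

Section well.
Variables (R : realType) (a : R) (g F k : R -> R) (M : R).
Hypothesis a0 : 0 < a.
Hypothesis Hg : front a g.
Hypothesis HF : even_double_well a F.
Local Notation mu := (@lebesgue_measure R).
Local Notation w := (front_inv a g).
Local Notation phi := (transport a g).
Local Notation psi := (displacement a g).
Local Notation Psi := (potential a g).
Hypothesis k0 : forall d, 0 <= k d.
Hypothesis kN : forall d, k (- d) = k d.
Hypothesis mk : measurable_fun setT k.
Hypothesis Mk : (\int[mu]_d (k d)%:E = M%:E)%E.
Hypothesis bal : forall x, (\int[mu]_d (k d * (g (x + d) + a))%:E =
  (derive1 F (g x) / 2 + (g x + a) * M)%:E)%E.

Lemma measurable_front_inv : measurable_fun setT (w : R -> R).
Proof.
apply: (measurability _ (RGenInftyO.measurableE R)) => _ [_ [c ->]] <-.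
rewrite setTI.
(* The second set accounts for the default value of the inverse. *)
rewrite (_ : _ @^-1` _ = (`]- a, a[%classic `&` `]-oo, (g c)[%classic) `|` (~` `]- a, a[%classic `&` [set _ | 0 < c])).
  apply: measurableU; first by apply: measurableI; exact: measurable_itv.
  apply: measurableI; first by apply: measurableC; exact: measurable_itv.
  have [c0|c0] := boolP (0 < c).
    by rewrite (_ : [set _ | _] = setT)//; apply/seteqP; split.
  by rewrite (_ : [set _ | _] = set0)//; apply/seteqP; split.
apply/seteqP; split => s /=; rewrite !in_itv/=.
  have [sa|sa] := boolP (- a < s < a); first by rewrite (front_inv_lt Hg)//; left.
  by rewrite /front_inv (negbTE sa) => c0; right; split => //; exact/negP.
move=> [[sa gc]|[/negP sa c0]]; first by rewrite (front_inv_lt Hg).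
by rewrite /front_inv (negbTE sa).
Qed.

Lemma measurable_transport : measurable_fun setT (fun z : R * R => phi z.1 z.2).
Proof.
have -> : (fun z : R * R => phi z.1 z.2) =
    (fun z => if (- a < z.2) && (z.2 < a) then g (w z.2 + z.1) else z.2) by [].
have [cg _ _ _] := Hg.
apply: measurable_fun_ifT.
- by apply: measurable_and; apply: measurable_fun_ltr => //; exact: measurable_snd.
- apply: (measurableT_comp (continuous_measurable_fun cg)).
  apply: measurable_funD; last exact: measurable_fst.
  exact: (measurableT_comp measurable_front_inv measurable_snd).
- exact: measurable_snd.
Qed.

Lemma measurable_potential : measurable_fun setT (fun z : R * R => Psi z.1 z.2).
Proof.
pose f (q : (R * R) * measurableTypeR R) : R := if q.2 <= q.1.2 then psi q.1.1 q.2 else 0.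
have mf : measurable_fun setT (EFin \o f).
  apply/measurable_EFinP; apply: measurable_fun_ifT => //.
    by apply: measurable_fun_ler; [exact: measurable_snd|exact: (measurableT_comp measurable_snd measurable_fst)].
  apply: measurable_funB; last exact: measurable_snd.
  apply: (measurableT_comp measurable_transport (g := fun q : (R * R) * measurableTypeR R => (q.1.1, q.2 : R))).
  apply/measurable_fun_pairP; split => /=; last exact: measurable_snd.
  exact: (measurableT_comp measurable_fst measurable_fst).
rewrite (_ : (fun z => _) = fine \o ((fun z => \int[mu]_t (EFin \o f)^\+ (z, t))%E \- (fun z => \int[mu]_t (EFin \o f)^\- (z, t))%E)%E).
  apply: (measurableT_comp (f := fine)) => //.
  apply: emeasurable_funB; apply: measurable_fun_partial_integral => //.
    exact: measurable_funepos.
  exact: measurable_funeneg.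
apply/funext => -[d s]; rewrite /potential /Rintegral /=; congr fine.
have -> : (\int[mu]_(t in `]-oo, s]) (psi d t)%:E = \int[mu]_t (EFin \o f) ((d, s), t))%E.
  rewrite integral_mkcond; apply: eq_integral => t _.
  by rewrite patchE mem_setE in_itv/= /f/=; case: ifP.
rewrite [LHS]integralE; congr (_ - _)%E; apply: eq_integral => t _; by rewrite !unlock.
Qed.

Lemma integrable_kernel : mu.-integrable setT (EFin \o k).
Proof.
apply/integrableP; split; first exact/measurable_EFinP.
under eq_integral do rewrite /= ger0_norm//.
by rewrite Mk ltry.
Qed.

Lemma integrable_weighted (b : R -> R) (C : R) : measurable_fun setT b ->
  (forall d, `|b d| <= C) -> mu.-integrable setT (EFin \o (fun d => k d * b d)).
Proof.
move=> mb bC.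
apply: (@le_integrable _ _ _ mu setT _ _ (fun d => C%:E * (EFin \o k) d)%E) => //.
- by apply/measurable_EFinP; exact: measurable_funM.
- move=> d _; rewrite /= lee_fin !normrM mulrC ler_wpM2r//.
  by rewrite (le_trans (bC d))// ler_norm.
- by apply: integrableZl => //; exact: integrable_kernel.
Qed.

(** Integral of a bounded function against the kernel. *)
Definition average (b : R -> R) := \int[mu]_d (k d * b d).

Lemma averageE (b : R -> R) (C : R) : measurable_fun setT b -> (forall d, `|b d| <= C) ->
  (\int[mu]_d (k d * b d)%:E = (average b)%:E)%E.
Proof.
move=> mb bC; rewrite /average /Rintegral fineK//.
by apply: integrable_fin_num => //; exact: (integrable_weighted mb bC).
Qed.

Lemma average_cst c : average (fun=> c) = c * M.
Proof.
rewrite /average (@eq_Rintegral _ _ _ mu setT (fun d => c * k d)).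
  rewrite RintegralZl//; last exact: integrable_kernel.
  by congr (_ * _); rewrite /Rintegral Mk.
by move=> d _; rewrite mulrC.
Qed.

Lemma averageD (b b' : R -> R) (C C' : R) : measurable_fun setT b -> measurable_fun setT b' ->
  (forall d, `|b d| <= C) -> (forall d, `|b' d| <= C') ->
  average (fun d => b d + b' d) = average b + average b'.
Proof.
move=> mb mb' bC bC'; rewrite /average -RintegralD//.
- by apply: eq_Rintegral => d _; rewrite mulrDr.
- exact: (integrable_weighted mb bC).
- exact: (integrable_weighted mb' bC').
Qed.

Lemma averageZ (b : R -> R) (c C : R) : measurable_fun setT b ->
  (forall d, `|b d| <= C) -> average (fun d => c * b d) = c * average b.
Proof.
move=> mb bC; rewrite /average -RintegralZl//; last exact: (integrable_weighted mb bC).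
by apply: eq_Rintegral => d _; rewrite mulrCA.
Qed.

Lemma average_le (b b' : R -> R) (C C' : R) : measurable_fun setT b -> measurable_fun setT b' ->
  (forall d, `|b d| <= C) -> (forall d, `|b' d| <= C') ->
  (forall d, b d <= b' d) -> average b <= average b'.
Proof.
move=> mb mb' bC bC' bb'; apply: le_Rintegral => //.
- exact: (integrable_weighted mb bC).
- exact: (integrable_weighted mb' bC').
- by move=> d _; rewrite ler_wpM2l.
Qed.

Lemma averageN (b : R -> R) : measurable_fun setT b -> average (fun d => b (- d)) = average b.
Proof.
move=> mb; rewrite /average /Rintegral; congr fine.
rewrite -[RHS]integral_oppr; last by apply/measurable_EFinP; exact: measurable_funM.
by apply: eq_integral => d _; rewrite kN.
Qed.

Let m_phi s : measurable_fun setT (phi ^~ s).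
Proof. exact: (measurableT_comp measurable_transport (measurable_pair2 s)). Qed.

Let m_Psi s : measurable_fun setT (Psi ^~ s).
Proof. exact: (measurableT_comp measurable_potential (measurable_pair2 s)). Qed.

Let phi_le s d : `|phi d s| <= `|s| + (a + a).
Proof.
have := displacement_le a0 Hg d s; rewrite /psi => h.
by rewrite -(subrKC s (phi d s)) (le_trans (ler_normD _ _))// lerD2l.
Qed.

(** This is the balance at the point [x] where [g x = s]. *)
Lemma average_transport s : - a < s < a ->
  average (phi ^~ s) = derive1 F s / 2 + s * M.
Proof.
move=> sa; pose x := w s; have gx : g x = s by exact: (front_invK Hg).
have := bal x; rewrite gx.
have E : (\int[mu]_d (k d * (g (x + d) + a))%:E = \int[mu]_d (k d * (phi d s + a))%:E)%E.
  by apply: eq_integral => d _; rewrite -gx (transport_front Hg).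
rewrite E (@averageE (fun d => phi d s + a) (`|s| + (a + a) + `|a|)); last 2 first.
- exact: measurable_funD.
- by move=> d; rewrite (le_trans (ler_normD _ _))// lerD2r.
rewrite (averageD (b' := fun=> a) (C' := `|a|) (m_phi s) _ (phi_le s))// average_cst.
by move=> [] h; lra.
Qed.

(** Both sides vanish at [- a]. By [average_transport] the derivative of the left
side is the average of the displacements, which is also the formal derivative
of the right side; instead of differentiating under the integral, the increments
of both sides are bracketed by those of increasing functions, and
[monotone_increment_const] applies. *)
Lemma well_potential s : - a <= s <= a -> F s / 2 = average (Psi ^~ s).
Proof.
move=> /andP[as_ sa]; case: HF => dF _ Fa FNa _.
pose D t := F t / 2 - average (Psi ^~ t).
suff : D s = D (- a).
  have A0 : average (Psi ^~ (- a)) = 0.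
    have -> : Psi ^~ (- a) = (fun=> 0) by apply/funext => d; rewrite potential_low.
    by rewrite average_cst mul0r.
  by rewrite /D FNa A0 mul0r subrr => /eqP; rewrite subr_eq0 => /eqP.
apply: (@monotone_increment_const _ _ (fun t => average (phi ^~ t))) => // t t' ut tt' t'v.
have [<-|ne] := eqVneq t t'; first by rewrite !subrr mulr0 normr0.
have {ne}tt : t < t' by rewrite lt_neqAle ne.
pose q u := (u ^+ 2 / 2 : R).
pose G u := F u / 2 + q u * M.
have dG (x : R) : is_derive x 1 G (derive1 F x / 2 + x * M).
  have hF : is_derive x 1 F (derive1 F x) by rewrite derive1E; exact: derivableP.
  have -> : G = (fun u => 2^-1 *: F u + (M / 2) *: u ^+ 2).
    by apply/funext => u; rewrite /G /q /GRing.scale/=; field.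
  by apply: is_derive_eq; rewrite /GRing.scale/=; field.
have [xi + EG] : exists2 x, x \in `]t, t'[ & G t' - G t = (derive1 F x / 2 + x * M) * (t' - t).
  apply: MVT => //; apply: continuous_subspaceT => x.
  by apply/differentiable_continuous/derivable1_diffP; have [] := dG x.
rewrite in_itv/= => /andP[tx xt'].
have xia : - a < xi < a.
  by rewrite (le_lt_trans ut tx)/= (lt_le_trans xt')// (le_trans t'v).
have phi_avg u v : u <= v -> average (phi ^~ u) <= average (phi ^~ v).
  move=> uv; apply: (average_le (m_phi u) (m_phi v) (phi_le u) (phi_le v)) => d.
  by rewrite (transport_le_mono Hg).
have Q1 := phi_avg _ _ (ltW tx); have Q2 := phi_avg _ _ (ltW xt').
have Exi := average_transport xia.
have PB u d := potential_le a0 Hg d u.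
have avgD : average (fun d => Psi d t' - Psi d t) = average (Psi ^~ t') - average (Psi ^~ t).
  rewrite (averageD (m_Psi t') (b' := fun d => - Psi d t) _ (PB t') (C' := (a + a) * (a + a))).
  - congr (_ + _); rewrite -mulN1r -(averageZ _ (m_Psi t) (PB t)); congr average.
    by apply/funext => d; rewrite mulN1r.
  - exact: measurable_funN.
  - by move=> d; rewrite normrN.
have low d : phi d t * (t' - t) <= Psi d t' - Psi d t + (q t' - q t).
  by have /andP[] := potential_increment a0 Hg d (ltW tt).
have high d : Psi d t' - Psi d t + (q t' - q t) <= phi d t' * (t' - t).
  by have /andP[] := potential_increment a0 Hg d (ltW tt).
pose S d := Psi d t' - Psi d t + (q t' - q t).
have mS : measurable_fun setT S by apply: measurable_funD => //; exact: measurable_funB.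
have SB d : `|S d| <= (a + a) * (a + a) + (a + a) * (a + a) + `|q t' - q t|.
  rewrite (le_trans (ler_normD _ _))// lerD2r (le_trans (ler_normB _ _))// lerD//.
have avgS : average S = average (Psi ^~ t') - average (Psi ^~ t) + (q t' - q t) * M.
  rewrite -avgD -(average_cst (q t' - q t)).
  apply: (@averageD (fun d => Psi d t' - Psi d t) (fun=> q t' - q t)
    ((a + a) * (a + a) + (a + a) * (a + a)) `|q t' - q t|) => //.
    exact: measurable_funB.
  by move=> d; rewrite (le_trans (ler_normB _ _))// lerD.
have low' : (t' - t) * average (phi ^~ t) <= average S.
  rewrite -(averageZ _ (m_phi t) (phi_le t)).
  apply: (average_le (C := `|t' - t| * (`|t| + (a + a))) _ mS _ SB).
  - exact: measurable_funM.
  - by move=> d; rewrite normrM ler_wpM2l.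
  - by move=> d; rewrite mulrC; exact: low.
have high' : average S <= (t' - t) * average (phi ^~ t').
  rewrite -(averageZ _ (m_phi t') (phi_le t')).
  apply: (average_le (C' := `|t' - t| * (`|t'| + (a + a))) mS _ SB).
  - exact: measurable_funM.
  - by move=> d; rewrite normrM ler_wpM2l.
  - by move=> d; rewrite [X in _ <= X]mulrC; exact: high.
have tt0 : 0 < t' - t by rewrite subr_gt0.
have -> : D t' - D t = average (phi ^~ xi) * (t' - t) - average S.
  by rewrite Exi -EG avgS; exact: regroup.
exact: sandwich_dist (ltW tt0) Q1 Q2 low' high'.
Qed.

Definition well_part d s := Psi d s + Psi (- d) s.

(** The well is twice the average of [potential d], and the kernel is even. *)
Lemma well_part_eq s : - a <= s <= a ->
  (\int[mu]_d (k d * well_part d s)%:E = (F s)%:E)%E.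
Proof.
move=> sa.
rewrite (@averageE (fun d => well_part d s) ((a + a) * (a + a) + (a + a) * (a + a))); last 2 first.
- apply: measurable_funD => //.
  exact: (measurableT_comp (m_Psi s) (@oppr_measurable R setT)).
- by move=> d; rewrite (le_trans (ler_normD _ _))// lerD// potential_le.
congr EFin; rewrite (averageD (C := (a + a) * (a + a)) (C' := (a + a) * (a + a)) (b' := fun d => Psi (- d) s))//; last 3 first.
- exact: (measurableT_comp (m_Psi s) (@oppr_measurable R setT)).
- by move=> d; exact: potential_le.
- by move=> d; exact: potential_le.
rewrite (averageN (m_Psi s)) -(well_potential sa); lra.
Qed.

(** Outside of the range of the front the potentials cancel, while the well is
nonnegative. *)
Lemma well_part_le s : (\int[mu]_d (k d * well_part d s)%:E <= (F s)%:E)%E.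
Proof.
have [sa|sa] := boolP (- a <= s <= a); last first.
  rewrite (eq_integral (cst 0%E)); last first.
    move=> d _; rewrite /well_part (potential_pair_out a0 Hg) ?mulr0//.
    by apply: contra sa => /andP[? ?]; rewrite !ltW.
  rewrite integral0 lee_fin; case: HF => _ _ Fa FNa Fpos.
  have [->|sna] := eqVneq s a; first by rewrite Fa.
  have [->|snNa] := eqVneq s (- a); first by rewrite FNa.
  by rewrite ltW// Fpos//; exact/eqP.
by rewrite well_part_eq.
Qed.

End well.

(** * Telescoping of bounded functions with limits *)

Section telescoping.
Variable R : realType.
Local Notation mu := (@lebesgue_measure R).

(** The difference of the indicators of [[0, +oo[] and [[d, +oo[], whose integral is
[d] whatever the sign of [d]. *)
Definition step_difference (d z : R) : R := (0 <= z)%R%:R - (d <= z)%R%:R.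
Local Notation e := step_difference.

Lemma measurable_step_difference d : measurable_fun setT (e d).
Proof.
have ms c : measurable_fun [set: R] (fun z => (c <= z)%R%:R : R).
  apply: nondecreasing_measurable => // x y xy; rewrite ler_nat.
  by case: (leP c x) => // cx; rewrite (le_trans cx xy).
exact: measurable_funB.
Qed.

Lemma step_difference_le (d z : R) : `|e d z| <= (\1_(`[(- `|d|), `|d|]%classic : set R) z : R).
Proof.
rewrite indicE mem_setE in_itv/= -ler_norml /e.
have [z0|z0] := leP 0 z; have [dz|dz] := leP d z; rewrite ?subrr ?normr0 ?ler0n// ?subr0 ?sub0r ?normrN normr1 (_ : `|z| <= `|d|)//.
  by rewrite ger0_norm// (le_trans (ltW dz))// ler_norm.
by rewrite ler0_norm ?(ltW z0)// (le_trans (_ : _ <= - d)) ?lerN2// -normrN ler_norm.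
Qed.

Lemma integrable_step_difference d : mu.-integrable setT (EFin \o e d).
Proof.
have mI : measurable (`[(- `|d|), `|d|] : set (measurableTypeR R)) by exact: measurable_itv.
apply: (@le_integrable _ _ _ mu setT _ _ (EFin \o \1_(`[(- `|d|), `|d|]))) => //.
- by apply/measurable_EFinP; exact: measurable_step_difference.
- move=> z _; rewrite /= lee_fin (le_trans (step_difference_le d z))// ler_norm//.
exact: integrable_indic_itv.
Qed.

Lemma integral_indic_co (u v : R) : u <= v ->
  (\int[mu]_z (\1_(`[u, v[%classic : set R) z)%:E = (v - u)%:E)%E.
Proof.
move=> uv; have mI : measurable (`[u, v[ : set (measurableTypeR R)) by exact: measurable_itv.
rewrite (integral_indic mu measurableT mI) setIT.
apply: (etrans (lebesgue_measure_itv `[u, v[)); rewrite /= lte_fin.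
case: ltP => [_|vu]; first by rewrite -EFinB.
by rewrite (@le_anti _ _ u v) ?uv// subrr.
Qed.

Lemma integral_step_difference d : (\int[mu]_z (e d z)%:E = d%:E)%E.
Proof.
have [d0|d0] := leP 0 d.
  rewrite -[in RHS](subr0 d) -(integral_indic_co d0).
  apply: eq_integral => z _; rewrite indicE mem_setE in_itv/= /e.
  have [z0|z0] := leP 0 z; have [dz|dz] := leP d z; rewrite ?subrr ?subr0//.
  by move: (lt_le_trans z0 d0); rewrite ltNge dz.
rewrite -[in RHS](opprK d) -[in RHS](sub0r d) EFinN -(integral_indic_co (ltW d0)).
rewrite -integral_ge0N; last by move=> z _; rewrite lee_fin.
apply: eq_integral => z _; rewrite -EFinN; congr EFin.
rewrite indicE mem_setE in_itv/= /e.
have [z0|z0] := leP 0 z; have [dz|dz] := leP d z; rewrite ?subrr ?oppr0 ?subr0 ?sub0r//=.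
by move: (lt_le_trans dz (le_trans (ltW d0) z0)); rewrite ltxx.
Qed.

(** Dominated convergence: the step difference has compact support. *)
Lemma translated_cvg (v : R -> R) (d l B : R) (sh : nat -> R) :
  measurable_fun setT v -> (forall x, `|v x| <= B) ->
  (forall z, v (z + sh n) @[n --> \oo] --> l) ->
  (\int[mu]_z (v (z + sh n) * e d z)%:E @[n --> \oo] --> (l * d)%:E)%E.
Proof.
move=> mv vB vl.
have := @dominated_convergence _ _ _ mu setT measurableT (fun n z => (v (z + sh n) * e d z)%:E)
  (fun z => (l * e d z)%:E) (fun z => (B%:E * `|(e d z)%:E|)%E).
rewrite (_ : \int[mu]_x (l * e d x)%:E = (l * d)%:E)%E; last first.
  under eq_integral do rewrite EFinM.
  by rewrite integralZl ?integral_step_difference -?EFinM//; exact: integrable_step_difference.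
case=> //.
- move=> n; apply/measurable_EFinP/measurable_funM; last exact: measurable_step_difference.
  by apply: (measurableT_comp mv); exact: measurable_funD.
- by apply/measurable_EFinP/measurable_funM => //; exact: measurable_step_difference.
- apply: aeW => z _; apply: cvg_EFin; first by apply: nearW.
  by apply: cvgMr_tmp; exact: vl.
- apply: integrableZl => //; apply: integrable_abse.
  exact: integrable_step_difference.
- apply: aeW => z n _ /=; rewrite lee_fin normrM ler_wpM2r//.
Qed.

Lemma lebesgue_itvco_lty (u v : R) : (mu (`[u, v[%classic : set R) < +oo)%E.
Proof.
by rewrite lebesgue_measure_itv; case: ifP => _; rewrite ?lt0y// -EFinB ltry.
Qed.

Variables (v : R -> R) (d l r B : R).
Hypothesis mv : measurable_fun setT v.
Hypothesis vB : forall x, `|v x| <= B.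
Hypothesis vl : v x @[x --> -oo] --> l.
Hypothesis vr : v x @[x --> +oo] --> r.

Let I n : set R := `[(- n%:R), n%:R[%classic.

Let mI n : measurable (I n : set (measurableTypeR R)).
Proof. exact: measurable_itv. Qed.

Let mvd : measurable_fun [set: R] (fun x : R => v (x + d)).
Proof. by apply: (measurableT_comp mv); exact: measurable_funD. Qed.

Let integrable_translated (c : R) :
  mu.-integrable setT (fun z => (v (z + c) * e d z)%:E).
Proof.
apply: (@le_integrable _ _ _ mu setT _ _ (fun z => (B%:E * `|(e d z)%:E|)%E)) => //.
- apply/measurable_EFinP/measurable_funM; last exact: measurable_step_difference.
  by apply: (measurableT_comp mv); exact: measurable_funD.
- move=> z _ /=; rewrite lee_fin !normrM normr_id ler_wpM2r//.
  by rewrite (le_trans (vB _))// ler_norm.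
- by apply: integrableZl => //; apply: integrable_abse; exact: integrable_step_difference.
Qed.

Let integrable_shifted (c : R) :
  mu.-integrable setT (fun z => (v z * e d (z + c))%:E).
Proof.
have E : (fun z => (v z * e d (z + c))%:E) = (fun z => (v ((z + c) - c) * e d (z + c))%:E).
  by apply/funext => z; rewrite addrK.
have m1 : measurable_fun [set: R] (fun z : R => (v (z - c) * e d z)%:E).
  apply/measurable_EFinP/measurable_funM; last exact: measurable_step_difference.
  by apply: (measurableT_comp mv); exact: measurable_funD.
rewrite E; apply/integrableP; split.
  apply: (measurableT_comp m1 (g := fun z : R => z + c)).
  exact: measurable_funD.
rewrite (integral_shift c (f := fun z : R => `|(v (z - c) * e d z)%:E|%E)); last exact: measurableT_comp.
by have /integrableP[] := integrable_translated (- c).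
Qed.

Let shifted_integral (c : R) :
  (\int[mu]_z (v z * e d (z + c))%:E = \int[mu]_z (v (z - c) * e d z)%:E)%E.
Proof.
rewrite -[RHS](integral_shift c); first by apply: eq_integral => z _; rewrite addrK.
apply/measurable_EFinP/measurable_funM; last exact: measurable_step_difference.
by apply: (measurableT_comp mv); exact: measurable_funD.
Qed.

Let integrable_window (u : R -> R) n : measurable_fun setT u ->
  (forall x, `|u x| <= B) -> mu.-integrable (I n) (EFin \o u).
Proof.
move=> mu_ uB; apply: measurable_bounded_integrable => //.
- exact: lebesgue_itvco_lty.
- exact: measurable_funTS.
- exists B; split; first exact: num_real.
  by move=> M BM x _ /=; rewrite (le_trans (uB x))// ltW.
Qed.

(** Translating the window [[- N, N[] by [d] changes it only near its two ends. *)
Lemma window_integral n : (\int[mu]_(x in I n) (v x)%:E - \int[mu]_(x in I n) (v (x + d))%:E =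
  \int[mu]_z (v (z - n%:R) * e d z)%:E - \int[mu]_z (v (z + n%:R) * e d z)%:E)%E.
Proof.
have i1 : mu.-integrable setT ((EFin \o v) \_ (I n)).
  by rewrite -(integrable_mkcond _ (mI n)); exact: integrable_window.
have i2 : mu.-integrable setT ((EFin \o (fun x : R => v (x + d))) \_ (I n)).
  by rewrite -(integrable_mkcond _ (mI n)); exact: integrable_window.
pose G (x : R) : \bar R := ((EFin \o (fun x : R => v (x + d))) \_ (I n)) x.
have mG : measurable_fun setT G by case/integrableP: i2.
rewrite [X in (X - _)%E = _]integral_mkcond [X in (_ - X)%E = _]integral_mkcond.
rewrite -[X in (_ - X)%E = _](integral_shift (- d) (f := G))//.
have i3 : mu.-integrable setT (fun x : R => G (x - d)).
  apply/integrableP; split.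
    by apply: (measurableT_comp mG (g := fun x : R => x - d)); exact: measurable_funD.
  rewrite (integral_shift (- d) (f := fun x : R => `|G x|%E)); last exact: measurableT_comp.
  by case/integrableP: i2.
rewrite -integralB//.
have := shifted_integral (- n%:R); rewrite opprK => <-.
rewrite -(shifted_integral n%:R) -integralB//.
apply: eq_integral => x _; rewrite /G !patchE !mem_setE !in_itv/= subrK -EFinB -mulrBr.
have -> : (if - n%:R <= x < n%:R then (v x)%:E else 0%E) = (v x * (- n%:R <= x < n%:R)%R%:R)%:E.
  by case: ifP; rewrite ?mulr1 ?mulr0.
have -> : (if - n%:R <= x - d < n%:R then (v x)%:E else 0%E) = (v x * (- n%:R <= x - d < n%:R)%R%:R)%:E.
  by case: ifP; rewrite ?mulr1 ?mulr0.
rewrite -EFinB -mulrBr; congr (_ * _)%:E.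
have half (y : R) : (- n%:R <= y < n%:R)%R%:R = (0 <= y + n%:R)%R%:R - (0 <= y - n%:R)%R%:R :> R.
  rewrite subr_ge0 -lerBlDr sub0r.
  have [h1|h1] := leP (- n%:R) y; have [h2|h2] := leP n%:R y; rewrite ?subr0 ?subrr//=.
  have := le_lt_trans h2 h1; rewrite ltNge => /negP[].
  by rewrite (le_trans (_ : _ <= 0))// oppr_le0.
rewrite !half /e.
have -> : (0 <= x - d + n%:R)%R = (d <= x + n%:R)%R by rewrite addrAC subr_ge0.
have -> : (0 <= x - d - n%:R)%R = (d <= x - n%:R)%R by rewrite addrAC subr_ge0.
ring.
Qed.

(** Neither [f] nor [y] need be integrable, so the difference is computed on the
windows [[- N, N[], where [v x - v (x + d)] integrates to two boundary terms
that converge to [d * l] and [d * r]. *)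
Lemma telescoping (f y : R -> R) : measurable_fun setT f -> measurable_fun setT y ->
  (forall x, 0 <= f x) -> (forall x, 0 <= y x) ->
  (forall x, f x = y x + (v x - v (x + d))) ->
  (\int[mu]_x (f x)%:E = \int[mu]_x (y x)%:E + (d * (l - r))%:E)%E.
Proof.
move=> mf my f0 y0 fE.
have bigI : \bigcup_n I n = setT.
  apply/seteqP; split => // x _; exists (Num.truncn `|x|).+1 => //=.
  by rewrite /I/= in_itv/=; have := truncnS_gt `|x|; rewrite ltr_norml => /andP[/ltW -> ->].
have ndI : nondecreasing_seq I.
  move=> m n mn; rewrite subsetEset; apply: subset_itv; rewrite bnd_simp ?lerN2 ler_nat//.
have lim_int (h : R -> R) : measurable_fun setT h -> (forall x, 0 <= h x) ->
    (\int[mu]_(x in I n) (h x)%:E @[n --> \oo] --> \int[mu]_x (h x)%:E)%E.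
  move=> mh h0; rewrite -[X in (_ --> \int[mu]_(x in X) _)%E]bigI.
  apply: ge0_nondecreasing_set_cvg_integral => //.
    by move=> n; apply: measurable_funTS; exact/measurable_EFinP.
  by move=> n x _; rewrite lee_fin.
have B0 : 0 <= B by rewrite (le_trans _ (vB 0)).
have vn z : v (z - n%:R) @[n --> \oo] --> l.
  apply: (cvg_comp _ _ _ vl); apply/cvgrNyPle => A.
  near=> n; rewrite lerBlDr -lerBlDl ltW//.
  by near: n; exact: nbhs_infty_gtr.
have vp z : v (z + n%:R) @[n --> \oo] --> r.
  apply: (cvg_comp _ _ _ vr); apply/cvgryPge => A.
  near=> n; rewrite -lerBlDl ltW//.
  by near: n; exact: nbhs_infty_gtr.
have Tl := @translated_cvg v d l B (fun n => - n%:R) mv vB vn.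
have Tr := @translated_cvg v d r B (fun n => n%:R) mv vB vp.
have TT : (\int[mu]_z (v (z - n%:R) * e d z)%:E - \int[mu]_z (v (z + n%:R) * e d z)%:E @[n --> \oo] --> (d * (l - r))%:E)%E.
  rewrite mulrC mulrBl EFinB; apply: cvgeB => //.
have step n : (\int[mu]_(x in I n) (f x)%:E = \int[mu]_(x in I n) (y x)%:E +
    (\int[mu]_z (v (z - n%:R) * e d z)%:E - \int[mu]_z (v (z + n%:R) * e d z)%:E))%E.
  rewrite -window_integral.
  have iv := integrable_window n mv vB.
  have ivd := integrable_window n mvd (fun x => vB (x + d)).
  (* Adding [B] makes all terms nonnegative, so that no integrability of [f] or
     [y] is required. *)
  have H : (\int[mu]_(x in I n) (f x)%:E + \int[mu]_(x in I n) (v (x + d) + B)%:E =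
      \int[mu]_(x in I n) (y x)%:E + \int[mu]_(x in I n) (v x + B)%:E)%E.
    have vB0 x : 0 <= v x + B by have := vB x; rewrite ler_norml -lerBlDr sub0r => /andP[].
    have mvB : measurable_fun (I n) (EFin \o (fun x => v x + B)).
      by apply/measurable_funTS/measurable_EFinP/measurable_funD.
    have mvdB : measurable_fun (I n) (EFin \o (fun x => v (x + d) + B)).
      by apply/measurable_funTS/measurable_EFinP/measurable_funD.
    have mfI : measurable_fun (I n) (EFin \o f) by apply/measurable_funTS/measurable_EFinP.
    have myI : measurable_fun (I n) (EFin \o y) by apply/measurable_funTS/measurable_EFinP.
    rewrite -ge0_integralD//; last 2 first.
    - by move=> x _; rewrite lee_fin.
    - by move=> x _; rewrite lee_fin.
    rewrite -ge0_integralD//; last 2 first.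
    - by move=> x _; rewrite lee_fin.
    - by move=> x _; rewrite lee_fin.
    by apply: eq_integral => x _; rewrite -!EFinD fE; congr EFin; ring.
  have cB : mu.-integrable (I n) (EFin \o (fun=> B)).
    by apply: integrable_window => // x; rewrite ger0_norm.
  move: H; rewrite (_ : (\int[mu]_(x in I n) (v (x + d) + B)%:E = \int[mu]_(x in I n) (v (x + d))%:E + \int[mu]_(x in I n) B%:E)%E); last first.
    by rewrite -(integralD (mI n) ivd cB).
  rewrite (_ : (\int[mu]_(x in I n) (v x + B)%:E = \int[mu]_(x in I n) (v x)%:E + \int[mu]_(x in I n) B%:E)%E); last first.
    by rewrite -(integralD (mI n) iv cB).
  have := integrable_fin_num (mI n) iv; have := integrable_fin_num (mI n) ivd; have := integrable_fin_num (mI n) cB.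
  rewrite /=; set Bn := (\int[mu]_(x in I n) B%:E)%E; set V := (\int[mu]_(x in I n) (v x)%:E)%E.
  set V' := (\int[mu]_(x in I n) (v (x + d))%:E)%E.
  move=> /fineK <- /fineK <- /fineK <-.
  case: (\int[mu]_(x in I n) (f x)%:E)%E => [q| |]; case: (\int[mu]_(x in I n) (y x)%:E)%E => [p| |] //=.
  by rewrite -!EFinD => -[] h; congr EFin; lra.
have C1 := lim_int _ mf f0.
have C2 := lim_int _ my y0.
have C3 : (\int[mu]_(x in I n) (f x)%:E @[n --> \oo] --> \int[mu]_x (y x)%:E + (d * (l - r))%:E)%E.
  under eq_fun do rewrite step; apply: cvgeD => //.
  by rewrite fin_num_adde_defl.
exact: (cvg_unique _ C1 C3).
Unshelve. all: by end_near. Qed.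

End telescoping.

(** * Calibration of the one-dimensional energy *)

Section energy.
Variables (R : realType) (a : R) (g F k : R -> R) (M rho : R).
Hypothesis a0 : 0 < a.
Hypothesis Hg : front a g.
Hypothesis HF : even_double_well a F.
Local Notation mu := (@lebesgue_measure R).
Local Notation R' := (measurableTypeR R).
Local Notation w := (front_inv a g).
Local Notation phi := (transport a g).
Local Notation psi := (displacement a g).
Local Notation Psi := (potential a g).
Hypothesis k0 : forall d, 0 <= k d.
Hypothesis kN : forall d, k (- d) = k d.
Hypothesis mk : measurable_fun setT k.
Hypothesis Mk : (\int[mu]_d (k d)%:E = M%:E)%E.
Hypothesis krho : forall d, rho < `|d| -> k d = 0.
Hypothesis bal : forall x, (\int[mu]_d (k d * (g (x + d) + a))%:E =
  (derive1 F (g x) / 2 + (g x + a) * M)%:E)%E.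
Local Notation h := (well_part a g).
Local Notation Y := (young a g).

(** What remains of the energy per unit of [k d] once the Young terms are removed. It
depends on the limits of the competitor only. *)
Definition drift d := d * (Psi (- d) (- a) - Psi (- d) a).

Section competitor.
Variable u : R -> R.
Hypothesis Hu : admissible_1d a u.

Let m_u : measurable_fun setT u. Proof. by case: Hu. Qed.

Let m_ud d : measurable_fun [set: R] (fun x : R => u (x + d)).
Proof. by apply: (measurableT_comp m_u (g := fun x : R => x + d)); exact: measurable_funD. Qed.

Let m_P e : measurable_fun setT (Psi e).
Proof. by apply: continuous_measurable_fun; exact: continuous_potential. Qed.

Let m_u1 : measurable_fun [set: R' * R'] (fun z : R' * R' => u z.1).
Proof. exact: (measurableT_comp m_u measurable_fst). Qed.

Let m_u2 : measurable_fun [set: R' * R'] (fun z : R' * R' => u (z.1 + z.2)).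
Proof.
apply: (measurableT_comp m_u (g := fun z : R' * R' => (z.1 + z.2 : R))).
by apply: measurable_funD; [exact: measurable_fst|exact: measurable_snd].
Qed.

Let m_k : measurable_fun [set: R' * R'] (fun z : R' * R' => k z.2).
Proof. exact: (measurableT_comp mk measurable_snd). Qed.

Let m_d : measurable_fun [set: R' * R'] (fun z : R' * R' => z.2 : R).
Proof. exact: measurable_snd. Qed.

Let m_dN : measurable_fun [set: R' * R'] (fun z : R' * R' => - z.2 : R).
Proof. exact: (measurableT_comp (@oppr_measurable R setT) m_d). Qed.

Let m_Psi (p q : R' * R' -> R) : measurable_fun [set: R' * R'] p ->
  measurable_fun [set: R' * R'] q -> measurable_fun [set: R' * R'] (fun z => Psi (p z) (q z)).
Proof.
move=> mp mq; apply: (measurableT_comp (measurable_potential Hg) (g := fun z => (p z, q z))).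
exact/measurable_fun_pairP.
Qed.

Let m_h : measurable_fun [set: R' * R'] (fun z : R' * R' => k z.2 * h z.2 (u z.1)).
Proof. by apply: measurable_funM => //; apply: measurable_funD; exact: m_Psi. Qed.

Let m_sq : measurable_fun [set: R' * R'] (fun z : R' * R' => k z.2 * ((u z.1 - u (z.1 + z.2)) ^+ 2 / 2)).
Proof.
apply: measurable_funM => //; apply: measurable_funM => //; apply: measurable_funX.
exact: measurable_funB.
Qed.

Lemma measurable_young : measurable_fun [set: R' * R'] (fun z : R' * R' => k z.2 * Y z.2 (u z.1) (u (z.1 + z.2))).
Proof.
apply: measurable_funM => //.
rewrite (_ : (fun z => _) = (fun z : R' * R' => Psi z.2 (u z.1) + Psi (- z.2) (u (z.1 + z.2)) + (u z.1 - u (z.1 + z.2)) ^+ 2 / 2)).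
  apply: measurable_funD; first by apply: measurable_funD; exact: m_Psi.
  by apply: measurable_funM => //; apply: measurable_funX; exact: measurable_funB.
by apply/funext => z; rewrite youngE.
Qed.

Let h0 d s : 0 <= h d s. Proof. exact: potential_bounds. Qed.
Let Y0 d s s' : 0 <= Y d s s'. Proof. exact: young_ge0. Qed.

Lemma interaction_shift :
  ((2^-1)%:E * \int[mu]_x \int[mu]_x' ((u x - u x') ^+ 2 * k (x - x'))%:E =
   \int[mu]_x \int[mu]_d (k d * ((u x - u (x + d)) ^+ 2 / 2))%:E)%E.
Proof.
pose q (z : R' * R') : \bar R := ((u z.1 - u z.2) ^+ 2 * k (z.1 - z.2))%:E.
have mq : measurable_fun setT q.
  apply/measurable_EFinP; apply: measurable_funM.
    apply: measurable_funX; apply: measurable_funB => //.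
    exact: (measurableT_comp m_u measurable_snd).
  apply: (measurableT_comp mk (g := fun z : R' * R' => (z.1 - z.2 : R))).
  by apply: measurable_funB; [exact: measurable_fst|exact: measurable_snd].
have q0 z : (0 <= q z)%E by rewrite lee_fin mulr_ge0// sqr_ge0.
rewrite -ge0_integralZl//; last 2 first.
- exact: (measurable_fun_partial_integral mu measurableT mq q0).
- by move=> x _; apply: integral_ge0 => x' _; exact: (q0 (x, x')).
apply: eq_integral => x _.
have mqx : measurable_fun setT (fun x' => q (x, x')) by exact: (measurableT_comp mq (measurable_pair1 x)).
rewrite -ge0_integralZl//; last by move=> x' _; exact: (q0 (x, x')).
rewrite -(integral_shift x (f := fun x' => ((2^-1)%:E * q (x, x'))%E)); last exact: measurable_funeM.
apply: eq_integral => d _; rewrite /q/= -EFinM; congr EFin.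
rewrite (addrC d x) (_ : x - (x + d) = - d); last by ring.
by rewrite kN; ring.
Qed.

(** The first potential in the Young term is already there, and the second is moved
from [u (x + d)] to [u x], at the cost of a telescoping difference. *)
Lemma young_split d x : h d (u x) + (u x - u (x + d)) ^+ 2 / 2 =
  Y d (u x) (u (x + d)) + (Psi (- d) (u x) - Psi (- d) (u (x + d))).
Proof. by rewrite youngE /well_part; ring. Qed.

Lemma fiber_energy d :
  (\int[mu]_x (h d (u x) + (u x - u (x + d)) ^+ 2 / 2)%:E =
   \int[mu]_x (Y d (u x) (u (x + d)))%:E + (drift d)%:E)%E.
Proof.
have cP : continuous (Psi (- d)) by exact: continuous_potential.
have [_ uNy uy] := Hu.
apply: (@telescoping _ (Psi (- d) \o u) d _ _ ((a + a) * (a + a))).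
- exact: measurableT_comp (m_P _) m_u.
- by move=> x; exact: potential_le.
- exact: (cvg_comp _ _ uNy (cP _)).
- exact: (cvg_comp _ _ uy (cP _)).
- apply: measurable_funD.
    by apply: measurable_funD; exact: (measurableT_comp (m_P _) m_u).
  by apply: measurable_funM => //; apply: measurable_funX; exact: measurable_funB.
- rewrite (_ : (fun x => _) = (fun x => Psi d (u x) + Psi (- d) (u (x + d)) + (u x - u (x + d)) ^+ 2 / 2)).
    apply: measurable_funD.
      apply: measurable_funD; first exact: (measurableT_comp (m_P _) m_u).
      exact: (measurableT_comp (m_P _) (m_ud d)).
    by apply: measurable_funM => //; apply: measurable_funX; exact: (measurable_funB m_u (m_ud d)).
  by apply/funext => x; rewrite youngE.
- by move=> x; rewrite addr_ge0// divr_ge0// sqr_ge0.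
- by [].
- by move=> x; rewrite young_split.
Qed.

(** The part of the energy that measures how far [u] is from following the transport
of the front. *)
Definition defect := (\int[mu]_d \int[mu]_x (k d * Y d (u x) (u (x + d)))%:E)%E.

Lemma measurable_drift : measurable_fun [set: R] drift.
Proof.
have m_Psi_s s : measurable_fun [set: R] (fun d : R => Psi (- d) s).
  apply: (measurableT_comp (measurable_potential Hg) (g := fun d : R => (- d, s))).
  by apply/measurable_fun_pairP; split => /=; [exact: oppr_measurable|exact: measurable_cst].
by apply: measurable_funM => //; exact: measurable_funB.
Qed.

(** [fiber_energy] is integrated over the displacements [d]. Only nonnegative
functions occur, so that Tonelli's theorem needs no integrability of [u]. *)
Lemma split_energy : (forall d, 0 <= drift d) ->
  (\int[mu]_x (\int[mu]_d (k d * h d (u x))%:E) +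
   \int[mu]_x \int[mu]_d (k d * ((u x - u (x + d)) ^+ 2 / 2))%:E =
   defect + \int[mu]_d (k d * drift d)%:E)%E.
Proof.
move=> drift0.
pose p (z : R' * R') : \bar R := (k z.2 * h z.2 (u z.1))%:E.
pose q (z : R' * R') : \bar R := (k z.2 * ((u z.1 - u (z.1 + z.2)) ^+ 2 / 2))%:E.
pose y (z : R' * R') : \bar R := (k z.2 * Y z.2 (u z.1) (u (z.1 + z.2)))%:E.
have mp : measurable_fun setT p by exact/measurable_EFinP.
have mq : measurable_fun setT q by exact/measurable_EFinP.
have my : measurable_fun setT y by apply/measurable_EFinP; exact: measurable_young.
have p0 z : (0 <= p z)%E by rewrite lee_fin mulr_ge0.
have q0 z : (0 <= q z)%E by rewrite lee_fin mulr_ge0// divr_ge0// sqr_ge0.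
have y0 z : (0 <= y z)%E by rewrite lee_fin mulr_ge0.
have E1 : (\int[mu]_x \int[mu]_d p (x, d) + \int[mu]_x \int[mu]_d q (x, d) =
    \int[mu]_x \int[mu]_d (p \+ q) (x, d))%E.
  rewrite -ge0_integralD//; last 4 first.
  - by move=> x _; apply: integral_ge0 => d _; exact: p0.
  - exact: (measurable_fun_partial_integral mu measurableT mp p0).
  - by move=> x _; apply: integral_ge0 => d _; exact: q0.
  - exact: (measurable_fun_partial_integral mu measurableT mq q0).
  apply: eq_integral => x _; rewrite -ge0_integralD//.
  - exact: (measurableT_comp mp (measurable_pair1 x)).
  - exact: (measurableT_comp mq (measurable_pair1 x)).
rewrite [LHS]E1 (@ge0_integral_swap _ _ _ _ _ mu mu setT setT (p \+ q)%E)//; last 2 first.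
- exact: emeasurable_funD.
- by move=> z; rewrite adde_ge0.
pose y' (z : R' * R') := y (z.2, z.1).
have my' : measurable_fun setT y'.
  by apply: (measurableT_comp my); apply/measurable_fun_pairP; split => /=; [exact: measurable_snd|exact: measurable_fst].
have my'1 : measurable_fun setT (fun d => \int[mu]_x y' (d, x))%E.
  by apply: (measurable_fun_partial_integral mu measurableT my') => z; exact: y0.
rewrite /defect -[RHS]ge0_integralD//; last 3 first.
- by move=> d _; apply: integral_ge0 => x _; exact: (y0 (x, d)).
- by move=> d _; rewrite lee_fin mulr_ge0.
- by apply/measurable_EFinP; apply: measurable_funM => //; exact: measurable_drift.
apply: eq_integral => d _.
have mf : measurable_fun [set: R] (fun x => (h d (u x) + (u x - u (x + d)) ^+ 2 / 2)%:E).
  apply/measurable_EFinP/measurable_funD.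
    by apply: measurable_funD; exact: (measurableT_comp (m_P _) m_u).
  by apply: measurable_funM => //; apply: measurable_funX; exact: measurable_funB.
have f0 x : (0 <= (h d (u x) + (u x - u (x + d)) ^+ 2 / 2)%:E)%E.
  by rewrite lee_fin addr_ge0// divr_ge0// sqr_ge0.
transitivity ((k d)%:E * \int[mu]_x (h d (u x) + (u x - u (x + d)) ^+ 2 / 2)%:E)%E.
  rewrite -ge0_integralZl//; last by rewrite lee_fin.
  by apply: eq_integral => x _; rewrite /p /q -EFinM [in RHS]mulrDr.
rewrite fiber_energy ge0_muleDr; last 2 first.
- by apply: integral_ge0 => x _; rewrite lee_fin.
- by rewrite lee_fin.
congr (_ + _)%E.
rewrite -ge0_integralZl//.
- rewrite (_ : (fun x => _) = (fun x => (Psi d (u x) + Psi (- d) (u (x + d)) + (u x - u (x + d)) ^+ 2 / 2)%:E)).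
    apply/measurable_EFinP/measurable_funD.
      apply: measurable_funD; first exact: (measurableT_comp (m_P _) m_u).
      exact: (measurableT_comp (m_P _) (m_ud d)).
    by apply: measurable_funM => //; apply: measurable_funX; exact: (measurable_funB m_u (m_ud d)).
  by apply/funext => x; rewrite youngE.
- by move=> x _; rewrite lee_fin.
- by rewrite lee_fin.
Qed.

Let measurable_well : measurable_fun setT (fun x => \int[mu]_d (k d * h d (u x))%:E)%E.
Proof.
apply: (measurable_fun_partial_integral mu measurableT (f := fun z : R' * R' => (k z.2 * h z.2 (u z.1))%:E)).
  exact/measurable_EFinP.
by move=> z; rewrite lee_fin mulr_ge0.
Qed.

Let measurable_F : measurable_fun setT F.
Proof.
case: HF => dF _ _ _ _; apply: continuous_measurable_fun => x.
by apply/differentiable_continuous/derivable1_diffP.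
Qed.

Lemma energy_lower_bound : (forall d, 0 <= drift d) ->
  (defect + \int[mu]_d (k d * drift d)%:E <= energy_1d F k u)%E.
Proof.
move=> drift0; rewrite -split_energy// /energy_1d interaction_shift.
apply: leeD => //; apply: ge0_le_integral => //.
- by move=> x _; apply: integral_ge0 => d _; rewrite lee_fin mulr_ge0.
- by apply/measurable_EFinP; exact: measurableT_comp.
- by move=> x _; exact: (well_part_le a0 Hg HF k0 kN mk Mk bal).
Qed.

Lemma energy_formula : (forall d, 0 <= drift d) -> (forall x, - a <= u x <= a) ->
  (energy_1d F k u = defect + \int[mu]_d (k d * drift d)%:E)%E.
Proof.
move=> drift0 ua; rewrite -split_energy// /energy_1d interaction_shift.
congr (_ + _)%E; apply: eq_integral => x _.
by rewrite (well_part_eq a0 Hg HF k0 kN mk Mk bal).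
Qed.

End competitor.

Lemma front_admissible : admissible_1d a g.
Proof.
by case: Hg => cg _ gNy gy; split => //; exact: continuous_measurable_fun.
Qed.

(** The front follows its own transport. *)
Lemma front_young d x : Y d (g x) (g (x + d)) = 0.
Proof. by rewrite -(transport_front Hg) young_graph. Qed.

(** [fiber_energy] for the front itself, whose Young terms vanish, expresses the
drift as the integral of a nonnegative function. *)
Lemma drift_ge0 d : 0 <= drift d.
Proof.
have := fiber_energy front_admissible d.
rewrite [X in (_ = X + _)%E](_ : _ = 0%E); last first.
  by rewrite integral0_eq// => x _; rewrite front_young.
rewrite add0e => E; rewrite -lee_fin -E; apply: integral_ge0 => x _.
by rewrite lee_fin addr_ge0 ?potential_bounds// divr_ge0// sqr_ge0.
Qed.

Lemma front_energy : (energy_1d F k g = \int[mu]_d (k d * drift d)%:E)%E.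
Proof.
rewrite (energy_formula front_admissible drift_ge0); last first.
  by move=> x; have /andP[? ?] := front_bounds Hg x; rewrite !ltW.
rewrite /defect integral0_eq ?add0e// => d _; rewrite integral0_eq// => x _.
by rewrite front_young mulr0.
Qed.

Lemma defect_ge0 u : (0 <= defect u)%E.
Proof.
apply: integral_ge0 => d _; apply: integral_ge0 => x _.
by rewrite lee_fin mulr_ge0// young_ge0.
Qed.

Lemma front_minimizer : minimizer_1d a F k g.
Proof.
split; first exact: front_admissible.
move=> u Hu; apply: (le_trans _ (energy_lower_bound Hu drift_ge0)).
by rewrite front_energy leeDr// defect_ge0.
Qed.

Lemma front_energy_fin : (\int[mu]_d (k d * drift d)%:E \is a fin_num)%E.
Proof.
pose C := `|rho| * ((a + a) * (a + a) + (a + a) * (a + a)).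
have C0 : 0 <= C by rewrite mulr_ge0// addr_ge0// mulr_ge0// addr_ge0// ltW.
rewrite ge0_fin_numE; last first.
  by apply: integral_ge0 => d _; rewrite lee_fin mulr_ge0// drift_ge0.
apply: (@le_lt_trans _ _ (\int[mu]_d (C%:E * (k d)%:E))%E); last first.
  rewrite ge0_integralZl ?Mk -?EFinM ?ltry//.
  - exact/measurable_EFinP.
  - by move=> d _; rewrite lee_fin.
apply: ge0_le_integral => //.
- by move=> d _; rewrite lee_fin mulr_ge0// drift_ge0.
- by apply/measurable_EFinP; apply: measurable_funM => //; exact: measurable_drift.
- by apply/measurable_EFinP; apply: measurable_funM.
move=> d _; rewrite -EFinM lee_fin mulrC.
have [dr|/krho ->] := leP `|d| rho; last by rewrite !mulr0.
apply: ler_wpM2r => //; rewrite (le_trans (ler_norm _))// normrM.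
apply: ler_pM => //; first by rewrite (le_trans dr)// ler_norm.
by rewrite (le_trans (ler_normB _ _))// lerD// potential_le.
Qed.

(** The front realizes the lower bound, and this bound is finite, so it can be
cancelled. *)
Lemma minimizer_defect u : minimizer_1d a F k u -> defect u = 0%E.
Proof.
move=> [Hu umin]; have := le_trans (energy_lower_bound Hu drift_ge0) (umin _ front_admissible).
rewrite front_energy -[X in (_ <= X)%E]add0e leeD2rE ?front_energy_fin// => d0.
by apply/eqP; rewrite eq_le d0 defect_ge0.
Qed.

End energy.

(** * Uniqueness of the one-dimensional minimizer *)

Section almost_everywhere.
Variable R : realType.
Local Notation mu := (@lebesgue_measure R).

Lemma ae_exists_itv (P : R -> Prop) (x y : R) : x < y -> {ae mu, forall z, P z} ->
  exists2 z, x < z < y & P z.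
Proof.
move=> xy [N [mN N0 PN]]; apply: contrapT => H.
have : (mu `]x, y[ <= mu N)%E.
  apply: le_measure; rewrite ?inE//.
  move=> z; rewrite /= in_itv/= => zxy; apply: PN => /= Pz.
  by apply: H; exists z.
by rewrite N0 leNgt => /negP; apply; exact: lebesgue_itv_gt0.
Qed.

Lemma ae_mono (P Q : R -> Prop) : (forall z, P z -> Q z) ->
  {ae mu, forall z, P z} -> {ae mu, forall z, Q z}.
Proof. exact: (@filterS _ _ (ae_filter_ringOfSetsType mu)). Qed.

Lemma ae_mono2 (P Q S : R -> Prop) : (forall z, P z -> Q z -> S z) ->
  {ae mu, forall z, P z} -> {ae mu, forall z, Q z} -> {ae mu, forall z, S z}.
Proof. exact: (@filterS2 _ _ (ae_filter_ringOfSetsType mu)). Qed.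

Lemma ae_shift (P : R -> Prop) (c : R) : {ae mu, forall z, P (z + c)} -> {ae mu, forall z, P z}.
Proof.
move=> [N [mN N0 PN]]; exists ((fun z => z + - c) @^-1` N); split.
- rewrite -[X in measurable X]setTI; exact: (@measurable_addr R (- c) measurableT N mN).
- by rewrite (lebesgue_shift (- c) mN).
- by move=> z /= nP; apply: PN => /=; rewrite subrK.
Qed.

Lemma ae_oppr (P : R -> Prop) : {ae mu, forall z, P (- z)} -> {ae mu, forall z, P z}.
Proof.
move=> [N [mN N0 PN]]; exists (-%R @^-1` N); split.
- rewrite -[X in measurable X]setTI; exact: (@oppr_measurable R setT measurableT N mN).
- by rewrite (lebesgue_oppr mN).
- by move=> z /= nP; apply: PN => /=; rewrite opprK.
Qed.

(** The set where two continuous functions differ is open, and a null set contains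
no interval. *)
Lemma ae_eq_continuous (f h : R -> R) : continuous f -> continuous h ->
  {ae mu, forall z, f z = h z} -> forall z, f z = h z.
Proof.
move=> cf ch fh z; apply/eqP; apply: contrapT => /negP ne.
have c : continuous (fun z => f z - h z) by move=> t; apply: cvgB; [exact: cf|exact: ch].
have /cvgrPdist_lt/(_ `|f z - h z|) := c z.
rewrite normr_gt0 subr_eq0 => /(_ ne)/nbhs_ballP[e /= e0 H].
have [|t /andP[t1 t2] ft] := @ae_exists_itv _ (z - e) (z + e) _ fh.
  by rewrite ltrD2l gtrN.
have tz : ball z e t by rewrite /ball/= ltr_distlC t1 t2.
by have := H t tz; rewrite /= ft subrr subr0 ltxx.
Qed.

Lemma ge0_integral_eq0_ae (f : R -> R) : measurable_fun setT f -> (forall x, 0 <= f x) ->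
  (\int[mu]_x (f x)%:E = 0)%E -> {ae mu, forall x, f x = 0}.
Proof.
move=> mf f0 H.
have mE : measurable_fun [set: measurableTypeR R] (EFin \o f) by exact/measurable_EFinP.
have : (\int[mu]_x `|(EFin \o f) x| = 0)%E.
  by rewrite -[RHS]H; apply: eq_integral => x _; rewrite gee0_abs// lee_fin.
move=> /(ae_eq_integral_abs mu measurableT mE); apply: filterS => x /(_ I)[].
by [].
Qed.
End almost_everywhere.

Section uniqueness.
Variables (R : realType) (a : R) (g F k : R -> R) (M rho r : R).
Hypothesis a0 : 0 < a.
Hypothesis Hg : front a g.
Hypothesis HF : even_double_well a F.
Local Notation mu := (@lebesgue_measure R).
Local Notation R' := (measurableTypeR R).
Local Notation w := (front_inv a g).
Local Notation phi := (transport a g).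
Local Notation Y := (young a g).
Hypothesis k0 : forall d, 0 <= k d.
Hypothesis kN : forall d, k (- d) = k d.
Hypothesis mk : measurable_fun setT k.
Hypothesis Mk : (\int[mu]_d (k d)%:E = M%:E)%E.
Hypothesis krho : forall d, rho < `|d| -> k d = 0.
Hypothesis bal : forall x, (\int[mu]_d (k d * (g (x + d) + a))%:E =
  (derive1 F (g x) / 2 + (g x + a) * M)%:E)%E.
Hypothesis r0 : 0 < r.
Hypothesis kpos : forall d, `|d| < r -> 0 < k d.

Section one_minimizer.
Variable u : R -> R.
Hypothesis Hu : minimizer_1d a F k u.

Let good x := {ae mu, forall z, `|z - x| < r -> u z = phi (z - x) (u x)}.

(** The defect vanishes and the kernel is positive near the origin, so for almost
every [x] the values of [u] near [x] are obtained by transport from [u x]. *)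
Lemma ae_good : {ae mu, forall x, good x}.
Proof.
have := minimizer_defect a0 Hg HF k0 kN mk Mk krho bal Hu.
pose y (z : R' * R') : R := k z.2 * Y z.2 (u z.1) (u (z.1 + z.2)).
have my : measurable_fun setT y by exact: (measurable_young Hg mk Hu.1).
have y0 z : 0 <= y z by rewrite mulr_ge0// young_ge0.
have my' : measurable_fun setT (EFin \o y) by exact/measurable_EFinP.
rewrite /defect -(@ge0_integral_swap _ _ _ _ _ mu mu setT setT (EFin \o y)%E)// => H.
have mI := measurable_fun_partial_integral mu measurableT my' (fun z => y0 z).
have H2 : (\int[mu]_x `|\int[mu]_d (y (x, d))%:E| = 0)%E.
  rewrite -[RHS]H; apply: eq_integral => x _; rewrite gee0_abs//.
  by apply: integral_ge0 => d _; rewrite lee_fin.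
have := (ae_eq_integral_abs mu measurableT mI).1 H2.
apply: filterS => x /(_ I)/= Hx.
apply: (@ae_shift _ (fun z => `|z - x| < r -> u z = phi (z - x) (u x)) x).
have myx : measurable_fun [set: R] (fun d => y (x, d)) by exact: (measurableT_comp my (measurable_pair1 x)).
have := ge0_integral_eq0_ae myx (fun d => y0 (x, d)) Hx.
apply: ae_mono => d; rewrite /y/= addrK => /eqP; rewrite mulf_eq0 => /orP[/eqP kd|/eqP yd] dr.
  by have := kpos dr; rewrite kd ltxx.
by rewrite addrC; exact: (young_eq0 a0 Hg yd).
Qed.

Lemma leaf_step x0 x1 z : u x1 = phi (x1 - x0) (u x0) -> u z = phi (z - x1) (u x1) ->
  u z = phi (z - x0) (u x0).
Proof. by move=> -> ->; rewrite (transportD Hg); congr phi; ring. Qed.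

(** Almost every point is good, so a good point can be found near each end of the
interval reached so far, and it extends this interval by [r / 2] at least. *)
Lemma ae_leaf : exists x0, {ae mu, forall z, u z = phi (z - x0) (u x0)}.
Proof.
have [x0 _ Gx0] := ae_exists_itv ltr01 ae_good.
exists x0.
pose b (n : nat) := r + n%:R * (r / 2).
have S n : {ae mu, forall z, `|z - x0| < b n -> u z = phi (z - x0) (u x0)}.
  elim: n => [|n IH]; first by move: Gx0; apply: ae_mono => z; rewrite /b mul0r addr0.
  pose p := n.+1%:R * (r / 2).
  have pb : p < b n.
    rewrite /p /b -natr1 mulrDl mul1r addrC ltrD2r ltr_pdivrMr//.
    by rewrite ltr_pMr// ltr1n.
  have bp : b n.+1 = r + p by [].
  have p0 : 0 <= p by rewrite mulr_ge0// divr_ge0// ltW.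
  have IG : {ae mu, forall x, good x /\ (`|x - x0| < b n -> u x = phi (x - x0) (u x0))}.
    by move: ae_good IH; apply: ae_mono2 => x.
  have pos : x0 + p < x0 + b n by rewrite ltrD2l.
  have neg : x0 - b n < x0 - p by rewrite ltrD2l ltrN2.
  have [x1 /andP[x11 x12] [G1 E1]] := ae_exists_itv pos IG.
  have [x2 /andP[x21 x22] [G2 E2]] := ae_exists_itv neg IG.
  have {}E1 : u x1 = phi (x1 - x0) (u x0).
    apply: E1; rewrite ger0_norm ?ltrBlDl// subr_ge0.
    by rewrite (le_trans _ (ltW x11))// lerDl.
  have {}E2 : u x2 = phi (x2 - x0) (u x0).
    apply: E2; rewrite distrC ger0_norm; first by rewrite ltrBlDr -ltrBlDl.
    by rewrite subr_ge0 (le_trans (ltW x22))// gerBl.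
  have G12 : {ae mu, forall z, (`|z - x1| < r -> u z = phi (z - x1) (u x1)) /\ (`|z - x2| < r -> u z = phi (z - x2) (u x2))}.
    by move: (G1) (G2); apply: ae_mono2.
  move: IH G12; apply: ae_mono2 => z IH [H1 H2] zb.
  have [zn|nz] := ltP `|z - x0| (b n); first exact: IH.
  have [zx|xz] := leP z x0.
    apply: (leaf_step E2); apply: H2.
    move: nz zb; rewrite distrC ger0_norm ?subr_ge0// bp => nz zb.
    by rewrite ltr_distlC; apply/andP; split; lra.
  apply: (leaf_step E1); apply: H1.
  move: nz zb; rewrite ger0_norm ?subr_ge0 ?(ltW xz)// bp => nz zb.
  by rewrite ltr_distl; apply/andP; split; lra.
have : {ae mu, forall z, forall n, `|z - x0| < b n -> u z = phi (z - x0) (u x0)}.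
  exact/ae_foralln.
apply: ae_mono => z Hz.
have [n nb] : exists n : nat, `|z - x0| / (r / 2) < n.+1%:R.
  by exists (Num.truncn (`|z - x0| / (r / 2))); exact: truncnS_gt.
apply: (Hz n.+1); rewrite (lt_trans _ (_ : n.+1%:R * (r / 2) < _))//.
  by rewrite -ltr_pdivrMr// divr_gt0.
by rewrite /b ltrDr.
Qed.

(** If [u x0] is in the range of the front, then [u] is a translate of the front.
Otherwise the transport does not move it, and [u] would be constant, against its
limits. *)
Lemma minimizer_translate : exists t, {ae mu, forall z, u z = g (z + t)}.
Proof.
have [x0 Hx0] := ae_leaf.
have [sa|sa] := boolP (- a < u x0 < a).
  exists (w (u x0) - x0); move: Hx0; apply: ae_mono => z ->.
  by rewrite /transport sa; congr g; ring.
have const : {ae mu, forall z, u z = u x0}.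
  by move: Hx0; apply: ae_mono => z ->; rewrite transport_out.
have [[_ uNy uy] _] := Hu.
have h1 : 0 < u x0.
  have /(cvgr_gt _ uy) H := a0.
  have [A HA] : exists A, forall z, A < z -> 0 < u z by case: H => A [_ HA]; exists A.
  have [z /andP[Az _] <-] : exists2 z, A < z < A + 1 & u z = u x0.
    by apply: ae_exists_itv => //; rewrite ltrDl.
  exact: HA.
have h2 : u x0 < 0.
  have /(cvgr_lt _ uNy) H : - a < 0 by rewrite oppr_lt0.
  have [A HA] : exists A, forall z, z < A -> u z < 0 by case: H => A [_ HA]; exists A.
  have [z /andP[_ Az] <-] : exists2 z, A - 1 < z < A & u z = u x0.
    by apply: ae_exists_itv => //; rewrite gtrBl.
  exact: HA.
by have := lt_trans h1 h2; rewrite ltxx.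
Qed.

End one_minimizer.

Lemma shifted_front c : front a (fun x => g (x + c)).
Proof.
case: Hg => cg gm gNy gy; split.
- by move=> x; apply: (@continuous_comp _ _ _ (fun x : R => x + c) g); [apply: cvgD; [exact: cvg_id|exact: cvg_cst]|exact: cg].
- by move=> x y xy; apply: gm; rewrite ltrD2r.
- apply: (cvg_comp _ _ _ gNy); apply/cvgrNyPle => A.
  near=> x; rewrite -lerBrDr; near: x; apply: nbhs_ninfty_le; exact: num_real.
- apply: (cvg_comp _ _ _ gy); apply/cvgryPge => A.
  near=> x; rewrite -lerBlDr; near: x; apply: nbhs_pinfty_ge; exact: num_real.
Unshelve. all: by end_near. Qed.

Lemma shifted_balance c x : (\int[mu]_d (k d * (g (x + d + c) + a))%:E =
  (derive1 F (g (x + c)) / 2 + (g (x + c) + a) * M)%:E)%E.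
Proof. by rewrite -bal; apply: eq_integral => d _; rewrite addrAC. Qed.

Lemma reflected_front : front a (fun x => - g (- x)).
Proof.
case: Hg => cg gm gNy gy; split.
- move=> x; apply: cvgN; apply: (@continuous_comp _ _ _ -%R g); [exact: opp_continuous|exact: cg].
- by move=> x y xy; rewrite ltrN2 gm// ltrN2.
- by apply: cvgN; apply/(cvgy_compNP g (nbhs a)).
- by rewrite -[X in _ --> X]opprK; apply: cvgN; apply/(cvgNy_compNP g (nbhs (- a))).
Qed.

Lemma well_derive_odd s : derive1 F (- s) = - derive1 F s.
Proof.
case: HF => dF FN _ _ _.
have dFs (t : R) : is_derive t 1 F (derive1 F t).
  by rewrite derive1E; exact: derivableP.
have h : is_derive s 1 (F \o -%R) (derive1 F (- s) * -1).
  by apply: is_derive1_comp.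
have E : F \o -%R = F by apply/funext => x; rewrite /= FN.
move: h; rewrite E => h.
have [_ e1] := h; have [_ e2] := dFs s.
by rewrite -e2 e1 mulrN1 opprK.
Qed.

(** With [d] reversed, the left side and the balance of [g] at [- x] add up to
[2 * a * M], since [(a - s) + (s + a) = 2 * a]; and the derivative of [F] is odd. *)
Lemma reflected_balance x : (\int[mu]_d (k d * (- g (- (x + d)) + a))%:E =
  (derive1 F (- g (- x)) / 2 + (- g (- x) + a) * M)%:E)%E.
Proof.
have mg : measurable_fun [set: R] g by case: Hg => cg _ _ _; exact: continuous_measurable_fun.
have mgx : measurable_fun [set: R] (fun d : R => g (- x + d)).
  by apply: (measurableT_comp mg); exact: measurable_funD.
have gb y : - a <= g y <= a by have /andP[h1 h2] := front_bounds Hg y; rewrite !ltW.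
have mf1 : measurable_fun [set: R] (fun d => (k d * (a - g (- x + d)))%:E).
  by apply/measurable_EFinP; apply: measurable_funM => //; exact: measurable_funB.
have mf2 : measurable_fun [set: R] (fun d => (k d * (g (- x + d) + a))%:E).
  by apply/measurable_EFinP; apply: measurable_funM => //; exact: measurable_funD.
transitivity (\int[mu]_d (k d * (a - g (- x + d)))%:E)%E.
  rewrite -[RHS]integral_oppr//; apply: eq_integral => d _.
  by rewrite kN opprD (addrC a).
have : (\int[mu]_d (k d * (a - g (- x + d)))%:E + \int[mu]_d (k d * (g (- x + d) + a))%:E =
    ((a + a) * M)%:E)%E.
  rewrite -ge0_integralD//.
  - rewrite EFinM -Mk -ge0_integralZl//.
    + by apply: eq_integral => d _; rewrite -EFinD -EFinM; congr EFin; ring.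
    + exact/measurable_EFinP.
    + by move=> d _; rewrite lee_fin.
    + by rewrite lee_fin addr_ge0// ltW.
  - by move=> d _; rewrite lee_fin mulr_ge0// subr_ge0; have /andP[] := gb (- x + d).
  - by move=> d _; rewrite lee_fin mulr_ge0// -lerBlDr sub0r; have /andP[] := gb (- x + d).
rewrite bal well_derive_odd.
case: (\int[mu]_d (k d * (a - g (- x + d)))%:E)%E => [q| |]//= [] E.
congr EFin; lra.
Qed.

(** The reflected front solves the same equation, hence is a minimizer, hence
[- g (- x) = g (x + t)] for some [t]; the translate by [t / 2] is then odd.
A translate of a strictly increasing front has only one zero, so no other one is
odd. *)
Lemma antisymmetric_translate : exists t,
  the_antisymmetric_minimizer_1d a F k (fun x => g (x + t)).
Proof.
have [t0 Ht0] := minimizer_translate (front_minimizer a0 reflected_front HF k0 kN mk Mk reflected_balance).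
have cg c : continuous (fun x => g (x + c)) by case: (shifted_front c).
have refl z : - g (- z) = g (z + t0).
  have cr : continuous (fun x => - g (- x)) by case: reflected_front.
  exact: (ae_eq_continuous cr (cg t0) Ht0).
have odd z : g (- z + t0 / 2) = - g (z + t0 / 2).
  rewrite -[LHS]opprK; congr (- _); rewrite (_ : - z + t0 / 2 = - (z - t0 / 2)); last by ring.
  by rewrite refl; congr g; field.
exists (t0 / 2); split; first split.
- exact: (front_minimizer a0 (shifted_front _) HF k0 kN mk Mk (shifted_balance _)).
- by apply: aeW => z; exact: odd.
move=> u [minu oddu]; have [s Hs] := minimizer_translate minu.
have Hs' : {ae mu, forall z, u (- z) = g (- z + s)}.
  by apply: ae_oppr; move: Hs; apply: ae_mono => z; rewrite opprK.
have Hs2 : {ae mu, forall z, u (- z) = - g (z + s)}.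
  by move: oddu Hs; apply: ae_mono2 => z -> ->.
have Hodd : {ae mu, forall z, g (- z + s) = - g (z + s)}.
  by move: Hs' Hs2; apply: ae_mono2 => z <- <-.
have co : continuous (fun z => g (- z + s)).
  move=> z; apply: (@continuous_comp _ _ _ (fun x : R => - x + s) g).
    by apply: cvgD; [exact: opp_continuous|exact: cvg_cst].
  by case: Hg => cg0 _ _ _; exact: cg0.
have cn : continuous (fun z => - g (z + s)) by move=> z; apply: cvgN; exact: cg.
have := ae_eq_continuous co cn Hodd 0; have := odd 0; rewrite oppr0 !add0r => e1 e2.
have gg : g s = g (t0 / 2) by lra.
have -> : t0 / 2 = s by rewrite -[LHS](frontK Hg) -gg (frontK Hg).
by move: Hs; apply: ae_mono.
Qed.

End uniqueness.

(** * The one-dimensional kernel, and conclusion *)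

Section one_dimensional_kernel.
Variables (R : realType) (L : R) (n : nat) (U : R -> R).
Hypothesis L0 : 0 < L.
Hypothesis HU : interaction_profile U.
Local Notation j := (@J R U L n).
Local Notation T := (n.-tuple R).
Local Notation mu := (@lebesgue_measure R).
Local Notation lam := (lebesgue_tuple R n).
Local Notation k := (J1 U L n).
Let t0 : T := [tuple 0 | i < n].
Let row0 : row_of t0 = 0.
Proof. by apply/rowP => i; rewrite !mxE tnth_mktuple. Qed.

Let mJ : measurable_fun setT (fun z : measurableTypeR R * T => (j z.1 (row_of z.2))%:E).
Proof.
apply/measurable_EFinP.
have := measurable_J L HU measurable_fst (@measurable_cst _ _ _ _ setT t0)
  (@measurable_snd _ _ (measurableTypeR R) T).
rewrite (_ : (fun s => _) = (fun z => j z.1 (row_of z.2)))//.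
by apply/funext => z; rewrite row0 sub0r JNy.
Qed.

Let mJx d : measurable_fun setT (fun t : T => j d (row_of t)).
Proof. by apply/measurable_EFinP; exact: (measurableT_comp mJ (measurable_pair1 d)). Qed.

Lemma J1_lty d : (\int[lam]_(t in cube L n) (j d (row_of t))%:E < +oo)%E.
Proof.
apply: (@bounded_integral_lty _ _ _ _ _ _ (U 0)) => //.
- exact: measurable_cube.
- exact: lebesgue_cube_finite.
- exact: measurable_funTS.
- by move=> t _; rewrite (J_ge0 L HU) (J_le L HU).
Qed.

Lemma J1E d : (k d)%:E = (\int[lam]_(t in cube L n) (j d (row_of t))%:E)%E.
Proof.
rewrite /J1 /Rintegral fineK// ge0_fin_numE ?J1_lty//.
by apply: integral_ge0 => t _; rewrite lee_fin (J_ge0 L HU).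
Qed.

Lemma J1_ge0 d : 0 <= k d.
Proof. by rewrite -lee_fin J1E; apply: integral_ge0 => t _; rewrite lee_fin (J_ge0 L HU). Qed.

Lemma J1N d : k (- d) = k d.
Proof. by rewrite /J1; apply: eq_Rintegral => t _; rewrite JNx. Qed.

Lemma measurable_J1 : measurable_fun setT k.
Proof.
apply/measurable_EFinP; rewrite (_ : _ \o _ = (fun d => \int[lam]_(t in cube L n) (j d (row_of t))%:E)%E).
  apply: (@measurable_fun_partial_integral _ _ (measurableTypeR R) T _ lam (cube L n) (fun z => (j z.1 (row_of z.2))%:E)) => //.
    exact: measurable_cube.
  by move=> z; rewrite lee_fin (J_ge0 L HU).
by apply/funext => d; rewrite -J1E.
Qed.

Lemma J1_finite_range : exists rho : R, forall d, rho < `|d| -> k d = 0.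
Proof.
have [rho _ H] := J_finite_range L n HU; exists rho => d dr.
rewrite /J1; under eq_Rintegral do rewrite H//.
by rewrite /Rintegral integral0.
Qed.

Lemma J1_pos (r c : R) : 0 < r -> 0 < c ->
  (forall x (y : 'rV[R]_n), `|x| < r -> (forall i, `|y ord0 i| < r) -> c <= j x y) ->
  forall d, `|d| < r -> 0 < k d.
Proof.
move=> r0 c0 Jpos d dr; rewrite -lte_fin J1E.
have ct0 : cube L n t0 by move=> i; rewrite tnth_mktuple lexx ltW.
apply: (@integral_gt0 _ _ _ _ _ (tuple_box t0 r `&` cube L n)).
- exact: measurable_cube.
- by apply: measurableI; [exact: measurable_tuple_box|exact: measurable_cube].
- by [].
- exact: lebesgue_tuple_box_gt0.
- by apply/measurable_EFinP; exact: measurable_funTS.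
- by move=> t _; rewrite lee_fin (J_ge0 L HU).
move=> t [tb _]; rewrite lte_fin (lt_le_trans c0)// Jpos// => i.
by have := tb i; rewrite !mxE tnth_mktuple subr0.
Qed.

(** Tonelli's theorem turns an integral over the strip that does not see [y] into
one against the integrated kernel. *)
Lemma integral_J1 (b : R -> R) : measurable_fun setT b -> (forall d, 0 <= b d) ->
  (\int[strip_measure n]_(z in [set: R] `*` cube L n) (j z.1 (0 - row_of z.2) * b z.1)%:E =
   \int[mu]_d (k d * b d)%:E)%E.
Proof.
move=> mb b0.
rewrite /strip_measure ge0_integral_setX//; last 3 first.
- exact: measurable_cube.
- apply/measurable_EFinP; apply: measurable_funM.
    by under eq_fun do rewrite sub0r JNy; apply/measurable_EFinP.
  exact: (measurableT_comp mb measurable_fst).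
- by move=> z; rewrite lee_fin mulr_ge0// (J_ge0 L HU).
apply: eq_integral => d _; rewrite EFinM J1E muleC -ge0_integralZl//.
- by apply: eq_integral => t _; rewrite sub0r JNy/= EFinM muleC.
- exact: measurable_cube.
- by apply: measurable_funTS; apply/measurable_EFinP.
- by move=> t _; rewrite lee_fin (J_ge0 L HU).
- by rewrite lee_fin.
Qed.

End one_dimensional_kernel.

Theorem theorem8p1 (R : realType) (a L : R) (d : nat) (F U : R -> R)
    (m : R -> 'rV[R]_d.-1 -> R) :
  0 < a -> 0 < L -> (2 <= d)%N ->
  even_double_well a F ->
  interaction_profile U ->
  (exists2 c : R, 0 < c &
     \forall p \near ((0, 0) : R * 'rV[R]_d.-1), c <= J U L p.1 p.2) ->
  in_M a L m ->
  euler_lagrange F U L m ->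
  exists2 mbar : R -> R,
    the_antisymmetric_minimizer_1d a F (J1 U L d.-1) mbar &
    exists x0 : R, forall (x : R) (y : 'rV[R]_d.-1), m x y = mbar (x - x0).
Proof.
move=> a0 L0 _ HF HU [c c0 /near_row_box[r r0 Jbox]] Hm EL.
set n := d.-1 in m Jbox Hm EL *.
have Jpos x (y : 'rV[R]_n) : `|x| < r -> (forall i, `|y ord0 i| < r) -> c <= J U L x y.
  by move=> xr yr; apply: (Jbox x y); [rewrite subr0|move=> i; rewrite mxE subr0].
pose g x := m x 0.
have flat x y : m x y = g x by exact: (planar a0 L0 HU Hm EL r0 c0 Jpos).
have Hg : front a g.
  case: (shifted_front_family a0 L0 HU Hm EL r0 c0 Jpos 0) => _ /(_ 0).
  by under eq_fun do rewrite addr0.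
pose t0 : n.-tuple R := [tuple 0 | i < n].
have row0 : row_of t0 = 0 by apply/rowP => i; rewrite !mxE tnth_mktuple.
pose M := fine (mass L U t0).
have mass0 : (\int[@lebesgue_measure R]_d (J1 U L n d)%:E = M%:E)%E.
  rewrite fineK ?mass_fin//.
  rewrite /mass row0.
  have := integral_J1 L n HU (b := fun=> 1) (measurable_cst _) (fun=> ler01).
  under eq_integral do rewrite mulr1; move=> ->.
  by apply: eq_integral => z _; rewrite mulr1.
have bal x : (\int[@lebesgue_measure R]_d (J1 U L n d * (g (x + d) + a))%:E =
    (derive1 F (g x) / 2 + (g x + a) * M)%:E)%E.
  have mg : measurable_fun [set: R] g by case: Hg => cg _ _ _; exact: continuous_measurable_fun.
  have mb : measurable_fun [set: R] (fun d : R => g (x + d) + a).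
    by apply: measurable_funD => //; apply: (measurableT_comp mg); exact: measurable_funD.
  rewrite -(integral_J1 L n HU mb); last first.
    by move=> e; rewrite -lerBlDr sub0r; have /andP[/ltW] := front_bounds Hg (x + e).
  have E := balance_formula a0 L0 HU Hm EL x t0 0; rewrite row0 addr0 in E.
  by rewrite -[RHS]E; apply: eq_integral => z _; rewrite flat.
have [rho krho] := J1_finite_range L n HU.
have [t Ht] := antisymmetric_translate a0 Hg HF (J1_ge0 L n HU) (J1N L n U) (measurable_J1 L n HU) mass0 krho bal r0 (J1_pos L0 HU r0 c0 Jpos).
exists (fun x => g (x + t)) => //.
by exists t => x y; rewrite flat subrK.
Qed.
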